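(* Let $\Omega\subsetneq\mathbb{C}$ be a convex domain with $1\in\Omega$ and let $P$ be a conformal map of $\mathbb{D}$ onto $\Omega$ with $P(z)=1+\alpha_1z+\alpha_2z^2+\cdots$. Let $(\lambda,\mu)\in\mathbb{C}^2$, and let $\gamma_1=\gamma_1(\lambda,\mu)$ and $\gamma_2=\gamma_2(\lambda,\mu)$ be given by $$\gamma_1=\frac{2\lambda}{\alpha_1},\qquad \gamma_2=\begin{cases}\dfrac{2\overline{\alpha_1}\{3\alpha_1^2\mu-2(\alpha_1^2+\alpha_2)\lambda^2\}}{\alpha_1^2(|\alpha_1|^2-4|\lambda|^2)}, & \text{if } |\gamma_1|<1,\\[2mm] 0, & \text{if } |\gamma_1|=1 \text{ and } 3\alpha_1^2\mu=2(\alpha_1^2+\alpha_2)\lambda^2,\\[1mm] \infty, & \text{if } |\gamma_1|=1\text{ and } 3\alpha_1^2\mu\neq2(\alpha_1^2+\alpha_2)\lambda^2.\end{cases}$$ For $z_0\in\mathbb{D}\setminus\{0\}$, consider the variability region $$V_{\mathcal{CV}(\Omega)}(z_0,\lambda,\mu):=\{\log f'(z_0): f\in\mathcal{CV}(\Omega)\text{ with }(a_2(f),a_3(f))=(\lambda,\mu)\}.$$ (i) If $|\gamma_1|=1$ and $\gamma_2=0$, then $V_{\mathcal{CV}(\Omega)}(z_0,\lambda,\mu)$ consists of the single point $w_0=\int_0^{z_0}\zeta^{-1}\{P(\gamma_1\zeta)-1\}\, d\zeta$. (ii) If $|\gamma_1|<1$ and $|\gamma_2|=1$, then $V_{\mathcal{CV}(\Omega)}(z_0,\lambda,\mu)$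 consists of the single point $w_0=\int_0^{z_0}\zeta^{-1}\{P(\zeta\sigma_{\gamma_1}(\gamma_2\zeta))-1\}\, d\zeta$. (iii) If $|\gamma_1|<1$ and $|\gamma_2|<1$, i.e., $(\lambda,\mu)\in\operatorname{Int}\mathcal{A}(3,\Omega)$, then $$Q_{\gamma_1,\gamma_2}(z_0,\varepsilon)=\int_0^{z_0}\zeta^{-1}\{P(\zeta\sigma_{\gamma_1}(\zeta\sigma_{\gamma_2}(\varepsilon\zeta)))-1\}\, d\zeta$$ is a convex, univalent, analytic function of $\varepsilon\in\overline{\mathbb{D}}$ and $$V_{\mathcal{CV}(\Omega)}(z_0,\lambda,\mu)=Q_{\gamma_1,\gamma_2}(z_0,\overline{\mathbb{D}}):=\{Q_{\gamma_1,\gamma_2}(z_0,\varepsilon):\varepsilon\in\overline{\mathbb{D}}\}.$$ Furthermore, for $|\varepsilon|=1$ and $f\in\mathcal{CV}(\Omega)$ with $(a_2(f),a_3(f))=(\lambda,\mu)$, the equality $\log f'(z_0)=Q_{\gamma_1,\gamma_2}(z_0,\varepsilon)$ holds if, and only if, $$f(z)=\int_0^z\exp\left[\int_0^{\zeta_1}\zeta_2^{-1}\left\{P(\zeta_2\sigma_{\gamma_1}(\zeta_2\sigma_{\gamma_2}(\varepsilon\zeta_2)))-1\right\} d\zeta_2\right] d\zeta_1,\quad z\in\mathbb{D}.$$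
   Context: $\mathbb{D}=\{z\in\mathbb{C}:|z|<1\}$, with closure $\overline{\mathbb{D}}$. For $a\in\mathbb{D}$, $\sigma_a(z)=\dfrac{z+a}{1+\overline{a}z}$. $\mathcal{A}_0$ denotes the class of analytic functions $f$ in $\mathbb{D}$ with $f(0)=f'(0)-1=0$. For a simply connected domain $\Omega$ with $1\in\Omega$, $$\mathcal{CV}(\Omega)=\left\{f\in\mathcal{A}_0: 1+z\frac{f''(z)}{f'(z)}\in\Omega \text{ for all } z\in\mathbb{D}\right\};$$ here $1+zf''/f'$ is required to be analytic in $\mathbb{D}$, so $f'$ has no zeros in $\mathbb{D}$. $\log f'$ is the single-valued analytic branch of the logarithm of $f'$ in $\mathbb{D}$ with $\log f'(0)=0$. For $k\in\mathbb{N}$, $a_k(f)=f^{(k)}(0)/k!$. $\mathcal{A}(3,\Omega)=\{(a_2(f),a_3(f))\in\mathbb{C}^2: f\in\mathcal{CV}(\Omega)\}$, and $\operatorname{Int}$ denotes the interior in $\mathbb{C}^2$. A conformal map of $\mathbb{D}$ onto $\Omega$ is an analytic bijection. ''Convex, univalent, analytic function of $\varepsilon\in\overline{\mathbb{D}}$'' means: analytic in a neighbourhood of $\overline{\mathbb{D}}$, injective on $\overline{\mathbb{D}}$, and mapping $\mathbb{D}$ onto a convex domain. Integrands $\zeta^{-1}\{\cdot\}$ have removable singularities at $0$. *)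

(* Defs.v *)
From Stdlib Require Import Reals Factorial.
From Coquelicot Require Import Coquelicot.

Open Scope C_scope.

Definition disk (z : C) : Prop := (Cmod z < 1)%R.
Definition cdisk (z : C) : Prop := (Cmod z <= 1)%R.

(** Analyticity is complex differentiability at every point; it is only used
    for open [U].  Functions on [U] are total functions [C -> C] whose values
    outside [U] are irrelevant: at points of an open [U], [ex_derive] and
    [C_derive] only depend on [f] near the point. *)
Definition analytic_on (U : C -> Prop) (f : C -> C) : Prop :=
  forall z, U z -> ex_derive f z.

Definition injective_on (U : C -> Prop) (f : C -> C) : Prop :=
  forall x y, U x -> U y -> f x = f y -> x = y.

Definition image (f : C -> C) (U : C -> Prop) (w : C) : Prop :=
  exists z, U z /\ f z = w.

(** Connectedness need not be required: it follows from convexity. *)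
Definition convex_domain (U : C -> Prop) : Prop :=
  open U /\ (exists z, U z) /\
  forall x y (t : R), U x -> U y -> (0 <= t <= 1)%R ->
    U ((1 - t) * x + t * y).

Definition conformal_map (P : C -> C) (Omega : C -> Prop) : Prop :=
  analytic_on disk P /\ injective_on disk P /\
  forall w, image P disk w <-> Omega w.

(** [f^(k)(0) / k!] *)
Definition coef (f : C -> C) (k : nat) : C :=
  Nat.iter k C_derive f 0 / INR (fact k).

Definition Csigma (a z : C) : C := (z + a) / (1 + Cconj a * z).

Definition Cexp (z : C) : C :=
  ((exp (Re z) * cos (Im z))%R, (exp (Re z) * sin (Im z))%R).

Definition class_A0 (f : C -> C) : Prop :=
  analytic_on disk f /\ f 0 = 0 /\ C_derive f 0 = 1.

Definition CV (Omega : C -> Prop) (f : C -> C) : Prop :=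
  class_A0 f /\
  forall z, disk z ->
    C_derive f z <> 0 /\
    Omega (1 + z * (C_derive (C_derive f) z / C_derive f z)).

(** [log_deriv f z w] says [log f'(z) = w], where [L] is the analytic branch
    of [log f'] on the unit disk with [L 0 = 0]. *)
Definition log_deriv (f : C -> C) (z w : C) : Prop :=
  exists L : C -> C,
    analytic_on disk L /\ L 0 = 0 /\
    (forall x, disk x -> Cexp (L x) = C_derive f x) /\ L z = w.

Definition coef_body (Omega : C -> Prop) (p : C * C) : Prop :=
  exists f, CV Omega f /\ (coef f 2, coef f 3) = p.

Definition variability_region (Omega : C -> Prop) (z0 lambda mu w : C) : Prop :=
  exists f, CV Omega f /\ (coef f 2, coef f 3) = (lambda, mu) /\
    log_deriv f z0 w.

(** Integral of [g] along the segment from [0] to [z]. *)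
Definition Cint (g : C -> C) (z : C) : C :=
  RInt (V := C_R_CompleteNormedModule) (fun t : R => z * g (t * z)) 0 1.

(** The removable singularity of the integrand at [0] needs no correction:
    it only affects the value at the end point [t = 0] of the segment. *)
Definition Pint (P omega : C -> C) (z : C) : C :=
  Cint (fun x => / x * (P (omega x) - 1)) z.

Definition Qint (P : C -> C) (g1 g2 z0 eps : C) : C :=
  Pint P (fun x => x * Csigma g1 (x * Csigma g2 (eps * x))) z0.

(** [gamma2] lives in the Riemann sphere [option C], with [None] for infinity;
    no value is prescribed when [Cmod gamma1 > 1]. *)
Definition is_gamma2 (alpha1 alpha2 lambda mu gamma1 : C) (gamma2 : option C) :
    Prop :=
  ((Cmod gamma1 < 1)%R ->
     gamma2 = Some
       (2 * Cconj alpha1 *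
          (3 * alpha1 ^ 2 * mu - 2 * (alpha1 ^ 2 + alpha2) * lambda ^ 2) /
        (alpha1 ^ 2 * (Cmod alpha1 ^ 2 - 4 * Cmod lambda ^ 2)%R))) /\
  (Cmod gamma1 = 1%R ->
     3 * alpha1 ^ 2 * mu = 2 * (alpha1 ^ 2 + alpha2) * lambda ^ 2 ->
     gamma2 = Some (RtoC 0)) /\
  (Cmod gamma1 = 1%R ->
     3 * alpha1 ^ 2 * mu <> 2 * (alpha1 ^ 2 + alpha2) * lambda ^ 2 ->
     gamma2 = None).

Definition convex_univalent_analytic_on_cdisk (F : C -> C) : Prop :=
  (exists U, open U /\ (forall e, cdisk e -> U e) /\ analytic_on U F) /\
  injective_on cdisk F /\
  convex_domain (image F disk).

(* Main.v *)
Require Import Defs.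
From Stdlib Require Import Reals Lra Lia Factorial ClassicalEpsilon ssreflect.
From Coquelicot Require Import Coquelicot.

(** By the Schwarz lemma, [f] is in [CV Omega] iff [1 + z f''/f' = P (z v(z))] for some [v]
    bounded by 1, and [(a_2, a_3)] fixes the first two Schur parameters of [v]; the remaining
    freedom is a function [psi] bounded by 1, with [psi = eps] constant giving [Qint eps].
    The heart is the inequality
      Re ((Qint eps - w_psi) / (eps Qint' eps)) >= 0   whenever |psi| <= |eps| <= 1,
    with equality only for [psi = eps], [w_psi] being the value of [log f'(z0)] for [psi].
    The integrands satisfy it pointwise, by Study's theorem that convex functions map
    subdisks onto convex sets.  It passes to the integrals by Sakaguchi's lemma: if [h] is
    starlike and [Re (N'/h') >= 0], then [Re (N/h) >= 0].  Here [h z = d/d eps (Qint z eps)],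
    which is starlike because [Re (1 + z h''/h') > 0].  The inequality yields injectivity of
    [Qint] at once; convexity of its image and the covering of the variability region follow
    from the mean value property of [eps Qint'/(Qint - w)]. *)

Open Scope C_scope.

(** Every quotient that occurs has a removable singularity at the origin, and this shapes the
    definitions. Changing [psi] in z sigma_g1(z sigma_g2(psi(z) z)) changes P of it by z^3 times a
    holomorphic function, one factor for each z; hence N and h both carry z^3, and N/h extends to 0
    as a quotient of averages [avg 2]. Comparing psi with eps under |psi| <= |eps|, and not only for
    |eps| = 1, lets the subdisks |eps| <= r be treated one by one, which is what injectivity on the
    closed disk and convexity of the image of the open disk require. At each z, N'/h' is up to the
    factor eps the support quotient at y = eps z of y -> P(z sigma_g1(z sigma_g2(y))), which is
    convex by two uses of Study's theorem. Starlikeness of h needs a lower bound on the logarithmic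
    derivative of h', a product of z^2, P' and two Moebius derivatives. These terms are not
    controlled separately, so a condition quantified over an auxiliary parameter of the closed disk,
    standing for P''/P', is carried through the layers. *)

Definition Cder (f : C -> C) (z l : C) : Prop := @is_derive C_AbsRing C_NormedModule f z l.
(** Curves are differentiated over the reals. This alias and its neighbours pin one structure on C
    each, so that the tactics further down can match goals syntactically. *)
Definition pder (g : R -> C) (t : R) (v : C) : Prop :=
  @is_derive R_AbsRing C_R_NormedModule g t v.
Definition Ccont {T : UniformSpace} (u : T -> C) (p : T) : Prop :=
  @continuous T C_UniformSpace u p.
Definition CInt (g : R -> C) (a b : R) : C := @RInt C_R_CompleteNormedModule g a b.
Definition is_CInt (g : R -> C) (a b : R) (l : C) : Prop := @is_RInt C_R_NormedModule g a b l.

Ltac cring := cbv beta; ring.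
Ltac cfield := cbv beta; field.

(** * Derivatives and continuity in terms of the modulus *)

Lemma Cmod_minus_sym (x y : C) : Cmod (x - y) = Cmod (y - x).
Proof. by rewrite -Cmod_opp; congr Cmod; ring. Qed.

Lemma Cmod_triangle_minus (x y : C) : (Cmod x <= Cmod (x - y) + Cmod y)%R.
Proof. by have := Cmod_triangle (x - y) y; replace (x - y + y) with x by ring. Qed.

Lemma Re_le_Cmod (z : C) : (Re z <= Cmod z)%R.
Proof. have := re_le_Cmod z; have := Rle_abs (Re z); lra. Qed.

(** The uniform structure on C is that of the product, whose balls are squares. Passing to Euclidean
    disks costs a factor sqrt 2 <= 2, hence the radius d / 2. *)
Lemma locally_Cmod (z : C) (Q : C -> Prop) :
  @locally C_UniformSpace z Q <->
  exists d : R, (0 < d)%R /\ forall w, (Cmod (w - z) < d)%R -> Q w.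
Proof.
split.
- case=> d Hd; exists d; split; first exact: cond_pos.
  move=> w Hw; apply: Hd; exact: C_NormedModule_mixin_compat1.
- case=> d [d0 Hd].
  have d2 : (0 < d / 2)%R by lra.
  exists (mkposreal _ d2) => w Hw; apply: Hd.
  have := @C_NormedModule_mixin_compat2 z w (mkposreal _ d2) Hw => /= H.
  apply: (Rlt_le_trans _ _ _ H).
  have : (sqrt 2 <= 2)%R.
  { rewrite -{2}(sqrt_square 2); last lra. apply: sqrt_le_1_alt; lra. }
  nra.
Qed.

Lemma Ccont_iff (T : UniformSpace) (u : T -> C) (p : T) :
  Ccont u p <-> forall e : R, (0 < e)%R -> locally p (fun q => (Cmod (u q - u p) < e)%R).
Proof.
split.
- move=> H e e0; apply: (H (fun w => Cmod (w - u p) < e)%R).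
  by apply/locally_Cmod; exists e; split.
- move=> H Q HQ.
  have [d [d0 Hd]] := proj1 (locally_Cmod _ _) HQ.
  apply: filter_imp (H d d0) => q; exact: Hd.
Qed.

Lemma Cder_iff (f : C -> C) (z l : C) :
  Cder f z l <-> forall e : R, (0 < e)%R -> exists d : R, (0 < d)%R /\
    forall w, (Cmod (w - z) < d)%R ->
      (Cmod (f w - f z - l * (w - z)) <= e * Cmod (w - z))%R.
Proof.
split.
- case=> _ H e e0.
  have := H z (fun Q HQ => HQ) (mkposreal e e0).
  move=> /locally_C H1; have [d [d0 Hd]] := proj1 (locally_Cmod _ _) H1.
  exists d; split=> // w Hw.
  rewrite (Cmult_comm l); exact: (Hd w Hw).
- move=> H; split; first exact: is_linear_scal_l.
  move=> x Hx.
  have <- : z = x by exact: is_filter_lim_locally_unique Hx.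
  move=> e; apply/locally_C/locally_Cmod.
  have [d [d0 Hd]] := H e (cond_pos e).
  exists d; split=> // w Hw.
  by have := Hd w Hw; rewrite (Cmult_comm l).
Qed.

Lemma norm_C_R (z : C) : @norm R_AbsRing C_R_NormedModule z = Cmod z.
Proof.
rewrite /norm /= /prod_norm /Cmod; congr sqrt.
rewrite /norm /= /abs /=.
have H x : (Rabs x * (Rabs x * 1) = x * (x * 1))%R.
{ by rewrite !Rmult_1_r -Rabs_mult Rabs_pos_eq //; nra. }
by rewrite !H.
Qed.

Lemma pder_iff (g : R -> C) (t : R) (v : C) :
  pder g t v <-> forall e : R, (0 < e)%R -> exists d : R, (0 < d)%R /\
    forall s, (Rabs (s - t) < d)%R ->
      (Cmod (g s - g t - v * RtoC (s - t)) <= e * Rabs (s - t))%R.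
Proof.
have E s : @norm R_AbsRing C_R_NormedModule
     (minus (minus (g s) (g t)) (scal (minus s t) v)) = Cmod (g s - g t - v * RtoC (s - t)).
{ rewrite norm_C_R; congr Cmod.
  rewrite /minus /plus /opp /scal /= /prod_plus /prod_opp /prod_scal /= /plus /opp /scal /= /mult /=.
  rewrite /Cminus /Cplus /Copp /Cmult /=; congr pair; ring. }
split.
- case=> _ H e e0.
  have [d Hd] := H t (fun Q HQ => HQ) (mkposreal e e0).
  exists d; split; first exact: cond_pos.
  move=> s Hs; rewrite -E; exact: Hd.
- move=> H; split; first exact: is_linear_scal_l.
  move=> x Hx.
  have <- : t = x by exact: is_filter_lim_locally_unique Hx.
  move=> e.
  have [d [d0 Hd]] := H e (cond_pos e).
  exists (mkposreal d d0) => s Hs.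
  rewrite E; exact: Hd.
Qed.

Lemma Cder_cont (f : C -> C) (z l : C) : Cder f z l -> Ccont f z.
Proof.
move=> /Cder_iff H; apply/Ccont_iff => e e0.
have [d [d0 Hd]] := H 1%R Rlt_0_1.
apply/locally_Cmod.
have c0 := Cmod_ge_0 l.
have p0 : (0 < e / (Cmod l + 2))%R by apply: Rdiv_lt_0_compat; lra.
exists (Rmin d (e / (Cmod l + 2))); split; first by apply: Rmin_glb_lt.
move=> w Hw.
have H1 := Hd w (Rlt_le_trans _ _ _ Hw (Rmin_l _ _)).
have H2 := Rlt_le_trans _ _ _ Hw (Rmin_r _ _).
have H3 := Cmod_triangle_minus (f w - f z) (l * (w - z)).
rewrite Cmod_mult in H3.
have H4 : ((Cmod l + 2) * Cmod (w - z) < e)%R.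
{ replace e with ((Cmod l + 2) * (e / (Cmod l + 2)))%R at 1 by (field; lra).
  apply: Rmult_lt_compat_l => //; lra. }
have := Cmod_ge_0 (w - z); lra.
Qed.

Lemma Cder_uniq (f : C -> C) (z l m : C) : Cder f z l -> Cder f z m -> l = m.
Proof. by move=> /is_C_derive_unique <- /is_C_derive_unique. Qed.

Lemma Cder_eq (f : C -> C) (z l m : C) : Cder f z l -> l = m -> Cder f z m.
Proof. by move=> H <-. Qed.

Lemma pder_eq (f : R -> C) (z : R) (l m : C) : pder f z l -> l = m -> pder f z m.
Proof. by move=> H <-. Qed.

Lemma ex_derive_Cder (f : C -> C) (z : C) :
  @ex_derive C_AbsRing C_NormedModule f z -> Cder f z (C_derive f z).
Proof. exact: (C_derive_correct f z 0). Qed.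

(** The codomain C carries two normed module structures with the same norm but different balls. The
    rules for the identity, products and inner functions are available over the other one, and are
    transported from there. *)
Lemma Cder_AbsRing (f : C -> C) (z l : C) :
  @is_derive C_AbsRing (AbsRing_NormedModule C_AbsRing) f z l <-> Cder f z l.
Proof.
split.
- case=> _ H; split; first exact: is_linear_scal_l.
  move=> x Hx.
  have E : z = x by exact: is_filter_lim_locally_unique Hx.
  rewrite -E => e.
  have := H z (fun Q HQ => HQ) e.
  by rewrite /AbsRing_NormedModule /=.
- case=> _ H; split; first exact: is_linear_scal_l.
  move=> x Hx.
  have E : z = x by exact: is_filter_lim_locally_unique Hx.
  rewrite -E => e.
  have := H z (fun Q HQ => HQ) e.
  by rewrite /AbsRing_NormedModule /=.
Qed.

Lemma Cder_const (c z : C) : Cder (fun _ => c) z 0.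
Proof. exact: is_derive_const. Qed.

Lemma Cder_id (z : C) : Cder (fun w => w) z 1.
Proof. apply/Cder_AbsRing; exact: (@is_derive_id C_AbsRing). Qed.

Lemma Cder_plus (f g : C -> C) (z a b : C) :
  Cder f z a -> Cder g z b -> Cder (fun w => f w + g w) z (a + b).
Proof. exact: is_derive_plus. Qed.

Lemma Cder_opp (f : C -> C) (z a : C) : Cder f z a -> Cder (fun w => - f w) z (- a).
Proof. exact: is_derive_opp. Qed.

Lemma Cder_minus (f g : C -> C) (z a b : C) :
  Cder f z a -> Cder g z b -> Cder (fun w => f w - g w) z (a - b).
Proof. exact: is_derive_minus. Qed.

Lemma Cder_ext_loc (f g : C -> C) (z a : C) :
  @locally C_UniformSpace z (fun w => f w = g w) -> Cder f z a -> Cder g z a.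
Proof.
move=> H /Cder_iff Hf; apply/Cder_iff => e e0.
have [d [d0 Hd]] := Hf e e0.
have [d' [d0' Hd']] := proj1 (locally_Cmod _ _) H.
exists (Rmin d d'); split; first by apply: Rmin_glb_lt.
move=> w Hw.
rewrite -(Hd' w); last exact: (Rlt_le_trans _ _ _ Hw (Rmin_r _ _)).
rewrite -(Hd' z).
- exact: (Hd w (Rlt_le_trans _ _ _ Hw (Rmin_l _ _))).
- by replace (z - z) with (RtoC 0) by ring; rewrite Cmod_0.
Qed.

Lemma Cder_mult (f g : C -> C) (z a b : C) :
  Cder f z a -> Cder g z b -> Cder (fun w => f w * g w) z (a * g z + f z * b).
Proof.
move=> /Cder_AbsRing Hf /Cder_AbsRing Hg; apply/Cder_AbsRing.
apply: (is_derive_mult f g z a b Hf Hg); exact: Cmult_comm.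
Qed.

Lemma Cder_comp (f g : C -> C) (z a b : C) :
  Cder f (g z) a -> Cder g z b -> Cder (fun w => f (g w)) z (a * b).
Proof.
move=> Hf /Cder_AbsRing Hg.
have := is_derive_comp f g z a b Hf Hg.
by rewrite /scal /= /mult /= Cmult_comm.
Qed.

Lemma pder_comp (f : C -> C) (g : R -> C) (t : R) (a b : C) :
  Cder f (g t) a -> pder g t b -> pder (fun s => f (g s)) t (a * b).
Proof.
move=> /Cder_iff Hf /pder_iff Hg; apply/pder_iff => e e0.
have a0 := Cmod_ge_0 a. have b0 := Cmod_ge_0 b.
(* Each of two errors gets half of e |s - t|: that of g magnified by a, controlled by k, and that of
   f over an increment of size at most (|b| + 1) |s - t|, controlled by m. The factor |b| + 1 comes
   from asking g for precision [Rmin k 1]. *)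
set k := (e / (2 * (Cmod a + 1)))%R.
have k0 : (0 < k)%R by apply: Rdiv_lt_0_compat; lra.
set m := (e / (2 * (Cmod b + 1)))%R.
have m0 : (0 < m)%R by apply: Rdiv_lt_0_compat; lra.
have [d1 [d10 H1]] := Hf m m0.
have [d2 [d20 H2]] := Hg (Rmin k 1) (Rmin_glb_lt _ _ _ k0 Rlt_0_1).
set d3 := (d1 / (Cmod b + 1))%R.
have d30 : (0 < d3)%R by apply: Rdiv_lt_0_compat; lra.
exists (Rmin d2 d3); split; first by apply: Rmin_glb_lt.
move=> s Hs.
have s0 := Rabs_pos (s - t).
have Hs2 := H2 s (Rlt_le_trans _ _ _ Hs (Rmin_l _ _)).
have Hs3 := Rlt_le_trans _ _ _ Hs (Rmin_r _ _).
have Hk : (Cmod (g s - g t - b * RtoC (s - t)) <= k * Rabs (s - t))%R.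
{ apply: Rle_trans Hs2 _; apply: Rmult_le_compat_r => //; exact: Rmin_l. }
have H1' : (Cmod (g s - g t) <= (Cmod b + 1) * Rabs (s - t))%R.
{ have := Cmod_triangle_minus (g s - g t) (b * RtoC (s - t)).
  rewrite Cmod_mult Cmod_R.
  have := Rmin_r k 1. nra. }
have H3 : (Cmod (g s - g t) < d1)%R.
{ apply: Rle_lt_trans H1' _.
  replace d1 with ((Cmod b + 1) * d3)%R by (rewrite /d3; field; lra).
  apply: Rmult_lt_compat_l => //; lra. }
have H4 := H1 _ H3.
replace (f (g s) - f (g t) - a * b * RtoC (s - t)) with
  ((f (g s) - f (g t) - a * (g s - g t)) + a * (g s - g t - b * RtoC (s - t))) by ring.
apply: Rle_trans (Cmod_triangle _ _) _.
rewrite Cmod_mult.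
have H5 : (Cmod (f (g s) - f (g t) - a * (g s - g t)) <= e / 2 * Rabs (s - t))%R.
{ apply: Rle_trans H4 _.
  apply: (Rle_trans _ (m * ((Cmod b + 1) * Rabs (s - t)))).
  - apply: Rmult_le_compat_l => //; lra.
  - apply: Req_le. rewrite /m; field; lra. }
have H6 : (Cmod a * Cmod (g s - g t - b * RtoC (s - t)) <= e / 2 * Rabs (s - t))%R.
{ apply: (Rle_trans _ ((Cmod a + 1) * (k * Rabs (s - t)))).
  - apply: Rmult_le_compat => //; try lra; exact: Cmod_ge_0.
  - apply: Req_le. rewrite /k; field; lra. }
lra.
Qed.

Lemma Cder_inv_id (z : C) : z <> 0 -> Cder (fun w => / w) z (- / (z * z)).
Proof.
move=> z0; apply/Cder_iff => e e0.
have m0 : (0 < Cmod z)%R by apply/Cmod_gt_0.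
set d := Rmin (Cmod z / 2) (e * Cmod z ^ 3 / 2).
have z3 : (0 < Cmod z ^ 3)%R by apply: pow_lt.
have d0 : (0 < d)%R by apply: Rmin_glb_lt; nra.
exists d; split=> // w Hw.
have H1 := Rlt_le_trans _ _ _ Hw (Rmin_l _ _).
have H2 := Rlt_le_trans _ _ _ Hw (Rmin_r _ _).
have H3 : (Cmod z / 2 < Cmod w)%R.
{ have := Cmod_triangle_minus z w; rewrite Cmod_minus_sym; lra. }
have w0 : w <> 0 by apply/Cmod_gt_0; lra.
replace (/ w - / z - - / (z * z) * (w - z)) with ((w - z) * (w - z) * / (w * (z * z)))
  by (field; split; [exact z0 | exact w0]).
have zz0 : z * z <> 0 by apply: Cmult_neq_0.
rewrite !Cmod_mult Cmod_inv; last exact: Cmult_neq_0.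
rewrite !Cmod_mult.
have P : (0 < Cmod w * (Cmod z * Cmod z))%R.
{ apply: Rmult_lt_0_compat; [lra | nra]. }
apply: (Rmult_le_reg_r (Cmod w * (Cmod z * Cmod z))) => //.
rewrite Rmult_assoc Rinv_l; last lra.
have h0 := Cmod_ge_0 (w - z).
have K : (Cmod (w - z) <= e * (Cmod w * (Cmod z * Cmod z)))%R.
{ apply: Rle_trans (Rlt_le _ _ H2) _.
  replace (e * Cmod z ^ 3 / 2)%R with (e * (Cmod z / 2 * (Cmod z * Cmod z)))%R by (simpl; field).
  apply: Rmult_le_compat_l; first lra.
  apply: Rmult_le_compat_r; nra. }
nra.
Qed.

Lemma Cder_inv (f : C -> C) (z a : C) :
  Cder f z a -> f z <> 0 -> Cder (fun w => / f w) z (- a / (f z * f z)).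
Proof.
move=> Hf f0.
apply: Cder_eq; first exact: (Cder_comp (fun w => / w) f z _ _ (Cder_inv_id _ f0) Hf).
by cfield.
Qed.

Lemma Cder_div (f g : C -> C) (z a b : C) :
  Cder f z a -> Cder g z b -> g z <> 0 ->
  Cder (fun w => f w / g w) z ((a * g z - f z * b) / (g z * g z)).
Proof.
move=> Hf Hg g0.
apply: Cder_eq; first exact: (Cder_mult _ _ _ _ _ Hf (Cder_inv _ _ _ Hg g0)).
by cfield.
Qed.

Lemma Cder_scal (c : C) (f : C -> C) (z a : C) : Cder f z a -> Cder (fun w => c * f w) z (c * a).
Proof.
move=> H; apply: Cder_eq; first exact: (Cder_mult (fun _ => c) f z _ _ (Cder_const c z) H).
by cring.
Qed.

Lemma pder_pair (g : R -> C) (t : R) (v : C) :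
  is_derive (fun s => Re (g s)) t (Re v) -> is_derive (fun s => Im (g s)) t (Im v) -> pder g t v.
Proof.
move=> H1 H2; apply/pder_iff => e e0.
have e2 : (0 < e / 2)%R by lra.
have [d1 Hd1] := proj2 H1 t (fun Q HQ => HQ) (mkposreal _ e2).
have [d2 Hd2] := proj2 H2 t (fun Q HQ => HQ) (mkposreal _ e2).
exists (Rmin d1 d2); split; first by apply: Rmin_glb_lt; exact: cond_pos.
move=> s Hs.
have := Hd1 s (Rlt_le_trans _ _ _ Hs (Rmin_l _ _)).
have := Hd2 s (Rlt_le_trans _ _ _ Hs (Rmin_r _ _)).
rewrite /norm /= /abs /minus /plus /opp /scal /= /mult /=.
set B := (Im (g s) + - Im (g t) + - ((s + - t) * Im v))%R.
set D := (Re (g s) + - Re (g t) + - ((s + - t) * Re v))%R.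
move=> HB HD.
replace (g s - g t - v * RtoC (s - t)) with (RtoC D + Ci * RtoC B); last first.
{ rewrite /D /B /Cminus /Cplus /Copp /Cmult /Re /Im /=; congr pair; ring. }
apply: Rle_trans (Cmod_triangle _ _) _.
rewrite Cmod_mult Cmod_Ci !Cmod_R.
rewrite -/(s - t)%R in HB HD.
lra.
Qed.

Lemma pder_Re (g : R -> C) (t : R) (v : C) : pder g t v -> is_derive (fun s => Re (g s)) t (Re v).
Proof.
move=> H.
have L : filterdiff (fun c : C_R_NormedModule => fst c : R) (locally (g t)) (fun c => fst c).
{ apply: filterdiff_linear; exact: is_linear_fst. }
exact: (filterdiff_comp' g (fun c : C_R_NormedModule => fst c : R) t _ _ H L).
Qed.

Lemma pder_Im (g : R -> C) (t : R) (v : C) : pder g t v -> is_derive (fun s => Im (g s)) t (Im v).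
Proof.
move=> H.
have L : filterdiff (fun c : C_R_NormedModule => snd c : R) (locally (g t)) (fun c => snd c).
{ apply: filterdiff_linear; exact: is_linear_snd. }
exact: (filterdiff_comp' g (fun c : C_R_NormedModule => snd c : R) t _ _ H L).
Qed.

Lemma pder_const (c : C) (t : R) : pder (fun _ => c) t 0.
Proof. exact: is_derive_const. Qed.

Lemma pder_id (t : R) : pder (fun s => RtoC s) t 1.
Proof. apply: pder_pair; rewrite /RtoC /=; [exact: is_derive_id | exact: is_derive_const]. Qed.

Lemma pder_plus (f g : R -> C) (z : R) (a b : C) :
  pder f z a -> pder g z b -> pder (fun w => f w + g w) z (a + b).
Proof. exact: is_derive_plus. Qed.

Lemma pder_minus (f g : R -> C) (z : R) (a b : C) :
  pder f z a -> pder g z b -> pder (fun w => f w - g w) z (a - b).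
Proof. exact: is_derive_minus. Qed.

Lemma pder_scal (c : C) (g : R -> C) (t : R) (b : C) : pder g t b -> pder (fun s => c * g s) t (c * b).
Proof.
move=> Hg; apply: (pder_comp (fun w => c * w) g t c b) => //.
apply: Cder_eq; first exact: (Cder_scal c _ _ _ (Cder_id _)).
by cring.
Qed.

Lemma pder_mult (f g : R -> C) (t : R) (a b : C) :
  pder f t a -> pder g t b -> pder (fun s => f s * g s) t (a * g t + f t * b).
Proof.
(* polarization: a product is a combination of squares *)
have sq u c : pder u t c -> pder (fun s => u s * u s) t (2 * u t * c).
{ move=> Hu; apply: (pder_comp (fun w => w * w) u t (2 * u t) c) => //.
  apply: Cder_eq; first exact: (Cder_mult _ _ _ _ _ (Cder_id _) (Cder_id _)).
  by cring. }
move=> Hf Hg.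
have H := pder_scal (/ 4) _ _ _ (pder_minus _ _ _ _ _ (sq _ _ (pder_plus _ _ _ _ _ Hf Hg)) (sq _ _ (pder_minus _ _ _ _ _ Hf Hg))).
have n4 : RtoC 4 <> 0 by move=> /RtoC_inj; lra.
apply: pder_eq; first apply: is_derive_ext H.
- by move=> s /=; field.
- by cfield.
Qed.

Lemma pder_cont (g : R -> C) (t : R) (v : C) : pder g t v -> Ccont g t.
Proof.
move=> H; apply: (@ex_derive_continuous R_AbsRing C_R_NormedModule); by exists v.
Qed.

(** * Holomorphy near a point, and continuity *)

(** Differentiability is required on a whole neighbourhood: this is what makes the notion stable
    under differentiation ([holo_derive]), besides algebra and composition. *)
Definition holo (f : C -> C) (z : C) : Prop :=
  @locally C_UniformSpace z (fun w => @ex_derive C_AbsRing C_NormedModule f w).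

Lemma near2 (T : UniformSpace) (z : T) (P Q A : T -> Prop) :
  locally z P -> locally z Q -> (forall w, P w -> Q w -> A w) -> locally z A.
Proof. by move=> HP HQ H; apply: filter_imp (filter_and _ _ HP HQ) => w []; exact: H. Qed.

Lemma holo_Cder (f : C -> C) (z : C) : holo f z -> Cder f z (C_derive f z).
Proof. move=> H; apply: ex_derive_Cder; exact: locally_singleton H. Qed.

Lemma holo_cont (f : C -> C) (z : C) : holo f z -> Ccont f z.
Proof. move=> /holo_Cder; exact: Cder_cont. Qed.

Lemma holo_open (U : C -> Prop) (f : C -> C) (z : C) :
  @open C_UniformSpace U -> analytic_on U f -> U z -> holo f z.
Proof. move=> oU H /oU; apply: filter_imp; exact: H. Qed.

Lemma Cder_ex (f : C -> C) (z l : C) : Cder f z l -> @ex_derive C_AbsRing C_NormedModule f z.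
Proof. by move=> H; exists l. Qed.

Lemma Cder_derive (f : C -> C) (z l : C) : Cder f z l -> C_derive f z = l.
Proof. exact: is_C_derive_unique. Qed.

Lemma holo_const (c z : C) : holo (fun _ => c) z.
Proof. by apply: filter_forall => w; apply: Cder_ex (Cder_const c w). Qed.

Lemma holo_id (z : C) : holo (fun w => w) z.
Proof. by apply: filter_forall => w; apply: Cder_ex (Cder_id w). Qed.

Lemma holo_plus (f g : C -> C) (z : C) : holo f z -> holo g z -> holo (fun w => f w + g w) z.
Proof.
move=> Hf Hg; apply: (near2 _ _ _ _ _ Hf Hg) => w /ex_derive_Cder Hf' /ex_derive_Cder Hg'.
exact: Cder_ex (Cder_plus _ _ _ _ _ Hf' Hg').
Qed.

Lemma holo_minus (f g : C -> C) (z : C) : holo f z -> holo g z -> holo (fun w => f w - g w) z.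
Proof.
move=> Hf Hg; apply: (near2 _ _ _ _ _ Hf Hg) => w /ex_derive_Cder Hf' /ex_derive_Cder Hg'.
exact: Cder_ex (Cder_minus _ _ _ _ _ Hf' Hg').
Qed.

Lemma holo_opp (f : C -> C) (z : C) : holo f z -> holo (fun w => - f w) z.
Proof.
apply: filter_imp => w /ex_derive_Cder Hf'.
exact: Cder_ex (Cder_opp _ _ _ Hf').
Qed.

Lemma holo_mult (f g : C -> C) (z : C) : holo f z -> holo g z -> holo (fun w => f w * g w) z.
Proof.
move=> Hf Hg; apply: (near2 _ _ _ _ _ Hf Hg) => w /ex_derive_Cder Hf' /ex_derive_Cder Hg'.
exact: Cder_ex (Cder_mult _ _ _ _ _ Hf' Hg').
Qed.

Lemma Ccont_locally_neq (T : UniformSpace) (u : T -> C) (p : T) (c : C) :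
  Ccont u p -> u p <> c -> locally p (fun q => u q <> c).
Proof.
move=> /Ccont_iff H n.
have e0 : (0 < Cmod (u p - c))%R.
{ apply/Cmod_gt_0 => E; apply: n. by replace (u p) with (u p - c + c) by ring; rewrite E; ring. }
apply: filter_imp (H _ e0) => q Hq E; rewrite E Cmod_minus_sym in Hq; lra.
Qed.

Lemma holo_inv (f : C -> C) (z : C) : holo f z -> f z <> 0 -> holo (fun w => / f w) z.
Proof.
move=> Hf n.
apply: (near2 _ _ _ _ _ Hf (Ccont_locally_neq _ _ _ _ (holo_cont _ _ Hf) n)) => w /ex_derive_Cder Hf' Hw.
exact: Cder_ex (Cder_inv _ _ _ Hf' Hw).
Qed.

Lemma holo_div (f g : C -> C) (z : C) :
  holo f z -> holo g z -> g z <> 0 -> holo (fun w => f w / g w) z.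
Proof. by move=> Hf Hg n; apply: (holo_mult f (fun w => / g w)) => //; apply: holo_inv. Qed.

Lemma holo_comp (f g : C -> C) (z : C) : holo f (g z) -> holo g z -> holo (fun w => f (g w)) z.
Proof.
move=> Hf Hg.
apply: (near2 _ _ _ _ _ Hg (holo_cont _ _ Hg _ Hf)) => w /ex_derive_Cder Hg' /ex_derive_Cder Hf'.
exact: Cder_ex (Cder_comp _ _ _ _ _ Hf' Hg').
Qed.

Lemma holo_ext_loc (f g : C -> C) (z : C) :
  @locally C_UniformSpace z (fun w => f w = g w) -> holo f z -> holo g z.
Proof.
move=> /locally_locally E Hf; apply: (near2 _ _ _ _ _ E Hf) => w E' /ex_derive_Cder Hf'.
exact: Cder_ex (Cder_ext_loc _ _ _ _ E' Hf').
Qed.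

Lemma C_derive_ext_loc (f g : C -> C) (z : C) :
  @locally C_UniformSpace z (fun w => f w = g w) -> holo f z -> C_derive f z = C_derive g z.
Proof.
move=> E /holo_Cder Hf; symmetry; apply: Cder_derive; exact: Cder_ext_loc E Hf.
Qed.

Lemma Ccont_const (T : UniformSpace) (c : C) (p : T) : Ccont (fun _ => c) p.
Proof. exact: continuous_const. Qed.

Lemma Ccont_comp (T : UniformSpace) (f : C -> C) (u : T -> C) (p : T) :
  Ccont f (u p) -> Ccont u p -> Ccont (fun q => f (u q)) p.
Proof. by move=> Hf Hu; apply: (continuous_comp u f). Qed.

Lemma Ccont_holo (T : UniformSpace) (f : C -> C) (u : T -> C) (p : T) :
  holo f (u p) -> Ccont u p -> Ccont (fun q => f (u q)) p.
Proof. move=> Hf; apply: Ccont_comp; exact: holo_cont. Qed.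

Lemma Ccont_plus (T : UniformSpace) (u v : T -> C) (p : T) :
  Ccont u p -> Ccont v p -> Ccont (fun q => u q + v q) p.
Proof. exact: (@continuous_plus T C_AbsRing C_NormedModule). Qed.

Lemma Ccont_opp (T : UniformSpace) (u : T -> C) (p : T) :
  Ccont u p -> Ccont (fun q => - u q) p.
Proof. exact: (@continuous_opp T C_AbsRing C_NormedModule). Qed.

Lemma Ccont_minus (T : UniformSpace) (u v : T -> C) (p : T) :
  Ccont u p -> Ccont v p -> Ccont (fun q => u q - v q) p.
Proof. by move=> Hu Hv; apply: (Ccont_plus T u (fun q => - v q)) => //; apply: Ccont_opp. Qed.

(** Polarization again: a square is the composition with a holomorphic function, so sums and
    compositions suffice. *)
Lemma Ccont_mult (T : UniformSpace) (u v : T -> C) (p : T) :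
  Ccont u p -> Ccont v p -> Ccont (fun q => u q * v q) p.
Proof.
move=> Hu Hv.
have sq w : Ccont w p -> Ccont (fun q : T => w q * w q) p.
{ by move=> Hw; apply: (Ccont_holo T (fun x => x * x)) => //; apply: holo_mult; apply: holo_id. }
have n4 : RtoC 4 <> 0 by move=> /RtoC_inj; lra.
apply: (continuous_ext (fun q => (/ 4) * ((u q + v q) * (u q + v q) - (u q - v q) * (u q - v q)))).
- by move=> q /=; field.
- apply: (Ccont_holo T (fun x => / 4 * x)); first by apply: holo_mult; [apply: holo_const | apply: holo_id].
  by apply: Ccont_minus; apply: sq; [apply: Ccont_plus | apply: Ccont_minus].
Qed.

Lemma Ccont_inv (T : UniformSpace) (u : T -> C) (p : T) :
  Ccont u p -> u p <> 0 -> Ccont (fun q => / u q) p.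
Proof.
move=> Hu n; apply: (Ccont_holo T (fun x => / x)) => //.
apply: (holo_inv (fun x => x)) => //; exact: holo_id.
Qed.

Lemma Ccont_div (T : UniformSpace) (u v : T -> C) (p : T) :
  Ccont u p -> Ccont v p -> v p <> 0 -> Ccont (fun q => u q / v q) p.
Proof. by move=> Hu Hv n; apply: (Ccont_mult T u (fun q => / v q)) => //; apply: Ccont_inv. Qed.

Lemma Ccont_RtoC (t : R) : Ccont (fun s : R => RtoC s) t.
Proof. exact: pder_cont (pder_id t). Qed.

Lemma Ccont_RtoC_comp (T : UniformSpace) (u : T -> R) (p : T) :
  continuous u p -> Ccont (fun q => RtoC (u q)) p.
Proof. move=> Hu; apply: (continuous_comp u RtoC) => //; exact: Ccont_RtoC. Qed.

Lemma Ccont_fst (p : C * R) : Ccont (fun q : C * R => fst q) p.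
Proof. destruct p; exact: continuous_fst. Qed.

Lemma Ccont_snd (p : C * R) : Ccont (fun q : C * R => RtoC (snd q)) p.
Proof. apply: Ccont_RtoC_comp; destruct p; exact: continuous_snd. Qed.

Lemma Ccont_Re (T : UniformSpace) (u : T -> C) (p : T) : Ccont u p -> continuous (fun q => Re (u q)) p.
Proof.
move=> H; apply: (continuous_comp u Re) => //.
rewrite /Re; case: (u p) => x y; exact: continuous_fst.
Qed.

Lemma Ccont_Cmod (T : UniformSpace) (u : T -> C) (p : T) : Ccont u p -> continuous (fun q => Cmod (u q)) p.
Proof.
move=> H; apply: (continuous_comp u Cmod) => //.
apply: (continuous_ext (fun z => @norm R_AbsRing C_R_NormedModule z)); first by move=> z; rewrite norm_C_R.
exact: (@filterlim_norm R_AbsRing C_R_NormedModule).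
Qed.

(** * Integrals of complex functions of a real variable *)

Lemma is_CInt_CInt (g : R -> C) (a b : R) :
  (a <= b)%R -> (forall t, (a <= t <= b)%R -> Ccont g t) -> is_CInt g a b (CInt g a b).
Proof.
move=> ab H; apply: (@RInt_correct C_R_CompleteNormedModule).
apply: ex_RInt_continuous => t Ht; apply: H.
by rewrite Rmin_left ?Rmax_right in Ht.
Qed.

Lemma CInt_unique (g : R -> C) (a b : R) (l : C) : is_CInt g a b l -> CInt g a b = l.
Proof. exact: (@is_RInt_unique C_R_CompleteNormedModule). Qed.

Lemma is_CInt_plus (f g : R -> C) (a b : R) (k l : C) :
  is_CInt f a b k -> is_CInt g a b l -> is_CInt (fun t => f t + g t) a b (k + l).
Proof. exact: (@is_RInt_plus C_R_NormedModule). Qed.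

Lemma is_CInt_minus (f g : R -> C) (a b : R) (k l : C) :
  is_CInt f a b k -> is_CInt g a b l -> is_CInt (fun t => f t - g t) a b (k - l).
Proof. exact: (@is_RInt_minus C_R_NormedModule). Qed.

Lemma is_CInt_Re (f : R -> C) (a b : R) (l : C) :
  is_CInt f a b l -> is_RInt (fun t => Re (f t)) a b (Re l).
Proof. exact: (@is_RInt_fct_extend_fst R_NormedModule R_NormedModule). Qed.

Lemma is_CInt_Im (f : R -> C) (a b : R) (l : C) :
  is_CInt f a b l -> is_RInt (fun t => Im (f t)) a b (Im l).
Proof. exact: (@is_RInt_fct_extend_snd R_NormedModule R_NormedModule). Qed.

(** The integral is taken in a real module, of which a complex factor is not a scalar; real and
    imaginary parts are integrated apart. *)
Lemma is_CInt_scal (c : C) (f : R -> C) (a b : R) (l : C) :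
  is_CInt f a b l -> is_CInt (fun t => c * f t) a b (c * l).
Proof.
move=> H.
have HR := is_CInt_Re _ _ _ _ H. have HI := is_CInt_Im _ _ _ _ H.
apply: (@is_RInt_fct_extend_pair R_NormedModule R_NormedModule) => /=.
- apply: (@is_RInt_minus R_NormedModule); exact: (@is_RInt_scal R_NormedModule).
- apply: (@is_RInt_plus R_NormedModule); exact: (@is_RInt_scal R_NormedModule).
Qed.

Lemma is_CInt_ext (f g : R -> C) (a b : R) (l : C) :
  (a <= b)%R -> (forall t, (a < t < b)%R -> f t = g t) -> is_CInt f a b l -> is_CInt g a b l.
Proof.
move=> ab H; apply: is_RInt_ext => t Ht; apply: H.
by rewrite Rmin_left ?Rmax_right in Ht.
Qed.

Lemma CInt_ext (f g : R -> C) (a b : R) :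
  (a <= b)%R -> (forall t, (a < t < b)%R -> f t = g t) -> CInt f a b = CInt g a b.
Proof.
move=> ab H; apply: (@RInt_ext C_R_CompleteNormedModule) => t Ht; apply: H.
by rewrite Rmin_left ?Rmax_right in Ht.
Qed.

Lemma is_CInt_const (c : C) (a b : R) : is_CInt (fun _ => c) a b (RtoC (b - a) * c).
Proof.
have H := @is_RInt_const C_R_NormedModule a b c.
rewrite /is_CInt; suff -> : RtoC (b - a) * c = scal (b - a)%R c by [].
rewrite /scal /= /prod_scal /scal /= /mult /= /Cmult /=; congr pair; ring.
Qed.

Lemma is_CInt_bound (f : R -> C) (a b M : R) (l : C) :
  (a <= b)%R -> (forall t, (a <= t <= b)%R -> (Cmod (f t) <= M)%R) ->
  is_CInt f a b l -> (Cmod l <= (b - a) * M)%R.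
Proof.
move=> ab H Hl; rewrite -norm_C_R.
apply: (norm_RInt_le f (fun _ => M) a b l _ ab) => //.
- move=> t Ht; rewrite norm_C_R; exact: H.
- exact: (@is_RInt_const R_NormedModule).
Qed.

Lemma is_CInt_derive (g g' : R -> C) (a b : R) :
  (a <= b)%R -> (forall t, (a <= t <= b)%R -> pder g t (g' t)) ->
  (forall t, (a <= t <= b)%R -> Ccont g' t) -> is_CInt g' a b (g b - g a).
Proof.
move=> ab H1 H2; apply: (@is_RInt_derive C_R_CompleteNormedModule g g').
- move=> t Ht; rewrite Rmin_left ?Rmax_right // in Ht; exact: H1.
- move=> t Ht; rewrite Rmin_left ?Rmax_right // in Ht; exact: H2.
Qed.

(** The real mean value theorem is applied to Re(conj u g), the projection of the curve on its own
    increment u = g b - g a: the increment of the projection is |u|^2, its derivative at most |u|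
    M. *)
Lemma mean_value_bound (g g' : R -> C) (a b M : R) :
  (a <= b)%R -> (forall t, (a <= t <= b)%R -> pder g t (g' t)) ->
  (forall t, (a <= t <= b)%R -> (Cmod (g' t) <= M)%R) -> (Cmod (g b - g a) <= M * (b - a))%R.
Proof.
move=> ab H1 H2.
set u := g b - g a.
case: (Req_dec (Cmod u) 0) => [->|u0].
{ have := H2 a (conj (Rle_refl a) ab); have := Cmod_ge_0 (g' a); nra. }
have up : (0 < Cmod u)%R by have := Cmod_ge_0 u; lra.
have D t : (a <= t <= b)%R -> is_derive (fun s => Re (Cconj u * g s)) t (Re (Cconj u * g' t)).
{ move=> Ht; apply: pder_Re; apply: pder_scal; exact: H1. }
have Hder x : (Rmin a b < x < Rmax a b)%R ->
   is_derive (fun s => Re (Cconj u * g s)) x (Re (Cconj u * g' x)).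
{ rewrite Rmin_left // Rmax_right // => Hx; apply: D; lra. }
have Hcont x : (Rmin a b <= x <= Rmax a b)%R ->
   continuity_pt (fun s => Re (Cconj u * g s)) x.
{ rewrite Rmin_left // Rmax_right // => Hx; apply/continuity_pt_filterlim.
  exact: (@ex_derive_continuous R_AbsRing R_NormedModule _ x (ex_intro _ _ (D x Hx))). }
have [c [Hc E]] := MVT_gen (fun s => Re (Cconj u * g s)) a b (fun t => Re (Cconj u * g' t)) Hder Hcont.
rewrite Rmin_left // Rmax_right // in Hc.
have E2 : (Re (Cconj u * g b) - Re (Cconj u * g a) = Cmod u ^ 2)%R.
{ rewrite Cmod2_alt /u /Cconj /Cmult /Re /Im /=; ring. }
rewrite E2 in E.
have H3 := Re_le_Cmod (Cconj u * g' c).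
rewrite Cmod_mult Cmod_conj in H3.
have H4 := H2 c Hc.
have H5 : (Cmod u * Cmod u <= Cmod u * (M * (b - a)))%R.
{ have : (Cmod u * Cmod (g' c) <= Cmod u * M)%R by apply: Rmult_le_compat_l; lra.
  nra. }
nra.
Qed.

Lemma is_CInt_comp_lin (f : R -> C) (u v a b : R) (l : C) :
  is_CInt f (u * a + v) (u * b + v) l -> is_CInt (fun t => RtoC u * f (u * t + v)%R) a b l.
Proof.
move=> H; have := @is_RInt_comp_lin C_R_NormedModule f u v a b l H.
apply: is_RInt_ext => t _.
rewrite /scal /= /prod_scal /scal /= /mult /= /Cmult /=; congr pair; ring.
Qed.

(** * Differentiation under the integral sign *)

(** A tube argument. Joint continuity at each (z, t) gives a gauge t -> [delta t], and compactness
    of [a, b] provides one radius that works for all t. Both values are compared with [Phi z s] at a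
    nearby s, hence e / 2. *)
Lemma compact_uniform (Phi : C -> R -> C) (z : C) (a b : R) :
  (forall t, (a <= t <= b)%R -> Ccont (fun p : C * R => Phi (fst p) (snd p)) (z, t)) ->
  forall e, (0 < e)%R -> exists d, (0 < d)%R /\ forall w t, (Cmod (w - z) < d)%R ->
    (a <= t <= b)%R -> (Cmod (Phi w t - Phi z t) < e)%R.
Proof.
move=> H e e0.
have H1 t : exists d : posreal, (a <= t <= b)%R -> forall w s, (Cmod (w - z) < d)%R ->
   (Rabs (s - t) < d)%R -> (Cmod (Phi w s - Phi z t) < e / 2)%R.
{ case: (excluded_middle_informative (a <= t <= b)%R) => [Ht|n]; last by exists (mkposreal 1 Rlt_0_1).
  have e2 : (0 < e / 2)%R by lra.
  have [d Hd] := proj1 (Ccont_iff _ _ _) (H t Ht) _ e2.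
  exists d => _ w s Hw Hs; apply: (Hd (w, s)); split => //=.
  exact: C_NormedModule_mixin_compat1. }
have [delta Hdelta] := choice _ H1.
have [d Hd] := compactness_value_1d a b delta.
exists d; split; first exact: cond_pos.
move=> w t Hw Ht.
(* The compactness statement holds under a double negation; deciding the goal first allows it to be
   used. *)
case: (Rlt_dec (Cmod (Phi w t - Phi z t)) e) => // n; exfalso.
apply: (Hd t Ht) => -[s [Hs [Hts Hds]]]; apply: n.
have K1 := Hdelta s Hs w t (Rlt_le_trans _ _ _ Hw Hds) Hts.
have K2 := Hdelta s Hs z t _ Hts.
have zz : (Cmod (z - z) < delta s)%R.
{ replace (z - z) with (RtoC 0) by ring; rewrite Cmod_0; exact: cond_pos. }
have := Cmod_triangle (Phi w t - Phi z s) (Phi z s - Phi z t).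
replace (Phi w t - Phi z s + (Phi z s - Phi z t)) with (Phi w t - Phi z t) by ring.
have := K2 zz; rewrite (Cmod_minus_sym (Phi z t)); lra.
Qed.

(** For fixed t, the error of the linear approximation of [G] is bounded by the mean value
    inequality on the segment from z to w; uniform continuity of [G'] in t makes this bound
    integrable against [a, b]. *)
Lemma Cder_CInt (G G' : C -> R -> C) (z : C) (a b d0 : R) :
  (0 < d0)%R -> (a <= b)%R ->
  (forall w t, (Cmod (w - z) < d0)%R -> (a <= t <= b)%R -> Cder (fun v => G v t) w (G' w t)) ->
  (forall w t, (Cmod (w - z) < d0)%R -> (a <= t <= b)%R -> Ccont (fun s => G w s) t) ->
  (forall t, (a <= t <= b)%R -> Ccont (fun p : C * R => G' (fst p) (snd p)) (z, t)) ->
  Cder (fun w => CInt (G w) a b) z (CInt (G' z) a b).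
Proof.
move=> d00 ab HD HC HC'.
have zz : (Cmod (z - z) < d0)%R by replace (z - z) with (RtoC 0) by ring; rewrite Cmod_0.
have Iz' : is_CInt (G' z) a b (CInt (G' z) a b).
{ apply: is_CInt_CInt => // t Ht.
  apply: (continuous_comp_2 (fun _ : R => z) (fun s : R => s) G' t).
  - exact: continuous_const.
  - exact: continuous_id.
  - exact: HC'. }
apply/Cder_iff => e e0.
(* The summand 1 covers a = b. *)
set M := (e / (b - a + 1))%R.
have M0 : (0 < M)%R by apply: Rdiv_lt_0_compat; lra.
have [d [dp Hd]] := compact_uniform G' z a b HC' M M0.
exists (Rmin d0 d); split; first exact: Rmin_glb_lt.
move=> w Hw.
have Hw1 := Rlt_le_trans _ _ _ Hw (Rmin_l _ _).
have Hw2 := Rlt_le_trans _ _ _ Hw (Rmin_r _ _).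
have w0 := Cmod_ge_0 (w - z).
have Iw : is_CInt (G w) a b (CInt (G w) a b) by apply: is_CInt_CInt => // t Ht; exact: HC.
have Iz : is_CInt (G z) a b (CInt (G z) a b) by apply: is_CInt_CInt => // t Ht; exact: HC.
have I := is_CInt_minus _ _ _ _ _ _ (is_CInt_minus _ _ _ _ _ _ Iw Iz) (is_CInt_scal (w - z) _ _ _ _ Iz').
rewrite (Cmult_comm _ (w - z)).
apply: Rle_trans (is_CInt_bound _ _ _ (M * Cmod (w - z)) _ ab _ I) _.
- move=> t Ht.
  set g := fun s : R => G (z + s * (w - z)) t - s * ((w - z) * G' z t).
  set g' := fun s : R => G' (z + s * (w - z)) t * (w - z) - (w - z) * G' z t.
  have seg s : (0 <= s <= 1)%R -> (Cmod (z + s * (w - z) - z) <= Cmod (w - z))%R.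
  { move=> Hs; replace (z + s * (w - z) - z) with (s * (w - z)) by ring.
    rewrite Cmod_mult Cmod_R Rabs_pos_eq; nra. }
  have P1 s : (0 <= s <= 1)%R -> pder g s (g' s).
  { move=> Hs; apply: pder_minus.
    - apply: (pder_comp (fun v => G v t) (fun s : R => z + s * (w - z))).
      + apply: HD => //; apply: Rle_lt_trans (seg s Hs) Hw1.
      + apply: pder_eq; first apply: pder_plus (pder_const _ _) (pder_mult _ _ _ _ _ (pder_id _) (pder_const _ _)).
        by cring.
    - apply: pder_eq; first apply: (pder_mult _ _ _ _ _ (pder_id _) (pder_const _ _)).
      by cring. }
  have P2 s : (0 <= s <= 1)%R -> (Cmod (g' s) <= M * Cmod (w - z))%R.
  { move=> Hs; rewrite /g'.
    replace (G' (z + s * (w - z)) t * (w - z) - (w - z) * G' z t) with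
      ((G' (z + s * (w - z)) t - G' z t) * (w - z)) by ring.
    rewrite Cmod_mult; apply: Rmult_le_compat_r => //; apply: Rlt_le; apply: Hd => //.
    exact: Rle_lt_trans (seg s Hs) Hw2. }
  have := mean_value_bound g g' 0 1 _ Rle_0_1 P1 P2.
  rewrite /g Rminus_0_r Rmult_1_r.
  replace (G (z + 1 * (w - z)) t - 1 * ((w - z) * G' z t) - (G (z + 0 * (w - z)) t - 0 * ((w - z) * G' z t)))
    with (G w t - G z t - (w - z) * G' z t) => //.
  replace (z + 1 * (w - z)) with w by ring.
  replace (z + 0 * (w - z)) with z by ring.
  by ring.
- have E : ((b - a) * M <= e)%R.
  { apply: (Rle_trans _ ((b - a + 1) * M)); first by nra.
    apply: Req_le; rewrite /M; field; lra. }
  nra.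
Qed.

(** * Syntax-directed tactics for holomorphy, continuity and derivatives *)

Ltac holo_step :=
  match goal with
  | |- holo (fun _ => ?c) _ => apply holo_const
  | |- holo (fun w => w) _ => apply holo_id
  | H : holo ?f ?z |- holo ?f ?z => exact H
  | |- holo (fun w => @?f w + @?g w) ?z => apply (holo_plus f g z); cbv beta
  | |- holo (fun w => @?f w - @?g w) ?z => apply (holo_minus f g z); cbv beta
  | |- holo (fun w => @?f w * @?g w) ?z => apply (holo_mult f g z); cbv beta
  | |- holo (fun w => @?f w / @?g w) ?z => apply (holo_div f g z); cbv beta
  | |- holo (fun w => - @?f w) ?z => apply (holo_opp f z); cbv beta
  | |- holo (fun w => / @?f w) ?z => apply (holo_inv f z); cbv beta
  | |- holo (fun w => ?f w) ?z => change (holo f z)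
  | |- holo (fun w => ?f (@?g w)) ?z => apply (holo_comp f g z); cbv beta
  end.
Ltac holo := repeat holo_step.

Ltac Ccont_step :=
  match goal with
  | |- Ccont (fun _ => ?c) _ => apply Ccont_const
  | |- Ccont (fun q => fst q) _ => apply Ccont_fst
  | |- Ccont (fun q => RtoC (snd q)) _ => apply Ccont_snd
  | |- Ccont (fun q => RtoC q) _ => apply Ccont_RtoC
  | |- Ccont (fun q => @?f q + @?g q) ?z => apply (Ccont_plus _ f g z); cbv beta
  | |- Ccont (fun q => @?f q - @?g q) ?z => apply (Ccont_minus _ f g z); cbv beta
  | |- Ccont (fun q => @?f q * @?g q) ?z => apply (Ccont_mult _ f g z); cbv beta
  | |- Ccont (fun q => @?f q / @?g q) ?z => apply (Ccont_div _ f g z); cbv beta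
  | |- Ccont (fun q => - @?f q) ?z => apply (Ccont_opp _ f z); cbv beta
  | |- Ccont (fun q => / @?f q) ?z => apply (Ccont_inv _ f z); cbv beta
  | H : Ccont ?f ?z |- Ccont (fun q => ?f q) ?z => exact H
  | |- Ccont (fun q => ?f (@?g q)) ?z => apply (Ccont_comp _ f g z); cbv beta
  end.
Ltac Ccont := repeat Ccont_step.

Ltac Cder_step :=
  match goal with
  | |- Cder (fun _ => ?c) _ _ => apply Cder_const
  | |- Cder (fun w => w) _ _ => apply Cder_id
  | H : Cder ?f ?z _ |- Cder ?f ?z _ => exact H
  | |- Cder (fun w => @?f w + @?g w) ?z _ => eapply (Cder_plus f g z); cbv beta
  | |- Cder (fun w => @?f w - @?g w) ?z _ => eapply (Cder_minus f g z); cbv beta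
  | |- Cder (fun w => @?f w * @?g w) ?z _ => eapply (Cder_mult f g z); cbv beta
  | |- Cder (fun w => @?f w / @?g w) ?z _ => eapply (Cder_div f g z); cbv beta
  | |- Cder (fun w => - @?f w) ?z _ => eapply (Cder_opp f z); cbv beta
  | |- Cder (fun w => / @?f w) ?z _ => eapply (Cder_inv f z); cbv beta
  | |- Cder (fun w => ?f w) ?z _ => change (fun w => f w) with f
  | H : holo ?f ?z |- Cder ?f ?z _ => exact (holo_Cder f z H)
  | |- Cder (fun w => ?f (@?g w)) ?z _ => eapply (Cder_comp f g z); cbv beta
  end.
Ltac Cder := repeat Cder_step.

Ltac pder_step :=
  match goal with
  | |- pder (fun _ => ?c) _ _ => apply pder_const
  | |- pder (fun w => RtoC w) _ _ => apply pder_id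
  | H : pder ?f ?z _ |- pder (fun w => ?f w) ?z _ => exact H
  | |- pder (fun w => @?f w + @?g w) ?z _ => eapply (pder_plus f g z); cbv beta
  | |- pder (fun w => @?f w - @?g w) ?z _ => eapply (pder_minus f g z); cbv beta
  | |- pder (fun w => @?f w * @?g w) ?z _ => eapply (pder_mult f g z); cbv beta
  | |- pder (fun w => ?f (@?g w)) ?z _ => eapply (pder_comp f g z); cbv beta
  end.
Ltac pder := repeat pder_step.

(** * Goursat's theorem and primitives *)

(** The contour integral along a segment; [tri] is the one along the boundary of a triangle. *)
Definition seg (f : C -> C) (a b : C) : C :=
  CInt (fun t => (b - a) * f (a + t * (b - a))) 0 1.

Definition tri (f : C -> C) (a b c : C) : C := seg f a b + seg f b c + seg f c a.

Lemma disk_convex (r : R) (a b : C) (t : R) :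
  (Cmod a <= r)%R -> (Cmod b <= r)%R -> (0 <= t <= 1)%R -> (Cmod (a + t * (b - a)) <= r)%R.
Proof.
move=> Ha Hb Ht.
replace (a + t * (b - a)) with (RtoC (1 - t) * a + t * b) by (rewrite RtoC_minus; ring).
apply: Rle_trans (Cmod_triangle _ _) _.
rewrite !Cmod_mult !Cmod_R !Rabs_pos_eq; nra.
Qed.

(** With e n = 2L/2^n, the tail of the series of increments from n on, the intervals
    [x n - e n, x n + e n] are nested; the limit is the supremum of their left ends. *)
Lemma dichotomy_limit_R (x : nat -> R) (L : R) :
  (forall n, (Rabs (x (S n) - x n) <= L / 2 ^ n)%R) ->
  exists l, forall n, (Rabs (x n - l) <= 2 * L / 2 ^ n)%R.
Proof.
move=> H.
have p2 n : (0 < 2 ^ n)%R by apply: pow_lt; lra.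
pose e n := (2 * L / 2 ^ n)%R.
have eS n : (e n = L / 2 ^ n + e (S n))%R.
{ rewrite /e /=; field; have := p2 n; lra. }
have e0 n : (0 <= e n)%R.
{ have := H n; have := Rabs_pos (x (S n) - x n); rewrite /e.
  replace (2 * L / 2 ^ n)%R with (2 * (L / 2 ^ n))%R by (field; have := p2 n; lra). lra. }
have up k n : (x n - e n <= x (n + k)%nat - e (n + k)%nat)%R /\ (x (n + k)%nat + e (n + k)%nat <= x n + e n)%R.
{ elim: k => [|k [IH1 IH2]]; first by rewrite Nat.add_0_r; lra.
  rewrite Nat.add_succ_r.
  have := H (n + k)%nat; have := eS (n + k)%nat.
  move=> E /Rabs_le_between. lra. }
have uv n m : (x n - e n <= x m + e m)%R.
{ case: (Nat.le_ge_cases n m) => nm.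
  - have [H1 _] := up (m - n)%nat n; rewrite (Arith_base.le_plus_minus_r_stt n m nm) in H1.
    have := e0 m; lra.
  - have [_ H1] := up (n - m)%nat m; rewrite (Arith_base.le_plus_minus_r_stt m n nm) in H1.
    have := e0 n; lra. }
have Hb : bound (fun y => exists n, y = (x n - e n)%R).
{ by exists (x 0%nat + e 0%nat)%R => y [n ->]; exact: uv. }
have Hi : exists y, exists n, y = (x n - e n)%R by exists (x 0%nat - e 0%nat)%R, 0%nat.
have [l [l1 l2]] := completeness _ Hb Hi.
exists l => n; apply/Rabs_le_between.
have := l1 _ (ex_intro _ n eq_refl).
have : (l <= x n + e n)%R by apply: l2 => y [m ->].
rewrite -/(e n); lra.
Qed.

Lemma dichotomy_limit (x : nat -> C) (L : R) :
  (forall n, (Cmod (x (S n) - x n) <= L / 2 ^ n)%R) ->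
  exists l, forall n, (Cmod (x n - l) <= 4 * L / 2 ^ n)%R.
Proof.
move=> H.
have [u Hu] : exists u, forall n, (Rabs (Re (x n) - u) <= 2 * L / 2 ^ n)%R.
{ apply: dichotomy_limit_R => n; apply: Rle_trans (H n).
  exact: (re_le_Cmod (x (S n) - x n)). }
have [v Hv] : exists v, forall n, (Rabs (Im (x n) - v) <= 2 * L / 2 ^ n)%R.
{ apply: dichotomy_limit_R => n; apply: Rle_trans (H n).
  exact: Rle_trans (Rmax_r _ _) (Rmax_Cmod (x (S n) - x n)). }
exists (u, v) => n.
replace (x n - (u, v)) with (RtoC (Re (x n) - u) + Ci * RtoC (Im (x n) - v)).
- apply: Rle_trans (Cmod_triangle _ _) _.
  rewrite Cmod_mult Cmod_Ci !Cmod_R.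
  have := Hu n; have := Hv n.
  have p2 : (0 < 2 ^ n)%R by apply: pow_lt; lra.
  replace (4 * L / 2 ^ n)%R with (2 * L / 2 ^ n + 2 * L / 2 ^ n)%R by (field; lra).
  lra.
- case: (x n) => p q; rewrite /Cminus /Cplus /Copp /Cmult /Re /Im /=; congr pair; ring.
Qed.

Lemma Cmod_half (x : C) : Cmod (x / 2) = (Cmod x / 2)%R.
Proof.
rewrite Cmod_div; last by move=> /RtoC_inj; lra.
by rewrite Cmod_R Rabs_pos_eq; lra.
Qed.

Lemma C2_neq_0 : RtoC 2 <> 0.
Proof. by move=> /RtoC_inj; lra. Qed.

Section Goursat.
Variables (f : C -> C) (r : R).
Hypothesis Hf : forall z, (Cmod z <= r)%R -> @ex_derive C_AbsRing C_NormedModule f z.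

Lemma seg_integrand_cont (a b : C) (t : R) : (Cmod a <= r)%R -> (Cmod b <= r)%R ->
  (0 <= t <= 1)%R -> Ccont (fun t : R => (b - a) * f (a + t * (b - a))) t.
Proof.
move=> Ha Hb Ht; Ccont.
apply: Cder_cont; apply: ex_derive_Cder; apply: Hf; exact: disk_convex.
Qed.

Lemma seg_correct (a b : C) : (Cmod a <= r)%R -> (Cmod b <= r)%R ->
  is_CInt (fun t => (b - a) * f (a + t * (b - a))) 0 1 (seg f a b).
Proof.
move=> Ha Hb; apply: is_CInt_CInt => [|t Ht]; first lra.
exact: seg_integrand_cont.
Qed.

Lemma seg_sym (a b : C) : (Cmod a <= r)%R -> (Cmod b <= r)%R -> seg f b a = - seg f a b.
Proof.
move=> Ha Hb; apply: CInt_unique.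
have H := is_RInt_swap _ _ _ _ (seg_correct a b Ha Hb).
have H1 : is_CInt (fun t => (b - a) * f (a + t * (b - a))) (-1 * 0 + 1) (-1 * 1 + 1) (- seg f a b).
{ have -> : (-1 * 0 + 1 = 1)%R by lra. have -> : (-1 * 1 + 1 = 0)%R by lra. exact: H. }
apply: is_CInt_ext (is_CInt_comp_lin _ _ _ _ _ _ H1); first lra.
have E1 : RtoC (-1) = - RtoC 1 by rewrite -RtoC_opp; congr RtoC; lra.
move=> t _; rewrite RtoC_plus RtoC_mult E1.
replace (a + (- (1) * t + 1) * (b - a)) with (b + t * (a - b)) by ring.
by ring.
Qed.

Lemma seg_mid (a b : C) : (Cmod a <= r)%R -> (Cmod b <= r)%R ->
  seg f a b = seg f a ((a + b) / 2) + seg f ((a + b) / 2) b.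
Proof.
move=> Ha Hb.
have n2 := C2_neq_0.
have Hm : (Cmod ((a + b) / 2) <= r)%R.
{ rewrite Cmod_half; have := Cmod_triangle a b; lra. }
pose h := fun t : R => (b - a) * f (a + t * (b - a)).
have I1 : is_CInt h 0 (1/2) (CInt h 0 (1/2)).
{ apply: is_CInt_CInt => [|t Ht]; first lra. apply: seg_integrand_cont => //; lra. }
have I2 : is_CInt h (1/2) 1 (CInt h (1/2) 1).
{ apply: is_CInt_CInt => [|t Ht]; first lra. apply: seg_integrand_cont => //; lra. }
have I := is_RInt_Chasles _ _ _ _ _ _ I1 I2.
rewrite {1}/seg (CInt_unique _ _ _ _ I).
have E1 : seg f a ((a + b) / 2) = CInt h 0 (1/2).
{ apply: CInt_unique.
  have I1' : is_CInt h (/2 * 0 + 0) (/2 * 1 + 0) (CInt h 0 (1/2)).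
  { have -> : (/2 * 0 + 0 = 0)%R by lra. have -> : (/2 * 1 + 0 = 1/2)%R by lra. exact: I1. }
  apply: is_CInt_ext (is_CInt_comp_lin _ _ _ _ _ _ I1'); first lra.
  move=> t _; rewrite /h RtoC_plus RtoC_mult RtoC_inv; last lra.
  replace (a + (/ 2 * t + 0) * (b - a)) with (a + t * ((a + b) / 2 - a)) by (field; exact n2).
  by field. }
have E2 : seg f ((a + b) / 2) b = CInt h (1/2) 1.
{ apply: CInt_unique.
  have I2' : is_CInt h (/2 * 0 + /2) (/2 * 1 + /2) (CInt h (1/2) 1).
  { have -> : (/2 * 0 + /2 = 1/2)%R by lra. have -> : (/2 * 1 + /2 = 1)%R by lra. exact: I2. }
  apply: is_CInt_ext (is_CInt_comp_lin _ _ _ _ _ _ I2'); first lra.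
  move=> t _; rewrite /h RtoC_plus RtoC_mult RtoC_inv; last lra.
  replace (a + (/ 2 * t + / 2) * (b - a)) with ((a + b) / 2 + t * (b - (a + b) / 2)) by (field; exact n2).
  by field. }
by rewrite E1 E2.
Qed.

(** Each side of the middle triangle is traversed in the opposite direction by one corner triangle,
    so the inner sides cancel. *)
Lemma tri_split (a b c : C) : (Cmod a <= r)%R -> (Cmod b <= r)%R -> (Cmod c <= r)%R ->
  tri f a b c = tri f a ((a + b) / 2) ((c + a) / 2) + tri f ((a + b) / 2) b ((b + c) / 2)
    + tri f ((c + a) / 2) ((b + c) / 2) c + tri f ((a + b) / 2) ((b + c) / 2) ((c + a) / 2).
Proof.
move=> Ha Hb Hc.
have Hm x y : (Cmod x <= r)%R -> (Cmod y <= r)%R -> (Cmod ((x + y) / 2) <= r)%R.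
{ move=> Hx Hy; rewrite Cmod_half; have := Cmod_triangle x y; lra. }
rewrite /tri (seg_mid a b Ha Hb) (seg_mid b c Hb Hc) (seg_mid c a Hc Ha).
rewrite (seg_sym ((c + a) / 2) ((a + b) / 2)); try exact: Hm.
rewrite (seg_sym ((a + b) / 2) ((b + c) / 2)); try exact: Hm.
rewrite (seg_sym ((b + c) / 2) ((c + a) / 2)); try exact: Hm.
by ring.
Qed.

(* An affine function integrates to the increment of a quadratic polynomial, so its contribution to a closed triangle cancels. *)
Lemma seg_affine_error (z l a b : C) (e rho L : R) :
  (Cmod a <= r)%R -> (Cmod b <= r)%R -> (0 <= e)%R ->
  (Cmod (a - z) <= rho)%R -> (Cmod (b - z) <= rho)%R -> (Cmod (b - a) <= L)%R ->
  (forall w, (Cmod (w - z) <= rho)%R -> (Cmod (f w - f z - l * (w - z)) <= e * Cmod (w - z))%R) ->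
  (Cmod (seg f a b - (f z * (b - a) + l * ((b - z) * (b - z) - (a - z) * (a - z)) / 2))
     <= L * (e * rho))%R.
Proof.
move=> Ha Hb e0 Haz Hbz HL Hw.
have n2 := C2_neq_0.
pose Phi := fun t : R => f z * (a + t * (b - a)) + (l / 2) * ((a + t * (b - a) - z) * (a + t * (b - a) - z)).
pose phi := fun t : R => (b - a) * (f z + l * (a + t * (b - a) - z)).
have I : is_CInt phi 0 1 (Phi 1%R - Phi 0%R).
{ apply: is_CInt_derive; first lra.
  - move=> t _; rewrite /Phi /phi; apply: pder_eq; first by pder.
    by field.
  - move=> t _; rewrite /phi; Ccont. }
have J := is_CInt_minus _ _ _ _ _ _ (seg_correct a b Ha Hb) I.
replace (f z * (b - a) + l * ((b - z) * (b - z) - (a - z) * (a - z)) / 2) with (Phi 1%R - Phi 0%R);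
  last by rewrite /Phi; field.
replace (L * (e * rho))%R with ((1 - 0) * (L * (e * rho)))%R by ring.
apply: is_CInt_bound J; first lra.
move=> t Ht; rewrite /phi.
have Ht' : (Cmod (a + t * (b - a) - z) <= rho)%R.
{ replace (a + t * (b - a) - z) with ((a - z) + t * ((b - z) - (a - z))) by ring.
  exact: disk_convex. }
replace ((b - a) * f (a + t * (b - a)) - (b - a) * (f z + l * (a + t * (b - a) - z))) with
  ((b - a) * (f (a + t * (b - a)) - f z - l * (a + t * (b - a) - z))) by ring.
rewrite Cmod_mult; apply: Rmult_le_compat; try exact: Cmod_ge_0; first exact: HL.
apply: Rle_trans (Hw _ Ht') _; exact: Rmult_le_compat_l.
Qed.

Lemma tri_small (z l a b c : C) (e rho L : R) :
  (Cmod a <= r)%R -> (Cmod b <= r)%R -> (Cmod c <= r)%R -> (0 <= e)%R ->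
  (Cmod (a - z) <= rho)%R -> (Cmod (b - z) <= rho)%R -> (Cmod (c - z) <= rho)%R ->
  (Cmod (b - a) <= L)%R -> (Cmod (c - b) <= L)%R -> (Cmod (a - c) <= L)%R ->
  (forall w, (Cmod (w - z) <= rho)%R -> (Cmod (f w - f z - l * (w - z)) <= e * Cmod (w - z))%R) ->
  (Cmod (tri f a b c) <= 3 * (L * (e * rho)))%R.
Proof.
move=> Ha Hb Hc e0 Haz Hbz Hcz Lab Lbc Lca Hw.
have n2 := C2_neq_0.
have H1 := seg_affine_error z l a b e rho L Ha Hb e0 Haz Hbz Lab Hw.
have H2 := seg_affine_error z l b c e rho L Hb Hc e0 Hbz Hcz Lbc Hw.
have H3 := seg_affine_error z l c a e rho L Hc Ha e0 Hcz Haz Lca Hw.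
move: H1 H2 H3.
set x1 := Cminus _ _. set x2 := Cminus _ _. set x3 := Cminus _ _.
move=> H1 H2 H3.
have -> : tri f a b c = x1 + x2 + x3 by rewrite /x1 /x2 /x3 /tri; field.
have := Cmod_triangle (x1 + x2) x3; have := Cmod_triangle x1 x2; lra.
Qed.

Definition sides (L : R) (a b c : C) : Prop :=
  (Cmod (b - a) <= L)%R /\ (Cmod (c - b) <= L)%R /\ (Cmod (a - c) <= L)%R.

(** Pigeonhole on [tri_split]. The bound on |a' - a| is kept so that the first vertices of
    successive triangles converge geometrically. *)
Lemma tri_quarter (a b c : C) (L k : R) :
  (Cmod a <= r)%R -> (Cmod b <= r)%R -> (Cmod c <= r)%R -> sides L a b c ->
  (k <= Cmod (tri f a b c))%R ->
  exists a' b' c', (Cmod a' <= r)%R /\ (Cmod b' <= r)%R /\ (Cmod c' <= r)%R /\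
    sides (L / 2) a' b' c' /\ (k / 4 <= Cmod (tri f a' b' c'))%R /\ (Cmod (a' - a) <= L)%R.
Proof.
move=> Ha Hb Hc [L1 [L2 L3]] Hk.
have n2 := C2_neq_0.
have Hm x y : (Cmod x <= r)%R -> (Cmod y <= r)%R -> (Cmod ((x + y) / 2) <= r)%R.
{ move=> Hx Hy; rewrite Cmod_half; have := Cmod_triangle x y; lra. }
have Lp : (0 <= L)%R by have := Cmod_ge_0 (b - a); lra.
have half x y : (Cmod y <= L)%R -> x = y / 2 -> (Cmod x <= L / 2)%R.
{ by move=> Hy ->; rewrite Cmod_half; lra. }
have half' x y : (Cmod y <= L)%R -> x = - (y / 2) -> (Cmod x <= L / 2)%R.
{ by move=> Hy ->; rewrite Cmod_opp Cmod_half; lra. }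
have Z x : (Cmod (x - x) <= L)%R by replace (x - x) with (RtoC 0) by ring; rewrite Cmod_0.
have := tri_split a b c Ha Hb Hc.
move Et1 : (tri f a ((a + b) / 2) ((c + a) / 2)) => t1.
move Et2 : (tri f ((a + b) / 2) b ((b + c) / 2)) => t2.
move Et3 : (tri f ((c + a) / 2) ((b + c) / 2) c) => t3.
move Et4 : (tri f ((a + b) / 2) ((b + c) / 2) ((c + a) / 2)) => t4.
move=> E.
have HM1 := Hm a b Ha Hb. have HM2 := Hm b c Hb Hc. have HM3 := Hm c a Hc Ha.
case: (Rle_dec (k / 4) (Cmod t1)) => [H|N1].
{ exists a, ((a + b) / 2), ((c + a) / 2); do 3 (split; first done).
  split; [split; [|split]|split; [by rewrite Et1 | exact: Z]].
  - by apply: (half _ (b - a)) => //; field.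
  - by apply: (half _ (c - b)) => //; field.
  - by apply: (half _ (a - c)) => //; field. }
case: (Rle_dec (k / 4) (Cmod t2)) => [H|N2].
{ exists ((a + b) / 2), b, ((b + c) / 2); do 3 (split; first done).
  split; [split; [|split]|split; first by rewrite Et2].
  - by apply: (half _ (b - a)) => //; field.
  - by apply: (half _ (c - b)) => //; field.
  - by apply: (half _ (a - c)) => //; field.
  - have : (Cmod ((a + b) / 2 - a) <= L / 2)%R by apply: (half _ (b - a)) => //; field.
    lra. }
case: (Rle_dec (k / 4) (Cmod t3)) => [H|N3].
{ exists ((c + a) / 2), ((b + c) / 2), c; do 3 (split; first done).
  split; [split; [|split]|split; first by rewrite Et3].
  - by apply: (half _ (b - a)) => //; field.
  - by apply: (half _ (c - b)) => //; field.
  - by apply: (half _ (a - c)) => //; field.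
  - have : (Cmod ((c + a) / 2 - a) <= L / 2)%R by apply: (half' _ (a - c)) => //; field.
    lra. }
case: (Rle_dec (k / 4) (Cmod t4)) => [H|N4].
{ exists ((a + b) / 2), ((b + c) / 2), ((c + a) / 2); do 3 (split; first done).
  split; [split; [|split]|split; first by rewrite Et4].
  - by apply: (half' _ (a - c)) => //; field.
  - by apply: (half' _ (b - a)) => //; field.
  - by apply: (half' _ (c - b)) => //; field.
  - have : (Cmod ((a + b) / 2 - a) <= L / 2)%R by apply: (half _ (b - a)) => //; field.
    lra. }
exfalso; rewrite E in Hk.
have := Cmod_triangle (t1 + t2 + t3) t4; have := Cmod_triangle (t1 + t2) t3.
have := Cmod_triangle t1 t2; lra.
Qed.

Lemma goursat (a b c : C) : (Cmod a <= r)%R -> (Cmod b <= r)%R -> (Cmod c <= r)%R -> tri f a b c = 0.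
Proof.
move=> Ha Hb Hc; apply: Cmod_eq_0; apply: NNPP => tau0.
set tau := Cmod (tri f a b c) in tau0.
have taup : (0 < tau)%R by have := Cmod_ge_0 (tri f a b c); rewrite -/tau; lra.
pose L := (Cmod (b - a) + Cmod (c - b) + Cmod (a - c))%R.
have HL : sides L a b c.
{ rewrite /L; have := Cmod_ge_0 (b - a); have := Cmod_ge_0 (c - b); have := Cmod_ge_0 (a - c).
  split; [|split]; lra. }
pose good n (T : C * C * C) := let '(a, b, c) := T in
  (Cmod a <= r)%R /\ (Cmod b <= r)%R /\ (Cmod c <= r)%R /\ sides (L / 2 ^ n) a b c /\
  (tau / 4 ^ n <= Cmod (tri f a b c))%R.
have p2 n : (0 < 2 ^ n)%R by apply: pow_lt; lra.
have p4 n : (0 < 4 ^ n)%R by apply: pow_lt; lra.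
(* [choice] asks for a total step function; a triangle that is not good is sent to itself. *)
have stp : forall nT : nat * (C * C * C), exists T' : C * C * C, good (fst nT) (snd nT) ->
   good (S (fst nT)) T' /\ (Cmod (fst (fst T') - fst (fst (snd nT))) <= L / 2 ^ (fst nT))%R.
{ move=> [n [[a1 b1] c1]] /=.
  case: (classic (good n (a1, b1, c1))) => [[H1 [H2 [H3 [H4 H5]]]]|N]; last by exists (a1, b1, c1).
  have [a' [b' [c' [K1 [K2 [K3 [K4 [K5 K6]]]]]]]] := tri_quarter _ _ _ _ _ H1 H2 H3 H4 H5.
  exists (a', b', c') => _; split => //.
  do 3 (split; first done); split.
  - replace (L / 2 ^ S n)%R with (L / 2 ^ n / 2)%R => //.
    rewrite /=; field; have := p2 n; lra.
  - replace (tau / 4 ^ S n)%R with (tau / 4 ^ n / 4)%R => //.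
    rewrite /=; field; have := p4 n; lra. }
have [g Hg] := choice _ stp.
pose T := fix T n := match n with O => (a, b, c) | S m => g (m, T m) end.
have GT n : good n (T n).
{ elim: n => [|n IH].
  - do 3 (split; first done); split.
    + by rewrite /= Rdiv_1_r.
    + by rewrite /= Rdiv_1_r; apply: Rle_refl.
  - exact: (proj1 (Hg (n, T n) IH)). }
have [z Hz] : exists z, forall n, (Cmod (fst (fst (T n)) - z) <= 4 * L / 2 ^ n)%R.
{ apply: dichotomy_limit => n; exact: (proj2 (Hg (n, T n) (GT n))). }
have L0 : (0 <= L)%R.
{ rewrite /L; have := Cmod_ge_0 (b - a); have := Cmod_ge_0 (c - b); have := Cmod_ge_0 (a - c); lra. }
(* The first vertex is within 4L/2^n of the limit and the sides are at most L/2^n, so the whole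
   triangle is within 5L/2^n. *)
have small d : (0 < d)%R -> exists n, (5 * L / 2 ^ n < d)%R.
{ move=> d0.
  have [n Hn] := pow_lt_1_zero (/ 2) ltac:(rewrite Rabs_pos_eq; lra) (d / (5 * L + 1)) ltac:(apply: Rdiv_lt_0_compat; lra).
  exists n; have := Hn n (le_n n); rewrite Rabs_pos_eq; last by apply: pow_le; lra.
  rewrite pow_inv => H.
  apply: (Rle_lt_trans _ ((5 * L + 1) * / 2 ^ n)).
  - apply: Rmult_le_compat_r; last lra. apply: Rlt_le; exact: Rinv_0_lt_compat.
  - replace d with ((5 * L + 1) * (d / (5 * L + 1)))%R by (field; lra).
    apply: Rmult_lt_compat_l; lra. }
have Hzr : (Cmod z <= r)%R.
{ apply: Rnot_lt_le => Hlt.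
  have [n Hn] := small (Cmod z - r)%R ltac:(lra).
  have := Hz n; have := GT n; case: (T n) => [[a1 b1] c1] /= [H1 _] H2.
  have := Cmod_triangle_minus z a1; rewrite Cmod_minus_sym.
  have : (4 * L / 2 ^ n <= 5 * L / 2 ^ n)%R.
  { apply: Rmult_le_compat_r; last lra. apply: Rlt_le; exact: Rinv_0_lt_compat. }
  lra. }
(* [tri_small] with sides L/2^n and radius 5L/2^n bounds the integral by 15 L^2 e / 4^n, which this
   choice puts below half of the lower bound tau / 4^n. *)
pose e := (tau / (15 * L * L + 1) / 2)%R.
have LL : (0 < 15 * L * L + 1)%R by nra.
have e0 : (0 < e)%R by rewrite /e; do 2 (apply: Rdiv_lt_0_compat; try lra).
have [d [d0 Hd]] := proj1 (Cder_iff _ _ _) (ex_derive_Cder _ _ (Hf z Hzr)) e e0.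
have [n Hn] := small d d0.
have := Hz n; have := GT n; case: (T n) => [[a1 b1] c1] /= [K1 [K2 [K3 [[S1 [S2 S3]] K4]]]] K5.
have q2 := Rinv_0_lt_compat _ (p2 n).
have E5 : (4 * L / 2 ^ n + L / 2 ^ n = 5 * L / 2 ^ n)%R by field; have := p2 n; lra.
have Lq : (0 <= L / 2 ^ n)%R by apply: Rmult_le_pos; lra.
have B1 : (Cmod (b1 - z) <= 5 * L / 2 ^ n)%R.
{ have := Cmod_triangle (b1 - a1) (a1 - z); replace (b1 - a1 + (a1 - z)) with (b1 - z) by ring. lra. }
have C1 : (Cmod (c1 - z) <= 5 * L / 2 ^ n)%R.
{ have := Cmod_triangle (c1 - a1) (a1 - z); replace (c1 - a1 + (a1 - z)) with (c1 - z) by ring.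
  rewrite (Cmod_minus_sym c1 a1). lra. }
have := tri_small z (C_derive f z) a1 b1 c1 e (5 * L / 2 ^ n) (L / 2 ^ n) K1 K2 K3 (Rlt_le _ _ e0)
  ltac:(lra) B1 C1 S1 S2 S3 (fun w Hw => Hd w (Rle_lt_trans _ _ _ Hw Hn)).
move=> K6.
have E4 : (4 ^ n = 2 ^ n * 2 ^ n)%R by rewrite -Rpow_mult_distr; congr pow; lra.
have : (tau / 4 ^ n <= 15 * L * L * e / 4 ^ n)%R.
{ apply: Rle_trans K4 _; apply: Rle_trans K6 _; apply: Req_le; rewrite E4; field; have := p2 n; lra. }
move/(Rmult_le_compat_r (4 ^ n) _ _ (Rlt_le _ _ (p4 n))).
have n4 : (4 ^ n <> 0)%R by have := p4 n; lra.
have -> : (tau / 4 ^ n * 4 ^ n = tau)%R by field.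
have -> : (15 * L * L * e / 4 ^ n * 4 ^ n = 15 * (L * (L * e)))%R by field.
have : (15 * (L * (L * e)) <= tau / 2)%R.
{ replace (15 * (L * (L * e)))%R with ((15 * L * L) * e)%R by ring.
  apply: (Rle_trans _ ((15 * L * L + 1) * e)); first nra.
  apply: Req_le; rewrite /e; field; lra. }
lra.
Qed.

(** By Goursat on the triangle 0, z, w, the increment of the integral from 0 is the integral over
    [z, w] alone, where f is close to f z. *)
Lemma seg_primitive (z : C) : (Cmod z < r)%R -> Cder (seg f 0) z (f z).
Proof.
move=> Hz; apply/Cder_iff => e e0.
have Hz' : (Cmod z <= r)%R by lra.
have r0 : (Cmod 0 <= r)%R by rewrite Cmod_0; have := Cmod_ge_0 z; lra.
have [d [d0 Hd]] := proj1 (locally_Cmod _ _)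
   (proj1 (Ccont_iff _ _ _) (Cder_cont _ _ _ (ex_derive_Cder _ _ (Hf z Hz'))) e e0).
exists (Rmin d (r - Cmod z)); split; first by apply: Rmin_glb_lt; lra.
move=> w Hw.
have Hw1 := Rlt_le_trans _ _ _ Hw (Rmin_l _ _).
have Hw2 := Rlt_le_trans _ _ _ Hw (Rmin_r _ _).
have Hwr : (Cmod w <= r)%R by have := Cmod_triangle_minus w z; lra.
have T := goursat 0 z w r0 Hz' Hwr.
rewrite /tri (seg_sym 0 w) // in T.
have -> : seg f 0 w - seg f 0 z - f z * (w - z) = seg f z w - f z * (w - z).
{ replace (seg f z w) with (seg f 0 z + seg f z w + - seg f 0 w + seg f 0 w - seg f 0 z) by ring.
  rewrite T; ring. }
have I := is_CInt_minus _ _ _ _ _ _ (seg_correct z w Hz' Hwr) (is_CInt_const (f z * (w - z)) 0 1).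
replace (f z * (w - z)) with (RtoC (1 - 0) * (f z * (w - z))); last by rewrite Rminus_0_r; ring.
replace (e * Cmod (w - z))%R with ((1 - 0) * (e * Cmod (w - z)))%R by ring.
apply: is_CInt_bound I; first lra.
move=> t Ht.
replace ((w - z) * f (z + t * (w - z)) - f z * (w - z)) with ((f (z + t * (w - z)) - f z) * (w - z)) by ring.
rewrite Cmod_mult; apply: Rmult_le_compat_r; first exact: Cmod_ge_0.
apply: Rlt_le; apply: Hd.
replace (z + t * (w - z) - z) with (RtoC t * (w - z)) by ring.
rewrite Cmod_mult Cmod_R Rabs_pos_eq; last lra.
have := Cmod_ge_0 (w - z); nra.
Qed.

End Goursat.

(** * Cauchy's formula on a circle *)

Definition cis (t : R) : C := (cos t, sin t).

Lemma pder_cis (t : R) : pder cis t (Ci * cis t).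
Proof. apply: pder_pair; rewrite /cis /Re /Im /=; auto_derive => //; ring. Qed.

Lemma Cmod_cis (t : R) : Cmod (cis t) = 1%R.
Proof.
rewrite /Cmod /cis /= !Rmult_1_r; have := sin2_cos2 t; rewrite /Rsqr => H.
by rewrite Rplus_comm H sqrt_1.
Qed.

Lemma cis_0 : cis 0 = 1.
Proof. by rewrite /cis cos_0 sin_0. Qed.

Lemma cis_2PI : cis (2 * PI) = 1.
Proof. by rewrite /cis cos_2PI sin_2PI. Qed.

Lemma Ccont_cis (t : R) : Ccont cis t.
Proof. exact: pder_cont (pder_cis t). Qed.

Lemma Ccont_cis_snd (p : C * R) : Ccont (fun q : C * R => cis (snd q)) p.
Proof.
apply: (continuous_comp (fun q : C * R => snd q) cis); last exact: Ccont_cis.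
destruct p; exact: continuous_snd.
Qed.

(** The angle is kept in a compact interval, so that extrema over circles become extrema over
    [0, 2 PI]. *)
Lemma polar (z : C) : exists t, (0 <= t <= 2 * PI)%R /\ z = Cmod z * cis t.
Proof.
have := PI_RGT_0 => pi0.
case: (Ceq_dec z 0) => [->|z0].
{ exists 0%R; split; first lra. rewrite Cmod_0; ring. }
have m0 : (0 < Cmod z)%R by apply/Cmod_gt_0.
set x := (Re z / Cmod z)%R. set y := (Im z / Cmod z)%R.
have E : (x * x + y * y = 1)%R.
{ have := Cmod2_alt z; rewrite /x /y => H.
  replace (Re z / Cmod z * (Re z / Cmod z) + Im z / Cmod z * (Im z / Cmod z))%R with
    ((Re z ^ 2 + Im z ^ 2) / Cmod z ^ 2)%R by (field; lra).
  rewrite -H; field; lra. }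
have x1 : (-1 <= x <= 1)%R by nra.
have Ez : z = Cmod z * (x, y).
{ rewrite /x /y; case: z z0 m0 {E x1 x y} => p q z0 m0.
  rewrite /Cmult /Re /Im /RtoC /=; congr pair; field; lra. }
have Hs : (sqrt (1 - x * x) = Rabs y)%R.
{ replace (1 - x * x)%R with (y * y)%R by lra; exact: sqrt_Rsqr_abs. }
have Hsin : sin (acos x) = Rabs y by rewrite sin_acos // -Hs /Rsqr.
have Ha := acos_bound x.
case: (Rle_dec 0 y) => y0.
- exists (acos x); split; first lra.
  rewrite {1}Ez /cis cos_acos // Hsin Rabs_pos_eq //.
- exists (2 * PI - acos x)%R; split; first lra.
  rewrite {1}Ez /cis.
  have -> : cos (2 * PI - acos x) = x.
  { rewrite cos_minus cos_2PI sin_2PI cos_acos //; ring. }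
  have -> // : sin (2 * PI - acos x) = y.
  rewrite sin_minus cos_2PI sin_2PI Hsin Rabs_left; lra.
Qed.

Ltac circ_step :=
  match goal with
  | |- Ccont (fun q => cis (snd q)) _ => apply Ccont_cis_snd
  | |- Ccont (fun q => cis q) _ => apply Ccont_cis
  | |- Ccont cis _ => apply Ccont_cis
  | |- pder (fun q => cis q) _ _ => apply pder_cis
  | |- pder cis _ _ => apply pder_cis
  | _ => Ccont_step
  | _ => pder_step
  end.
Ltac circ := repeat circ_step.

(** The device by which circle integrals are evaluated: the integrand is deformed by a parameter s,
    and its s-derivative is a total t-derivative of a function with equal values at 0 and 2 PI, so
    the integral does not depend on s. *)
Lemma Cder_const_on_01 (phi : C -> C) :
  (forall s : R, (0 <= s <= 1)%R -> Cder phi s 0) -> phi 1 = phi 0.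
Proof.
move=> H.
have H1 s : (0 <= s <= 1)%R -> pder (fun s : R => phi s) s 0.
{ move=> Hs; apply: pder_eq; first apply: (pder_comp phi (fun s : R => RtoC s) s 0 1).
  - exact: H.
  - exact: pder_id.
  - by ring. }
have := mean_value_bound (fun s : R => phi s) (fun _ => 0) 0 1 0 Rle_0_1 H1.
rewrite Cmod_0 => H2.
have H3 : (Cmod (phi 1 - phi 0) <= 0 * (1 - 0))%R by apply: H2 => t _; apply: Rle_refl.
have H4 : phi 1 - phi 0 = 0 by apply: Cmod_eq_0; have := Cmod_ge_0 (phi 1 - phi 0); lra.
by replace (phi 1) with (phi 1 - phi 0 + phi 0) by ring; rewrite H4; ring.
Qed.

Lemma is_CInt_closed (g g' : R -> C) (a b : R) :
  (a <= b)%R -> (forall t, (a <= t <= b)%R -> pder g t (g' t)) ->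
  (forall t, (a <= t <= b)%R -> Ccont g' t) -> g a = g b -> CInt g' a b = 0.
Proof.
move=> ab H1 H2 E; rewrite (CInt_unique _ _ _ _ (is_CInt_derive g g' a b ab H1 H2)) E; ring.
Qed.

Section Cauchy.
Variables (F f : C -> C) (r R0 : R).
Hypothesis r0 : (0 < r < R0)%R.
Hypothesis HF : forall z, (Cmod z < R0)%R -> Cder F z (f z).
Hypothesis Hf : forall z, (Cmod z < R0)%R -> Ccont f z.

Let TPI0 : (0 <= 2 * PI)%R.
Proof. have := PI_RGT_0; lra. Qed.

Lemma Cmod_circle (t : R) : Cmod (r * cis t) = r.
Proof. by rewrite Cmod_mult Cmod_cis Cmod_R Rabs_pos_eq; lra. Qed.

Lemma circle_neq (z : C) (t : R) : (Cmod z < r)%R -> r * cis t - z <> 0.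
Proof.
move=> Hz E; have : r * cis t = z by replace z with (r * cis t - (r * cis t - z)) by ring; rewrite E; ring.
move/(f_equal Cmod); rewrite Cmod_circle; lra.
Qed.

(** The pole is moved from z to 0 along s z. With c = r cis t, the s-derivative c z / (c - s z)^2 is
    the t-derivative of i z / (c - s z); at s = 0 the integrand is 1. *)
Lemma circle_kernel (z : C) : (Cmod z < r)%R ->
  CInt (fun t => r * cis t / (r * cis t - z)) 0 (2 * PI) = RtoC (2 * PI).
Proof.
move=> Hz.
pose psi := fun s : C => CInt (fun t => r * cis t / (r * cis t - s * z)) 0 (2 * PI).
have E : psi 1 = psi 0.
{ apply: Cder_const_on_01 => s Hs.
  have z0 := Cmod_ge_0 z.
  pose d := ((r - Cmod z) / (Cmod z + 1))%R.
  have d0 : (0 < d)%R by apply: Rdiv_lt_0_compat; lra.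
  have near w : (Cmod (w - s) < d)%R -> (Cmod (w * z) < r)%R.
  { move=> Hw; replace (w * z) with ((w - s) * z + s * z) by ring.
    apply: Rle_lt_trans (Cmod_triangle _ _) _; rewrite !Cmod_mult Cmod_R Rabs_pos_eq; last lra.
    have : ((Cmod z + 1) * d = r - Cmod z)%R by rewrite /d; field; lra.
    have := Cmod_ge_0 (w - s); nra. }
  have ss : (Cmod (s * z) < r)%R.
  { apply: near; replace (s - s) with (RtoC 0) by ring; by rewrite Cmod_0. }
  have D : Cder psi s (CInt (fun t => r * cis t * z / ((r * cis t - s * z) * (r * cis t - s * z))) 0 (2 * PI)).
  { apply: (Cder_CInt (fun s t => r * cis t / (r * cis t - s * z)) (fun s t => r * cis t * z / ((r * cis t - s * z) * (r * cis t - s * z))) s 0 (2 * PI) d) => //.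
    - move=> w t /near Hw _; have n := circle_neq _ t Hw.
      apply: Cder_eq; first by Cder.
      by field.
    - move=> w t /near Hw _; have n := circle_neq _ t Hw; by circ.
    - move=> t _; have n := circle_neq _ t ss; circ => /=; exact: Cmult_neq_0. }
  rewrite (is_CInt_closed (fun t => Ci * z / (r * cis t - s * z))) // in D.
  - move=> t _; have n := circle_neq _ t ss.
    apply: pder_eq.
    + apply: (pder_comp (fun w => Ci * z / (r * w - s * z)) cis); last exact: pder_cis.
      by Cder.
    + have Ci2 : Ci * Ci = - 1 by rewrite /Ci /Cmult /Copp /RtoC /=; congr pair; ring.
      replace (r * cis t * z) with (- (Ci * Ci) * r * cis t * z) by (rewrite Ci2; ring).
      by cfield.
  - move=> t _; have n := circle_neq _ t ss; circ => /=; exact: Cmult_neq_0.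
  - by rewrite cis_0 cis_2PI. }
rewrite /psi in E.
transitivity (CInt (fun t => r * cis t / (r * cis t - 1 * z)) 0 (2 * PI)).
{ by apply: CInt_ext => // t _; congr (_ / _); ring. }
rewrite E; apply: CInt_unique.
apply: (is_CInt_ext (fun _ => 1)) => //.
- move=> t _; have n : r * cis t - 0 * z <> 0.
  { apply: circle_neq; rewrite Cmult_0_l Cmod_0; lra. }
  have E0 : r * cis t - 0 * z = r * cis t by ring.
  by rewrite E0 in n *; rewrite /Cdiv Cinv_r.
- have := is_CInt_const 1 0 (2 * PI); by rewrite Rminus_0_r Cmult_1_r.
Qed.

(** The circle is contracted to z along z + s (r cis t - z). The formula is stated for a function
    with a continuous derivative, which is known at this point only for primitives such as that of
    [seg_primitive]. *)
Lemma cauchy_formula (z : C) : (Cmod z < r)%R ->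
  CInt (fun t => F (r * cis t) * (r * cis t) / (r * cis t - z)) 0 (2 * PI) = RtoC (2 * PI) * F z.
Proof.
move=> Hz.
pose phi := fun s : C => CInt (fun t => F (z + s * (r * cis t - z)) * (r * cis t / (r * cis t - z))) 0 (2 * PI).
have seg_r (s : R) t : (0 <= s <= 1)%R -> (Cmod (z + s * (r * cis t - z)) <= r)%R.
{ move=> Hs; apply: disk_convex => //; first lra. rewrite Cmod_circle; lra. }
have E : phi 1 = phi 0.
{ apply: Cder_const_on_01 => s Hs.
  pose d := ((R0 - r) / (2 * r))%R.
  have d0 : (0 < d)%R by apply: Rdiv_lt_0_compat; lra.
  have near w t : (Cmod (w - s) < d)%R -> (Cmod (z + w * (r * cis t - z)) < R0)%R.
  { move=> Hw; replace (z + w * (r * cis t - z)) with ((z + s * (r * cis t - z)) + (w - s) * (r * cis t - z)) by ring.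
    apply: Rle_lt_trans (Cmod_triangle _ _) _; rewrite Cmod_mult.
    have := seg_r s t Hs.
    have H2 : (Cmod (r * cis t - z) <= 2 * r)%R.
    { have := Cmod_triangle (r * cis t) (- z); rewrite Cmod_opp Cmod_circle /Cminus; lra. }
    have : (2 * r * d = R0 - r)%R by rewrite /d; field; lra.
    have := Cmod_ge_0 (w - s); have := Cmod_ge_0 (r * cis t - z); nra. }
  have nears t : (Cmod (z + s * (r * cis t - z)) < R0)%R by have := seg_r s t Hs; lra.
  have D : Cder phi s (CInt (fun t => f (z + s * (r * cis t - z)) * (r * cis t)) 0 (2 * PI)).
  { apply: (Cder_CInt (fun s t => F (z + s * (r * cis t - z)) * (r * cis t / (r * cis t - z)))
       (fun s t => f (z + s * (r * cis t - z)) * (r * cis t)) s 0 (2 * PI) d) => //.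
    - move=> w t Hw _; have n := circle_neq _ t Hz.
      have DF := HF _ (near w t Hw).
      apply: Cder_eq; first by Cder; exact: DF.
      by field.
    - move=> w t Hw _; have n := circle_neq _ t Hz.
      have DF := Cder_cont _ _ _ (HF _ (near w t Hw)); by circ.
    - move=> t _; have n := circle_neq _ t Hz.
      have DF := Hf _ (nears t); by circ. }
  (* The primitive in t is F(z + s (r cis t - z)) / (i s) and degenerates at s = 0, where the
     integrand is f z times r cis t and is integrated directly. *)
  case: (Req_dec s 0) => s0.
  - move: D; rewrite s0.
    rewrite (is_CInt_closed (fun t => f z * (r * cis t / Ci))) //.
    + move=> t _; have Ci0 : Ci <> 0 by case; lra.
      apply: pder_eq; first by apply: (pder_comp (fun w => f z * (r * w / Ci)) cis); [Cder | exact: pder_cis].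
      replace (z + 0 * (r * cis t - z)) with z by ring.
      by field.
    + move=> t _; have DF := Hf _ (nears t); rewrite s0 in DF; by circ.
    + by rewrite cis_0 cis_2PI.
  - rewrite (is_CInt_closed (fun t => F (z + s * (r * cis t - z)) / (Ci * s))) // in D.
    + move=> t _; have Ci0 : Ci <> 0 by case; lra.
      have s0' : RtoC s <> 0 by move=> /RtoC_inj.
      have DF := HF _ (nears t).
      have n0 : Ci * s <> 0 by apply: Cmult_neq_0.
      apply: pder_eq; first by apply: (pder_comp (fun w => F (z + s * (r * w - z)) / (Ci * s)) cis); [Cder; exact: n0 | exact: pder_cis].
      by field.
    + move=> t _; have DF := Hf _ (nears t); by circ.
    + by rewrite cis_0 cis_2PI. }
transitivity (phi 1).
{ apply: CInt_ext => // t _; have n := circle_neq _ t Hz.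
  replace (z + 1 * (r * cis t - z)) with (r * cis t) by ring. by field. }
rewrite E -(circle_kernel z Hz) Cmult_comm.
transitivity (CInt (fun t => F z * (r * cis t / (r * cis t - z))) 0 (2 * PI)).
{ apply: CInt_ext => // t _; by replace (z + 0 * (r * cis t - z)) with z by ring. }
apply: CInt_unique; apply: is_CInt_scal; apply: is_CInt_CInt => // t _.
have n := circle_neq _ t Hz; by circ.
Qed.

End Cauchy.

Lemma two_PI_pos : (0 < 2 * PI)%R.
Proof. have := PI_RGT_0; lra. Qed.

(** Cauchy's formula on the circle of radius 1/2 is applied to the primitive F of f, available on
    the disk of radius 3/4. The kernels [K k] satisfy K k' = k K (k + 1), so F, f and f' equal K 1,
    K 2 and 2 K 3 up to the factor 1/(2 PI), and the last is differentiable again. *)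
Lemma derive_differentiable_at_0 (f : C -> C) :
  (forall z, (Cmod z < 1)%R -> @ex_derive C_AbsRing C_NormedModule f z) -> holo (C_derive f) 0.
Proof.
move=> H.
have TPI0 := two_PI_pos.
have TPIn : RtoC (2 * PI) <> 0 by move=> /RtoC_inj; lra.
have D34 z : (Cmod z < 3 / 4)%R -> Cder (seg f 0) z (f z).
{ move=> Hz; apply: (seg_primitive f (3 / 4)) => // w Hw; apply: H; lra. }
have Hfc z : (Cmod z < 3 / 4)%R -> Ccont f z.
{ move=> Hz; apply: Cder_cont; apply: ex_derive_Cder; apply: H; lra. }
set F := seg f 0 in D34.
have r0 : (0 < / 2 < 3 / 4)%R by lra.
have n t z : (Cmod z < / 2)%R -> (/ 2)%R * cis t - z <> 0 by apply: (circle_neq _ (3/4)).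
have HF t : Ccont F ((/ 2)%R * cis t).
{ apply: Cder_cont; apply: D34; rewrite (Cmod_circle _ (3/4)) //; lra. }
have near0 z w : (Cmod z < / 2)%R -> (Cmod (w - z) < / 2 - Cmod z)%R -> (Cmod w < / 2)%R.
{ move=> Hz Hw; have := Cmod_triangle_minus w z; lra. }
pose K k z := CInt (fun t => F ((/ 2)%R * cis t) * ((/ 2)%R * cis t) * (/ ((/ 2)%R * cis t - z)) ^ k) 0 (2 * PI).
have KD k z : (Cmod z < / 2)%R -> Cder (K k) z (RtoC (INR k) * K (S k) z).
{ move=> Hz.
  have pw x : Cder (fun v => v ^ k) x (RtoC (INR k) * x ^ (k - 1)).
  { elim: k => [|k IH]; first by apply: Cder_eq; [exact: Cder_const | rewrite /=; ring].
    apply: Cder_eq; first by apply: (Cder_mult (fun v => v) (fun v => v ^ k)); [exact: Cder_id | exact: IH].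
    rewrite S_INR RtoC_plus /= Nat.sub_0_r; case: k {IH} => [|k]; rewrite /=; first by ring.
    by rewrite Nat.sub_0_r; ring. }
  have pc (T : UniformSpace) (u : T -> C) (p : T) : Ccont u p -> Ccont (fun q => u q ^ k) p.
  { move=> Hu; apply: (Ccont_comp T (fun v => v ^ k) u p) => //; exact: Cder_cont (pw _). }
  have pc1 (T : UniformSpace) (u : T -> C) (p : T) : Ccont u p -> Ccont (fun q => u q ^ S k) p.
  { move=> Hu; apply: (Ccont_mult T u (fun q => u q ^ k)) => //; exact: pc. }
  have -> : RtoC (INR k) * K (S k) z = CInt (fun t => RtoC (INR k) *
     (F ((/ 2)%R * cis t) * ((/ 2)%R * cis t) * (/ ((/ 2)%R * cis t - z)) ^ (S k))) 0 (2 * PI).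
  { symmetry; apply: CInt_unique; apply: is_CInt_scal; apply: is_CInt_CInt; first lra.
    move=> t _; have n1 := n t z Hz; have HFt := HF t.
    apply: Ccont_mult; first by circ; exact: HFt.
    apply: pc1; by circ. }
  apply: (Cder_CInt (fun z t => F ((/ 2)%R * cis t) * ((/ 2)%R * cis t) * (/ ((/ 2)%R * cis t - z)) ^ k)
    (fun z t => RtoC (INR k) * (F ((/ 2)%R * cis t) * ((/ 2)%R * cis t) * (/ ((/ 2)%R * cis t - z)) ^ (S k)))
    z 0 (2 * PI) (/ 2 - Cmod z)); try lra.
  - move=> w t Hw _; have n1 := n t w (near0 z w Hz Hw).
    apply: Cder_eq.
    + apply: (Cder_mult (fun v => F ((/ 2)%R * cis t) * ((/ 2)%R * cis t))); first exact: Cder_const.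
      apply: (Cder_comp (fun v => v ^ k) (fun z => / ((/ 2)%R * cis t - z))); first exact: pw.
      by Cder.
    + case: k {pw pc pc1} => [|k]; rewrite /=; first by ring.
      rewrite Nat.sub_0_r.
      set q := / ((/ 2)%R * cis t - w).
      have -> : - (0 - 1) / (((/ 2)%R * cis t - w) * ((/ 2)%R * cis t - w)) = q * q by rewrite /q; field.
      by ring.
  - move=> w t Hw _; have n1 := n t w (near0 z w Hz Hw); have HFt := HF t.
    apply: Ccont_mult; first by circ; exact: HFt.
    apply: pc; by circ.
  - move=> t _; have n1 := n t z Hz; have HFt := HF t.
    apply: Ccont_mult; first by circ.
    apply: Ccont_mult.
    + apply: Ccont_mult; last by circ.
      apply: (Ccont_comp _ F (fun q : C * R => (/ 2)%R * cis (snd q))); [exact: HFt | by circ].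
    + apply: pc1; by circ. }
have loc z : (Cmod z < / 2)%R -> @locally C_UniformSpace z (fun w => (Cmod w < / 2)%R).
{ move=> Hz; apply/locally_Cmod; exists (/ 2 - Cmod z)%R; split; first lra.
  move=> w; exact: near0. }
have E z : (Cmod z < / 2)%R -> / RtoC (2 * PI) * K 2%nat z = f z.
{ move=> Hz; apply: (Cder_uniq F z); last by apply: D34; lra.
  apply: (Cder_ext_loc (fun w => / RtoC (2 * PI) * K 1%nat w)).
  - apply: filter_imp (loc z Hz) => w Hw.
    have C1 := cauchy_formula F f (/ 2) (3 / 4) r0 D34 Hfc w Hw.
    replace (F w) with (/ RtoC (2 * PI) * (RtoC (2 * PI) * F w)) by (field; exact TPIn).
    rewrite -C1; congr (_ * _); apply: CInt_ext; first lra.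
    move=> t _; rewrite /=; by rewrite Cmult_1_r.
  - apply: Cder_eq; first by apply: Cder_scal; exact: KD.
    by rewrite /=; ring. }
have E' z : (Cmod z < / 2)%R -> C_derive f z = / RtoC (2 * PI) * (RtoC (INR 2) * K 3%nat z).
{ move=> Hz; apply: Cder_derive.
  apply: (Cder_ext_loc (fun w => / RtoC (2 * PI) * K 2%nat w)).
  - apply: filter_imp (loc z Hz) => w Hw; exact: E.
  - apply: Cder_scal; exact: KD. }
apply: (holo_ext_loc (fun z => / RtoC (2 * PI) * (RtoC (INR 2) * K 3%nat z))).
- have Z : (Cmod 0 < / 2)%R by rewrite Cmod_0; lra.
  apply: filter_imp (loc 0 Z) => w Hw; by rewrite E'.
- have Z : (Cmod 0 < / 2)%R by rewrite Cmod_0; lra.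
  apply: filter_imp (loc 0 Z) => w Hw; apply: Cder_ex.
  do 2 apply: Cder_scal; exact: KD.
Qed.

Lemma holo_derive (f : C -> C) (z : C) : holo f z -> holo (C_derive f) z.
Proof.
move=> Hf; have [d [d0 Hd]] := proj1 (locally_Cmod _ _) Hf.
have dn : RtoC d <> 0 by move=> /RtoC_inj; lra.
pose g := fun w => f (z + d * w).
have dd w : (Cmod w < 1)%R -> (Cmod (z + d * w - z) < d)%R.
{ move=> Hw; replace (z + d * w - z) with (d * w) by ring.
  rewrite Cmod_mult Cmod_R Rabs_pos_eq; nra. }
have Hg w : (Cmod w < 1)%R -> Cder g w (d * C_derive f (z + d * w)).
{ move=> Hw; have Df := ex_derive_Cder _ _ (Hd _ (dd w Hw)).
  apply: Cder_eq; first by apply: (Cder_comp f (fun w => z + d * w)); [exact: Df | Cder].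
  by ring. }
have H0 := derive_differentiable_at_0 g (fun w Hw => Cder_ex _ _ _ (Hg w Hw)).
have inner : holo (fun v => (v - z) / d) z by holo.
apply: (holo_ext_loc (fun v => C_derive g ((v - z) / d) / d)).
- apply/locally_Cmod; exists d; split => // w Hw.
  have E : z + d * ((w - z) / d) = w by field.
  have W : (Cmod ((w - z) / d) < 1)%R.
  { rewrite Cmod_div // Cmod_R Rabs_pos_eq; last lra. apply/Rlt_div_l; lra. }
  by rewrite (Cder_derive _ _ _ (Hg _ W)) E; field.
- apply: holo_div => //; last exact: holo_const.
  apply: (holo_comp (C_derive g) (fun v => (v - z) / d)) => //.
  by replace ((z - z) / d) with (RtoC 0) by (field; exact dn).
Qed.

(** Near the boundary circle no uniform margin of holomorphy is at hand, so the circle of radius s r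
    is deformed for s < 1 only, and s = 1 is reached by continuity uniform in t. *)
Lemma mean_value (f : C -> C) (c : C) (r : R) :
  (0 < r)%R -> (forall z, (Cmod (z - c) <= r)%R -> holo f z) ->
  CInt (fun t => f (c + r * cis t)) 0 (2 * PI) = RtoC (2 * PI) * f c.
Proof.
move=> r0 H.
have TPI0 := two_PI_pos.
pose phi := fun s : C => CInt (fun t => f (c + s * (r * cis t))) 0 (2 * PI).
have Cm s t : Cmod (c + s * (r * cis t) - c) = (Cmod s * r)%R.
{ replace (c + s * (r * cis t) - c) with (s * (r * cis t)) by ring.
  by rewrite !Cmod_mult Cmod_cis Cmod_R Rabs_pos_eq; lra. }
have D (s : R) : (0 <= s < 1)%R -> Cder phi s 0.
{ move=> Hs.
  have near w t : (Cmod (w - s) < 1 - s)%R -> holo f (c + w * (r * cis t)).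
  { move=> Hw; apply: H; rewrite Cm.
    have := Cmod_triangle_minus w s; rewrite Cmod_R Rabs_pos_eq; last lra. nra. }
  have ss : (Cmod (s - s) < 1 - s)%R by replace (s - s) with (RtoC 0) by ring; rewrite Cmod_0; lra.
  have D1 : Cder phi s (CInt (fun t => C_derive f (c + s * (r * cis t)) * (r * cis t)) 0 (2 * PI)).
  { apply: (Cder_CInt (fun s t => f (c + s * (r * cis t))) (fun s t => C_derive f (c + s * (r * cis t)) * (r * cis t)) s 0 (2 * PI) (1 - s)); try lra.
    - move=> w t Hw _; have Hh := near w t Hw.
      apply: Cder_eq; first by Cder.
      by ring.
    - move=> w t Hw _; have Hh := holo_cont _ _ (near w t Hw); by circ.
    - move=> t _; have Hh := holo_cont _ _ (holo_derive _ _ (near s t ss)); by circ. }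
  case: (Req_dec s 0) => s0.
  - move: D1; rewrite s0.
    rewrite (is_CInt_closed (fun t => C_derive f c * (r * cis t / Ci))) //; first lra.
    + move=> t _; have Ci0 : Ci <> 0 by case; lra.
      apply: pder_eq; first by apply: (pder_comp (fun w => C_derive f c * (r * w / Ci)) cis); [Cder | exact: pder_cis].
      replace (c + 0 * (r * cis t)) with c by ring.
      by field.
    + move=> t _; have Hh := holo_cont _ _ (holo_derive _ _ (near s t ss)); rewrite s0 in Hh; by circ.
    + by rewrite cis_0 cis_2PI.
  - rewrite (is_CInt_closed (fun t => f (c + s * (r * cis t)) / (Ci * s))) // in D1; first lra.
    + move=> t _; have Ci0 : Ci <> 0 by case; lra.
      have s0' : RtoC s <> 0 by move=> /RtoC_inj.
      have n0 : Ci * s <> 0 by apply: Cmult_neq_0.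
      have Hh := near s t ss.
      apply: pder_eq; first by apply: (pder_comp (fun w => f (c + s * (r * w)) / (Ci * s)) cis); [Cder; exact: n0 | exact: pder_cis].
      by field.
    + move=> t _; have Hh := holo_cont _ _ (holo_derive _ _ (near s t ss)); by circ.
    + by rewrite cis_0 cis_2PI. }
have C0 (s : R) : (0 <= s < 1)%R -> phi s = phi 0.
{ move=> Hs.
  have := Cder_const_on_01 (fun v => phi (s * v)).
  rewrite Cmult_1_r Cmult_0_r; apply=> u Hu.
  apply: Cder_eq; first apply: (Cder_comp phi (fun v => s * v)).
  - rewrite -RtoC_mult; apply: D; nra.
  - by Cder.
  - by ring. }
have I1 w : (Cmod w <= 1)%R -> is_CInt (fun t => f (c + w * (r * cis t))) 0 (2 * PI) (phi w).
{ move=> Hw; apply: is_CInt_CInt; first lra.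
  move=> t _; have Hh : holo f (c + w * (r * cis t)) by apply: H; rewrite Cm; nra.
  move/holo_cont: Hh => Hh; by circ. }
have E : phi 1 = phi 0.
{ suff : Cmod (phi 1 - phi 0) = 0%R.
  { move/Cmod_eq_0 => K; replace (phi 1) with (phi 1 - phi 0 + phi 0) by ring; rewrite K; ring. }
  apply: Rle_antisym; last exact: Cmod_ge_0.
  apply: Rnot_lt_le => Hlt.
  set e := (Cmod (phi 1 - phi 0) / (2 * PI + 1))%R.
  have e0 : (0 < e)%R by apply: Rdiv_lt_0_compat; lra.
  have U t : (0 <= t <= 2 * PI)%R -> Ccont (fun p : C * R => f (c + fst p * (r * cis (snd p)))) (RtoC 1, t).
  { move=> _; have Hh : holo f (c + 1 * (r * cis t)) by apply: H; rewrite Cm Cmod_1; lra.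
    move/holo_cont: Hh => Hh; by circ. }
  have [d [d0 Hd]] := compact_uniform (fun s t => f (c + s * (r * cis t))) 1 0 (2 * PI) U e e0.
  (* A parameter in [0, 1) at distance less than d from 1. *)
  set s := Rmax 0 (1 - d / 2).
  have Hs : (0 <= s < 1)%R by rewrite /s /Rmax; case: Rle_dec; lra.
  have Hs1 : (Cmod (s - 1) < d)%R.
  { have : (1 - d / 2 <= s)%R by exact: Rmax_r.
    rewrite -RtoC_minus Cmod_R Rabs_left; lra. }
  have Is : (Cmod s <= 1)%R by rewrite Cmod_R Rabs_pos_eq; lra.
  have I := is_CInt_minus _ _ _ _ _ _ (I1 s Is) (I1 1 (Req_le _ _ Cmod_1)).
  have := is_CInt_bound _ _ _ e _ (Rlt_le _ _ TPI0) (fun t Ht => Rlt_le _ _ (Hd s t Hs1 Ht)) I.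
  rewrite (C0 s Hs) Cmod_minus_sym.
  have : (Cmod (phi 1 - phi 0) = (2 * PI + 1) * e)%R by rewrite /e; field; lra.
  lra. }
transitivity (phi 1).
{ apply: CInt_ext; first lra. move=> t _; by rewrite Cmult_1_l. }
rewrite E; apply: CInt_unique.
have := is_CInt_const (f c) 0 (2 * PI); rewrite Rminus_0_r.
apply: is_CInt_ext; first lra. move=> t _; congr f; ring.
Qed.

Lemma continuous_nonneg_RInt_0 (h : R -> R) (a b t0 : R) :
  (a < b)%R -> (forall t, (a <= t <= b)%R -> continuous h t) -> (forall t, (a <= t <= b)%R -> (0 <= h t)%R) ->
  (a <= t0 <= b)%R -> RInt h a b = 0%R -> h t0 = 0%R.
Proof.
move=> ab Hc H0 Ht0 HI.
apply: NNPP => n.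
have hp : (0 < h t0)%R by have := H0 t0 Ht0; lra.
have hp2 : (0 < h t0 / 2)%R by lra.
have [d Hd] : locally t0 (fun s => Rabs (h s - h t0) < h t0 / 2)%R.
{ apply: (Hc t0 Ht0 (fun y => Rabs (y - h t0) < h t0 / 2)%R).
  by exists (mkposreal _ hp2) => y. }
have dp := cond_pos d.
(* t0 may be an end of [a, b]: the subinterval near it lies to its right, or to its left when t0 =
   b. *)
have [u [v [au [uv [vb Huv]]]]] : exists u v, (a <= u)%R /\ (u < v)%R /\ (v <= b)%R /\
   forall s, (u <= s <= v)%R -> (Rabs (s - t0) < d)%R.
{ case: (Rlt_dec t0 b) => tb.
  - exists t0, (Rmin b (t0 + d / 2)); have := Rmin_l b (t0 + d / 2); have := Rmin_r b (t0 + d / 2).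
    have : (t0 < Rmin b (t0 + d / 2))%R by apply: Rmin_glb_lt; lra.
    move=> ? ? ?; do 3 (split; first lra). move=> s Hs; rewrite Rabs_pos_eq; lra.
  - exists (Rmax a (t0 - d / 2)), t0; have := Rmax_l a (t0 - d / 2); have := Rmax_r a (t0 - d / 2).
    have : (Rmax a (t0 - d / 2) < t0)%R by apply: Rmax_lub_lt; lra.
    move=> ? ? ?; do 3 (split; first lra). move=> s Hs; rewrite Rabs_left1; lra. }
have ex x y : (a <= x)%R -> (x <= y)%R -> (y <= b)%R -> ex_RInt h x y.
{ move=> ax xy yb; apply: (@ex_RInt_continuous R_CompleteNormedModule) => t.
  rewrite Rmin_left // Rmax_right // => Ht; apply: Hc; lra. }
have ge0 x y : (a <= x)%R -> (x <= y)%R -> (y <= b)%R -> (0 <= RInt h x y)%R.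
{ move=> ax xy yb; apply: RInt_ge_0 => //; first exact: ex. move=> t Ht; apply: H0; lra. }
have mid : (0 < RInt h u v)%R.
{ apply: RInt_gt_0 => //.
  - move=> t Ht; have : (Rabs (h t - h t0) < h t0 / 2)%R by apply: Hd; apply: Huv; lra.
    move/Rabs_lt_between; lra.
  - move=> t Ht; apply: Hc; lra. }
have C1 := RInt_Chasles h a u v (ex a u ltac:(lra) ltac:(lra) ltac:(lra)) (ex u v ltac:(lra) ltac:(lra) ltac:(lra)).
have C2 := RInt_Chasles h a v b (ex a v ltac:(lra) ltac:(lra) ltac:(lra)) (ex v b ltac:(lra) ltac:(lra) ltac:(lra)).
rewrite /plus /= in C1 C2.
have := ge0 a u ltac:(lra) ltac:(lra) ltac:(lra); have := ge0 v b ltac:(lra) ltac:(lra) ltac:(lra).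
lra.
Qed.

(** The equality clause is the source of strong minimum principles and of the contradiction in
    [Qint_covers]. *)
Lemma mean_value_Re_pos (f : C -> C) (c : C) (r : R) :
  (0 < r)%R -> (forall z, (Cmod (z - c) <= r)%R -> holo f z) ->
  (forall z, Cmod (z - c) = r -> (0 <= Re (f z))%R) ->
  (0 <= Re (f c))%R /\ (Re (f c) = 0%R -> forall z, Cmod (z - c) = r -> Re (f z) = 0%R).
Proof.
move=> r0 H Hpos.
have TPI0 := two_PI_pos.
have cm t : Cmod (c + r * cis t - c) = r.
{ replace (c + r * cis t - c) with (r * cis t) by ring.
  by rewrite Cmod_mult Cmod_cis Cmod_R Rabs_pos_eq; lra. }
have cont t : Ccont (fun t => f (c + r * cis t)) t.
{ have Hh : holo f (c + r * cis t) by apply: H; rewrite cm; lra.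
  move/holo_cont: Hh => Hh; by circ. }
have I : is_CInt (fun t => f (c + r * cis t)) 0 (2 * PI) (RtoC (2 * PI) * f c).
{ rewrite -(mean_value f c r r0 H); apply: is_CInt_CInt; first lra. move=> t _; exact: cont. }
have IR := is_CInt_Re _ _ _ _ I.
have E : Re (RtoC (2 * PI) * f c) = (2 * PI * Re (f c))%R by rewrite /Cmult /RtoC /Re /=; ring.
rewrite E in IR.
have ER : RInt (fun t => Re (f (c + r * cis t))) 0 (2 * PI) = (2 * PI * Re (f c))%R.
{ exact: is_RInt_unique. }
split.
- have : (0 <= 2 * PI * Re (f c))%R.
  { rewrite -ER; apply: RInt_ge_0; first lra.
    - by exists (2 * PI * Re (f c))%R.
    - move=> t _; apply: Hpos; exact: cm. }
  nra.
- move=> E0 z Hz.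
  have [t [Ht Ez]] := polar (z - c).
  have -> : z = c + r * cis t by rewrite -Hz -Ez; ring.
  apply: (continuous_nonneg_RInt_0 (fun t => Re (f (c + r * cis t))) 0 (2 * PI) t) => //.
  + move=> s _; apply: Ccont_Re; exact: cont.
  + move=> s _; apply: Hpos; exact: cm.
  + by rewrite ER E0 Rmult_0_r.
Qed.

(** * Maximum principles and the Schwarz lemma *)

Lemma Csub0 (w : C) : w - 0 = w.
Proof. ring. Qed.

Lemma Cneq_1_plus (w : C) : (Cmod w < 1)%R -> 1 + w <> 0.
Proof.
move=> Hw E; have H : w = - (1) by replace w with (1 + w - 1) by ring; rewrite E; ring.
by move: Hw; rewrite H Cmod_m1; lra.
Qed.

Lemma sigma_den (a z : C) : (Cmod a < 1)%R -> (Cmod z <= 1)%R -> 1 + Cconj a * z <> 0.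
Proof.
move=> Ha Hz; apply: Cneq_1_plus; rewrite Cmod_mult Cmod_conj.
have := Cmod_ge_0 a; have := Cmod_ge_0 z; nra.
Qed.

Lemma sigma_identity (a z : C) :
  (Cmod (1 + Cconj a * z) ^ 2 - Cmod (z + a) ^ 2 = (1 - Cmod a ^ 2) * (1 - Cmod z ^ 2))%R.
Proof.
rewrite !Cmod2_alt; case: a => p q; case: z => x y.
rewrite /Cconj /Cmult /Cplus /RtoC /Re /Im /=; ring.
Qed.

Lemma sigma_le (a z : C) : (Cmod a < 1)%R -> (Cmod z <= 1)%R -> (Cmod (Csigma a z) <= 1)%R.
Proof.
move=> Ha Hz; have n := sigma_den a z Ha Hz.
have p : (0 < Cmod (1 + Cconj a * z))%R by apply/Cmod_gt_0.
rewrite /Csigma Cmod_div //; apply/Rle_div_l => //.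
have := sigma_identity a z; have := Cmod_ge_0 a; have := Cmod_ge_0 z; have := Cmod_ge_0 (z + a) => h1 h2 h3.
have : (0 <= (1 - Cmod a ^ 2) * (1 - Cmod z ^ 2))%R by apply: Rmult_le_pos; nra.
nra.
Qed.

Lemma sigma_lt (a z : C) : (Cmod a < 1)%R -> (Cmod z < 1)%R -> (Cmod (Csigma a z) < 1)%R.
Proof.
move=> Ha Hz; have n := sigma_den a z Ha (Rlt_le _ _ Hz).
have p : (0 < Cmod (1 + Cconj a * z))%R by apply/Cmod_gt_0.
rewrite /Csigma Cmod_div //; apply/Rlt_div_l => //.
have := sigma_identity a z; have := Cmod_ge_0 a; have := Cmod_ge_0 z; have := Cmod_ge_0 (z + a) => h1 h2 h3.
have : (0 < (1 - Cmod a ^ 2) * (1 - Cmod z ^ 2))%R by apply: Rmult_lt_0_compat; nra.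
nra.
Qed.

Lemma sigma_eq1 (a z : C) : (Cmod a < 1)%R -> Cmod z = 1%R -> Cmod (Csigma a z) = 1%R.
Proof.
move=> Ha Hz; have n := sigma_den a z Ha (Req_le _ _ Hz).
have p : (0 < Cmod (1 + Cconj a * z))%R by apply/Cmod_gt_0.
have := sigma_identity a z; rewrite Hz => H.
have E : (Cmod (1 + Cconj a * z) = Cmod (z + a))%R by have := Cmod_ge_0 (z + a); nra.
rewrite /Csigma Cmod_div // -E; field; lra.
Qed.

Lemma Cmod_opp_lt1 (a : C) : (Cmod a < 1)%R -> (Cmod (- a) < 1)%R.
Proof. by rewrite Cmod_opp. Qed.

Lemma one_minus_norm2_neq0 (a : C) : (Cmod a < 1)%R -> 1 - a * Cconj a <> 0.
Proof.
move=> Ha; rewrite -Cmod2_conj -RtoC_minus => /RtoC_inj; have := Cmod_ge_0 a; nra.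
Qed.

Lemma sigma_inv (a z : C) : (Cmod a < 1)%R -> (Cmod z <= 1)%R -> Csigma (- a) (Csigma a z) = z.
Proof.
move=> Ha Hz.
have n := sigma_den a z Ha Hz.
have n2 := sigma_den (- a) (Csigma a z) (Cmod_opp_lt1 a Ha) (sigma_le a z Ha Hz).
have n3 := one_minus_norm2_neq0 a Ha.
have cj : Cconj (- a) = - Cconj a by case: a {Ha n n2 n3} => p q; rewrite /Cconj /Copp.
move: n2; rewrite /Csigma cj => n2.
have E1 : (z + a) / (1 + Cconj a * z) + - a = z * (1 - a * Cconj a) / (1 + Cconj a * z) by field.
have E2 : 1 + - Cconj a * ((z + a) / (1 + Cconj a * z)) = (1 - a * Cconj a) / (1 + Cconj a * z) by field.
rewrite E1 E2; by field.
Qed.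

Lemma sigma_inv' (a z : C) : (Cmod a < 1)%R -> (Cmod z <= 1)%R -> Csigma a (Csigma (- a) z) = z.
Proof.
move=> Ha Hz; have := sigma_inv (- a) z (Cmod_opp_lt1 a Ha) Hz.
by replace (- - a) with a by ring.
Qed.

Lemma Cder_sigma (a z : C) : 1 + Cconj a * z <> 0 ->
  Cder (Csigma a) z ((1 - a * Cconj a) / ((1 + Cconj a * z) * (1 + Cconj a * z))).
Proof.
move=> n; rewrite /Csigma.
apply: Cder_eq; first by Cder.
by field.
Qed.

Lemma holo_sigma (a z : C) : 1 + Cconj a * z <> 0 -> holo (Csigma a) z.
Proof. by move=> n; rewrite /Csigma; holo. Qed.

Lemma holo_sigma_disk (a z : C) : (Cmod a < 1)%R -> (Cmod z <= 1)%R -> holo (Csigma a) z.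
Proof. move=> Ha Hz; apply: holo_sigma; exact: sigma_den. Qed.

Lemma sigma_0 (a : C) : Csigma a 0 = a.
Proof. rewrite /Csigma; replace (1 + Cconj a * 0) with (RtoC 1) by ring; field. Qed.

(* The Moebius change of variable [sigma_a] brings an arbitrary point of the disk to its center. *)
Lemma Re_nonneg_disk (f : C -> C) (c : C) (r : R) (z : C) :
  (0 < r)%R -> (forall z, (Cmod (z - c) <= r)%R -> holo f z) ->
  (forall z, Cmod (z - c) = r -> (0 <= Re (f z))%R) ->
  (Cmod (z - c) <= r)%R -> (0 <= Re (f z))%R.
Proof.
move=> r0 H Hpos Hz.
case: (Rle_lt_or_eq_dec _ _ Hz) => [Hlt|]; last exact: Hpos.
have rn : RtoC r <> 0 by move=> /RtoC_inj; lra.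
set a := (z - c) / r.
have Ha : (Cmod a < 1)%R.
{ rewrite /a Cmod_div // Cmod_R Rabs_pos_eq; last lra. apply/Rlt_div_l; lra. }
have cm w : Cmod (c + r * Csigma a w - c) = (r * Cmod (Csigma a w))%R.
{ replace (c + r * Csigma a w - c) with (r * Csigma a w) by ring.
  by rewrite Cmod_mult Cmod_R Rabs_pos_eq; lra. }
have [] := mean_value_Re_pos (fun w => f (c + r * Csigma a w)) 0 1 Rlt_0_1.
- move=> w; rewrite Csub0 => Hw.
  have h1 : holo (Csigma a) w by apply: holo_sigma_disk.
  have h2 : holo f (c + r * Csigma a w).
  { apply: H; rewrite cm; have := sigma_le a w Ha Hw; nra. }
  by holo.
- move=> w; rewrite Csub0 => Hw.
  apply: Hpos; rewrite cm (sigma_eq1 a w Ha Hw); ring.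
- move=> K _; move: K; rewrite sigma_0.
  by replace (c + r * a) with z by (rewrite /a; field; exact: rn).
Qed.

Lemma Re_ge_disk (f : C -> C) (c : C) (r m : R) (z : C) :
  (0 < r)%R -> (forall z, (Cmod (z - c) <= r)%R -> holo f z) ->
  (forall z, Cmod (z - c) = r -> (m <= Re (f z))%R) ->
  (Cmod (z - c) <= r)%R -> (m <= Re (f z))%R.
Proof.
move=> r0 H Hm Hz.
have E w : Re (f w - m) = (Re (f w) - m)%R by rewrite /Cminus /Cplus /Copp /RtoC /Re /=; ring.
have : (0 <= Re (f z - m))%R.
{ apply: (Re_nonneg_disk (fun w => f w - m) c r) => //.
  - by move=> w /H Hw; holo.
  - move=> w /Hm; rewrite E; lra. }
rewrite E; lra.
Qed.

Lemma Re_conj_mult (w : C) : Re (Cconj w * w) = (Cmod w ^ 2)%R.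
Proof. rewrite Cmod2_alt /Cmult /Cconj /Re /Im /=; ring. Qed.

(** The minimum principle for real parts, applied to -conj(f z) f, whose real part at z is -|f z|^2
    and on the circle at least -|f z| M. *)
Lemma maximum_principle (f : C -> C) (c : C) (r M : R) (z : C) :
  (0 < r)%R -> (forall z, (Cmod (z - c) <= r)%R -> holo f z) ->
  (forall z, Cmod (z - c) = r -> (Cmod (f z) <= M)%R) ->
  (Cmod (z - c) <= r)%R -> (Cmod (f z) <= M)%R.
Proof.
move=> r0 H HM Hz.
have K : (- (Cmod (f z) * M) <= Re (- (Cconj (f z)) * f z))%R.
{ apply: (Re_ge_disk (fun w => - (Cconj (f z)) * f w) c r) => //.
  - by move=> w /H Hw; holo.
  - move=> w /HM Hw.
    have := re_le_Cmod (- Cconj (f z) * f w); rewrite Cmod_mult Cmod_opp Cmod_conj.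
    move/Rabs_le_between => [K _]; have := Cmod_ge_0 (f z); nra. }
have E : Re (- (Cconj (f z)) * f z) = (- (Cmod (f z) ^ 2))%R.
{ rewrite -Re_conj_mult /Cmult /Copp /Re /Im /=; ring. }
rewrite E in K.
case: (Rle_lt_or_eq_dec _ _ (Cmod_ge_0 (f z))) => [p|<-]; first by nra.
(* Case f z = 0: it remains to see M >= 0, which any boundary point shows. *)
have : (Cmod (f (c + r)%C) <= M)%R.
{ apply: HM; replace (c + r - c) with (RtoC r) by ring. by rewrite Cmod_R Rabs_pos_eq; lra. }
have := Cmod_ge_0 (f (c + r)); lra.
Qed.

(** [sigma_a] moves the zero to the center; the equality case of the mean value property is then
    used on the circle around 0 through the preimage of z. *)
Lemma strong_minimum_Re (f : C -> C) (a z : C) :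
  (forall z, (Cmod z < 1)%R -> holo f z) -> (forall z, (Cmod z < 1)%R -> (0 <= Re (f z))%R) ->
  (Cmod a < 1)%R -> (Cmod z < 1)%R -> Re (f a) = 0%R -> Re (f z) = 0%R.
Proof.
move=> H Hpos Ha Hz E.
have Ha' := Cmod_opp_lt1 a Ha.
set w := Csigma (- a) z.
have Hw : (Cmod w < 1)%R by apply: sigma_lt.
have Ez : Csigma a w = z by apply: sigma_inv' => //; lra.
case: (Req_dec (Cmod w) 0) => [/Cmod_eq_0 w0|w0].
{ by rewrite -Ez w0 sigma_0. }
have wp : (0 < Cmod w)%R by have := Cmod_ge_0 w; lra.
have [] := mean_value_Re_pos (fun w => f (Csigma a w)) 0 (Cmod w) wp.
- move=> v; rewrite Csub0 => Hv.
  have h1 : holo (Csigma a) v by apply: holo_sigma_disk => //; lra.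
  have h2 : holo f (Csigma a v) by apply: H; apply: sigma_lt => //; lra.
  by holo.
- move=> v; rewrite Csub0 => Hv.
  apply: Hpos; apply: sigma_lt => //; lra.
- rewrite sigma_0 => _ K; rewrite -Ez; apply: K => //.
  by rewrite Csub0.
Qed.

(** M^2 - Re(conj(f a) f) is nonnegative and vanishes at a, hence everywhere; together with |f z| <=
    M this leaves |f z - f a|^2 <= 0. *)
Lemma strong_maximum (f : C -> C) (M : R) (a z : C) :
  (forall z, (Cmod z < 1)%R -> holo f z) -> (forall z, (Cmod z < 1)%R -> (Cmod (f z) <= M)%R) ->
  (Cmod a < 1)%R -> (Cmod z < 1)%R -> Cmod (f a) = M -> f z = f a.
Proof.
move=> H HM Ha Hz E.
have ER w : Re (RtoC (M ^ 2) - Cconj (f a) * f w) = (M ^ 2 - (Re (f a) * Re (f w) + Im (f a) * Im (f w)))%R.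
{ rewrite /Cminus /Cplus /Copp /Cmult /Cconj /RtoC /Re /Im /=; ring. }
have Q w : (Cmod (f w - f a) ^ 2 = Cmod (f w) ^ 2 + Cmod (f a) ^ 2 - 2 * (Re (f a) * Re (f w) + Im (f a) * Im (f w)))%R.
{ rewrite !Cmod2_alt /Cminus /Cplus /Copp /Re /Im /=; ring. }
have M0 : (0 <= M)%R by rewrite -E; exact: Cmod_ge_0.
have sq w : (Cmod w < 1)%R -> (Cmod (f w) ^ 2 <= M ^ 2)%R.
{ move=> Hw; apply: pow_incr; split; [exact: Cmod_ge_0 | exact: HM]. }
have K : Re (RtoC (M ^ 2) - Cconj (f a) * f z) = 0%R.
{ apply: (strong_minimum_Re (fun w => RtoC (M ^ 2) - Cconj (f a) * f w) a) => //.
  - by move=> w /H Hw; holo.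
  - move=> w Hw; rewrite ER; have := Q w; have := sq w Hw; rewrite E.
    have := pow2_ge_0 (Cmod (f w - f a)); lra.
  - rewrite ER -E Cmod2_alt; ring. }
have Z : Cmod (f z - f a) = 0%R.
{ rewrite ER in K; have := Q z; rewrite E; have := sq z Hz; have := Cmod_ge_0 (f z - f a).
  move=> h1 h2 h3; have : (Cmod (f z - f a) ^ 2 <= 0)%R by lra.
  nra. }
move/Cmod_eq_0: Z => Z; replace (f z) with (f z - f a + f a) by ring; rewrite Z; ring.
Qed.

(** * Functions on the unit disk: weighted averages and difference quotients *)

Definition hdisk (f : C -> C) : Prop := forall z, (Cmod z < 1)%R -> holo f z.

Lemma open_ball0 (r : R) : @open C_UniformSpace (fun z => (Cmod z < r)%R).
Proof.
move=> z Hz; apply/locally_Cmod; exists (r - Cmod z)%R; split; first lra.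
move=> w Hw; have := Cmod_triangle_minus w z; lra.
Qed.

Lemma hdiskP (f : C -> C) : analytic_on disk f <-> hdisk f.
Proof.
split=> H z Hz; last by exact: locally_singleton (H z Hz).
by apply: (holo_open disk) => //; apply: open_ball0.
Qed.

(** [avg n E z = z^(-n-1) * int_0^z x^n E(x) dx], written so as to be defined at [z = 0]. *)
Definition avg (n : nat) (E : C -> C) (z : C) : C := CInt (fun t => RtoC (t ^ n) * E (t * z)) 0 1.

Lemma Ccont_pow (T : UniformSpace) (u : T -> R) (n : nat) (p : T) :
  continuous u p -> Ccont (fun q => RtoC (u q ^ n)) p.
Proof.
move=> Hu; elim: n => [|n IH]; first exact: Ccont_const.
apply: (continuous_ext (fun q => RtoC (u q) * RtoC (u q ^ n))); first by move=> q; rewrite -RtoC_mult.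
apply: (Ccont_mult T (fun q => RtoC (u q)) (fun q => RtoC (u q ^ n)) p) => //; exact: Ccont_RtoC_comp.
Qed.

Lemma Cmod_tz_lt (t : R) (z : C) : (Cmod z < 1)%R -> (0 <= t <= 1)%R -> (Cmod (t * z) < 1)%R.
Proof. move=> Hz Ht; rewrite Cmod_mult Cmod_R Rabs_pos_eq; have := Cmod_ge_0 z; nra. Qed.

Lemma avg_integrand_cont (n : nat) (E : C -> C) (z : C) (t : R) : hdisk E ->
  (Cmod z < 1)%R -> (0 <= t <= 1)%R -> Ccont (fun t : R => RtoC (t ^ n) * E (t * z)) t.
Proof.
move=> H Hz Ht; have h := H _ (Cmod_tz_lt t z Hz Ht); apply: Ccont_mult.
- apply: Ccont_pow; exact: continuous_id.
- apply: (Ccont_holo _ E (fun t : R => t * z)) => //; by Ccont.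
Qed.

Lemma is_CInt_avg (n : nat) (E : C -> C) (z : C) : hdisk E -> (Cmod z < 1)%R ->
  is_CInt (fun t => RtoC (t ^ n) * E (t * z)) 0 1 (avg n E z).
Proof.
move=> H Hz; apply: is_CInt_CInt; first lra. move=> t Ht; exact: avg_integrand_cont.
Qed.

Lemma near_in_disk (z : C) : (Cmod z < 1)%R -> forall w, (Cmod (w - z) < 1 - Cmod z)%R -> (Cmod w < 1)%R.
Proof. move=> Hz w Hw; have := Cmod_triangle_minus w z; lra. Qed.

Lemma Cder_avg (n : nat) (E : C -> C) (z : C) : hdisk E -> (Cmod z < 1)%R ->
  Cder (avg n E) z (avg (S n) (C_derive E) z).
Proof.
move=> H Hz.
apply: (Cder_CInt (fun z t => RtoC (t ^ n) * E (t * z)) (fun z t => RtoC (t ^ S n) * C_derive E (t * z))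
   z 0 1 (1 - Cmod z)); try lra.
- move=> w t /(near_in_disk z Hz) Hw Ht.
  have h := H _ (Cmod_tz_lt t w Hw Ht).
  apply: Cder_eq; first by Cder.
  rewrite /= RtoC_mult; ring.
- move=> w t /(near_in_disk z Hz) Hw Ht; exact: avg_integrand_cont.
- move=> t Ht; have h := holo_derive _ _ (H _ (Cmod_tz_lt t z Hz Ht)).
  apply: Ccont_mult.
  + apply: (Ccont_pow _ (fun p : C * R => snd p)); exact: continuous_snd.
  + apply: (Ccont_holo _ (C_derive E) (fun p : C * R => snd p * fst p)) => //; by Ccont.
Qed.

Lemma hdisk_avg (n : nat) (E : C -> C) : hdisk E -> hdisk (avg n E).
Proof. move=> H; apply/hdiskP => z Hz; exact: Cder_ex (Cder_avg n E z H Hz). Qed.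

Lemma hdisk_derive (f : C -> C) : hdisk f -> hdisk (C_derive f).
Proof. move=> H z Hz; apply: holo_derive; exact: H. Qed.

(** This is (z^(n+1) avg)' = z^n E divided by z^n, and so holds at 0 too. The combined integrand is
    the t-derivative of t^(n+1) E(t z). *)
Lemma avg_ode (n : nat) (E : C -> C) (z : C) : hdisk E -> (Cmod z < 1)%R ->
  RtoC (INR (S n)) * avg n E z + z * C_derive (avg n E) z = E z.
Proof.
move=> H Hz; rewrite (Cder_derive _ _ _ (Cder_avg n E z H Hz)).
have I1 := is_CInt_avg n E z H Hz.
have I2 := is_CInt_avg (S n) (C_derive E) z (hdisk_derive E H) Hz.
have I := is_CInt_plus _ _ _ _ _ _ (is_CInt_scal (RtoC (INR (S n))) _ _ _ _ I1) (is_CInt_scal z _ _ _ _ I2).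
rewrite -(CInt_unique _ _ _ _ I).
have pw m (t : R) : pder (fun s => RtoC (s ^ S m)) t (RtoC (INR (S m) * t ^ m)).
{ apply: pder_pair; rewrite /RtoC /Re /Im; last by exact: is_derive_const.
  have := is_derive_pow (fun s => s) (S m) t 1 (is_derive_id t).
  by rewrite Rmult_1_r. }
have J : is_CInt (fun t => RtoC (INR (S n)) * (RtoC (t ^ n) * E (t * z)) + z * (RtoC (t ^ S n) * C_derive E (t * z))) 0 1
   ((fun t : R => RtoC (t ^ S n) * E (t * z)) 1%R - (fun t : R => RtoC (t ^ S n) * E (t * z)) 0%R).
{ apply: (is_CInt_derive (fun t : R => RtoC (t ^ S n) * E (t * z))); first lra.
  - move=> t Ht; have h := H _ (Cmod_tz_lt t z Hz Ht).
    apply: pder_eq.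
    + apply: (pder_mult (fun t => RtoC (t ^ S n)) (fun t : R => E (t * z))); first exact: pw.
      apply: (pder_comp E (fun t : R => t * z)); first exact: holo_Cder h.
      by pder.
    + rewrite RtoC_mult; cring.
  - move=> t Ht; apply: Ccont_plus.
    + apply: Ccont_mult; first exact: Ccont_const. exact: avg_integrand_cont.
    + apply: Ccont_mult; first exact: Ccont_const. apply: avg_integrand_cont => //; exact: hdisk_derive. }
rewrite (CInt_unique _ _ _ _ J) pow1 /= Rmult_0_l !Cmult_1_l; ring.
Qed.

(** The difference quotient (f z - f 0) / z, as an integral that makes sense at z = 0. *)
Definition dq (f : C -> C) : C -> C := avg 0 (C_derive f).

Lemma hdisk_dq (f : C -> C) : hdisk f -> hdisk (dq f).
Proof. move=> H; apply: hdisk_avg; exact: hdisk_derive. Qed.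

Lemma dq_spec (f : C -> C) (z : C) : hdisk f -> (Cmod z < 1)%R -> f z = f 0 + z * dq f z.
Proof.
move=> H Hz.
have I := is_CInt_scal z _ _ _ _ (is_CInt_avg 0 _ z (hdisk_derive f H) Hz).
have J : is_CInt (fun t => z * (RtoC (t ^ 0) * C_derive f (t * z))) 0 1
  ((fun t : R => f (t * z)) 1%R - (fun t : R => f (t * z)) 0%R).
{ apply: (is_CInt_derive (fun t : R => f (t * z))); first lra.
  - move=> t Ht; have h := H _ (Cmod_tz_lt t z Hz Ht).
    apply: pder_eq; first by apply: (pder_comp f (fun t : R => t * z)); [exact: holo_Cder h | pder].
    rewrite /=; ring.
  - move=> t Ht; apply: Ccont_mult; first exact: Ccont_const.
    apply: avg_integrand_cont => //; exact: hdisk_derive. }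
rewrite /dq -(CInt_unique _ _ _ _ I) (CInt_unique _ _ _ _ J) Cmult_1_l Cmult_0_l; ring.
Qed.

Lemma avg_at_0 (n : nat) (E : C -> C) : hdisk E -> RtoC (INR (S n)) * avg n E 0 = E 0.
Proof.
move=> H; have := avg_ode n E 0 H; rewrite Cmod_0 => /(_ Rlt_0_1) <-; ring.
Qed.

Lemma dq_at_0 (f : C -> C) : hdisk f -> dq f 0 = C_derive f 0.
Proof. move=> H; rewrite -(avg_at_0 0 _ (hdisk_derive f H)) /= /dq; ring. Qed.

Lemma dq_derive_0 (f : C -> C) : hdisk f -> 2 * C_derive (dq f) 0 = C_derive (C_derive f) 0.
Proof.
move=> H; have Z : (Cmod 0 < 1)%R by rewrite Cmod_0; lra.
rewrite (Cder_derive _ _ _ (Cder_avg 0 _ 0 (hdisk_derive f H) Z)).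
by rewrite -(avg_at_0 1 _ (hdisk_derive _ (hdisk_derive f H))).
Qed.

(** On |w| = r the quotient is at most M / r; the maximum principle brings this to z, and r tends to
    1. *)
Lemma bound_dq (f : C -> C) (M : R) (z : C) :
  hdisk f -> f 0 = 0 -> (forall z, (Cmod z < 1)%R -> (Cmod (f z) <= M)%R) ->
  (Cmod z < 1)%R -> (Cmod (dq f z) <= M)%R.
Proof.
move=> H f0 HM Hz.
have M0 : (0 <= M)%R by have := HM z Hz; have := Cmod_ge_0 (f z); lra.
have K r : (Cmod z < r < 1)%R -> (Cmod (dq f z) <= M / r)%R.
{ move=> Hr; have z0 := Cmod_ge_0 z.
  apply: (maximum_principle (dq f) 0 r); try lra.
  - move=> w; rewrite Csub0 => Hw; apply: hdisk_dq => //; lra.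
  - move=> w; rewrite Csub0 => Hw.
    apply/Rle_div_r; first lra.
    rewrite -Hw Rmult_comm -Cmod_mult.
    have := dq_spec f w H; rewrite f0 Cplus_0_l => <-; last lra.
    apply: HM; lra.
  - rewrite Csub0; lra. }
apply: Rnot_lt_le => Hlt.
have z0 := Cmod_ge_0 z.
set q := Cmod (dq f z) in K Hlt.
have q0 : (0 < q)%R by lra.
(* Instead of a limit: a radius in (|z|, 1) that also exceeds M / q, so that M / r < q. *)
set r := Rmax ((1 + Cmod z) / 2) ((1 + M / q) / 2).
have Mq : (M / q < 1)%R by apply/Rlt_div_l; lra.
have Hr : (Cmod z < r < 1)%R.
{ split; first by apply: Rlt_le_trans (Rmax_l _ _); lra.
  apply: Rmax_lub_lt; lra. }
have := K r Hr; have H2 : (M / q < r)%R by apply: Rlt_le_trans (Rmax_r _ _); lra.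
move/Rle_div_r => H3; have r0 : (0 < r)%R by lra.
have := H3 r0; move/Rlt_div_l: H2 => H2.
have := H2 q0; nra.
Qed.

Lemma schwarz (f : C -> C) (z : C) :
  hdisk f -> f 0 = 0 -> (forall z, (Cmod z < 1)%R -> (Cmod (f z) <= 1)%R) ->
  (Cmod z < 1)%R -> (Cmod (f z) <= Cmod z)%R.
Proof.
move=> H f0 HM Hz; rewrite (dq_spec f z H Hz) f0 Cplus_0_l Cmod_mult.
have := bound_dq f 1 z H f0 HM Hz; have := Cmod_ge_0 z; nra.
Qed.

(** * Open mapping, Hurwitz's argument and the inverse of an injective function *)

Lemma circle_argmin (h : C -> R) (c : C) (r : R) : (0 <= r)%R ->
  (forall z, Cmod (z - c) = r -> @continuous C_UniformSpace R_UniformSpace h z) ->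
  exists z1, Cmod (z1 - c) = r /\ forall z, Cmod (z - c) = r -> (h z1 <= h z)%R.
Proof.
move=> r0 H.
have cm t : Cmod (c + r * cis t - c) = r.
{ replace (c + r * cis t - c) with (r * cis t) by ring.
  by rewrite Cmod_mult Cmod_cis Cmod_R Rabs_pos_eq; lra. }
have [|t1 [Ht1 _]] := continuity_ab_min (fun t => h (c + r * cis t)) 0 (2 * PI) (Rlt_le _ _ two_PI_pos).
{ move=> t _; apply/continuity_pt_filterlim.
  apply: (continuous_comp (fun t : R => c + r * cis t) h).
  - suff : Ccont (fun t : R => c + r * cis t) t by []. by circ.
  - apply: H; exact: cm. }
exists (c + r * cis t1); split => [|z Hz]; first exact: cm.
have [t [Ht E]] := polar (z - c).
have -> : z = c + r * cis t by rewrite -Hz -E; ring.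
exact: Ht1.
Qed.

Lemma circle_lower_bound (u : C -> C) (c : C) (r : R) : (0 <= r)%R ->
  (forall z, Cmod (z - c) = r -> Ccont u z) -> (forall z, Cmod (z - c) = r -> u z <> 0) ->
  exists eta, (0 < eta)%R /\ forall z, Cmod (z - c) = r -> (eta <= Cmod (u z))%R.
Proof.
move=> r0 H n.
have [z1 [Hz1 Hm]] : exists z1, Cmod (z1 - c) = r /\ forall z, Cmod (z - c) = r -> (Cmod (u z1) <= Cmod (u z))%R.
{ apply: (circle_argmin (fun z => Cmod (u z))) => // z Hz; apply: Ccont_Cmod; exact: H. }
exists (Cmod (u z1)); split => //; apply/Cmod_gt_0; exact: n.
Qed.

Lemma minimum_modulus (f : C -> C) (c : C) (r eta : R) (z : C) :
  (0 < r)%R -> (0 < eta)%R -> (forall z, (Cmod (z - c) <= r)%R -> holo f z) ->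
  (forall z, (Cmod (z - c) <= r)%R -> f z <> 0) ->
  (forall z, Cmod (z - c) = r -> (eta <= Cmod (f z))%R) ->
  (Cmod (z - c) <= r)%R -> (eta <= Cmod (f z))%R.
Proof.
move=> r0 e0 H n Hm Hz.
have K : (Cmod (/ f z) <= / eta)%R.
{ apply: (maximum_principle (fun z => / f z) c r) => //.
  - move=> w Hw; apply: holo_inv; [exact: H | exact: n].
  - move=> w Hw; rewrite Cmod_inv; last by apply: n; lra.
    apply: Rinv_le_contravar => //; exact: Hm. }
have p : (0 < Cmod (f z))%R by apply/Cmod_gt_0; exact: n.
rewrite Cmod_inv in K; last exact: n.
apply: Rnot_lt_le => Hlt; have := Rinv_lt_contravar _ _ (Rmult_lt_0_compat _ _ p e0) Hlt; lra.
Qed.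

(** Injectivity keeps |K z - K a| >= eta on the circle. If w within eta/2 of K a were omitted, K - w
    would be zero-free with modulus at least eta/2 on the circle, hence at a by the minimum modulus
    principle. *)
Lemma open_mapping (K : C -> C) (a : C) (d : R) :
  hdisk K -> injective_on disk K -> (0 < d)%R -> (Cmod a + d < 1)%R ->
  exists eta, (0 < eta)%R /\
    forall w, (Cmod (w - K a) < eta)%R -> exists z, (Cmod (z - a) < d)%R /\ K z = w.
Proof.
move=> H inj d0 Had.
have a0 := Cmod_ge_0 a.
have ind z : (Cmod (z - a) <= d)%R -> (Cmod z < 1)%R.
{ move=> Hz; have := Cmod_triangle_minus z a; lra. }
have [eta [e0 He]] : exists eta, (0 < eta)%R /\ forall z, Cmod (z - a) = d -> (eta <= Cmod (K z - K a))%R.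
{ apply: (circle_lower_bound (fun z => K z - K a)); first lra.
  - move=> z Hz; apply: (holo_cont (fun z => K z - K a)).
    have h := H z (ind z (Req_le _ _ Hz)); by holo.
  - move=> z Hz E.
    have Ez : z = a.
    { apply: inj; [exact: ind z (Req_le _ _ Hz) | rewrite /disk; lra|].
      replace (K z) with (K z - K a + K a) by ring; rewrite E; ring. }
    move: Hz; rewrite Ez; replace (a - a) with (RtoC 0) by ring; rewrite Cmod_0; lra. }
exists (eta / 2)%R; split; first lra.
move=> w Hw; apply: NNPP => N.
have n z : (Cmod (z - a) <= d)%R -> K z - w <> 0.
{ move=> Hz E; have Kz : K z = w by replace (K z) with (K z - w + w) by ring; rewrite E; ring.
  case: (Rle_lt_or_eq_dec _ _ Hz) => [Hlt|Heq]; first by apply: N; exists z.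
  have := He z Heq; rewrite Kz; lra. }
have := minimum_modulus (fun z => K z - w) a d (eta / 2) a d0 (ltac:(lra))
  (fun z Hz => holo_minus _ _ _ (H z (ind z Hz)) (holo_const _ _)) n.
have -> : Cmod (K a - w) = Cmod (w - K a) by exact: Cmod_minus_sym.
replace (a - a) with (RtoC 0) by ring; rewrite Cmod_0 => M.
have : (eta / 2 <= Cmod (w - K a))%R.
{ apply: M; last lra. move=> z Hz; have := He z Hz.
  have := Cmod_triangle (K z - w) (w - K a); replace (K z - w + (w - K a)) with (K z - K a) by ring; lra. }
lra.
Qed.

Lemma hdisk_iter_dq (f : C -> C) (n : nat) : hdisk f -> hdisk (Nat.iter n dq f).
Proof. move=> H; elim: n => [|n IH] //=; exact: hdisk_dq. Qed.

Lemma factor_zero (f : C -> C) (n : nat) (z : C) : hdisk f -> (Cmod z < 1)%R ->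
  (forall k, (k < n)%nat -> Nat.iter k dq f 0 = 0) -> f z = z ^ n * Nat.iter n dq f z.
Proof.
move=> H Hz; elim: n => [|n IH] Hk; first by rewrite /=; ring.
rewrite IH; last by move=> k Hkn; apply: Hk; lia.
rewrite (dq_spec (Nat.iter n dq f) z (hdisk_iter_dq f n H) Hz) Hk /=; last lia.
ring.
Qed.

(* If all Taylor coefficients of f vanish, then f(z)/z^n is bounded by M/r^n on |z| = r, hence inside, for every n. *)
Lemma isolated_zero (f : C -> C) : hdisk f -> (exists z, (Cmod z < 1)%R /\ f z <> 0) ->
  exists rho, (0 < rho)%R /\ forall z, (0 < Cmod z < rho)%R -> f z <> 0.
Proof.
move=> H [z [Hz nz]].
have [n [Hn Hk]] : exists n, Nat.iter n dq f 0 <> 0 /\ forall k, (k < n)%nat -> Nat.iter k dq f 0 = 0.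
{ apply: NNPP => N.
  have all n : Nat.iter n dq f 0 = 0.
  { elim/(well_founded_induction Wf_nat.lt_wf): n => n IH.
    apply: NNPP => Hn; apply: N; exists n; split => // k Hk; exact: IH. }
  set r := ((1 + Cmod z) / 2)%R.
  have z0 := Cmod_ge_0 z.
  have Hr : (0 < r < 1)%R by rewrite /r; lra.
  have [z1 [Hz1 Hm]] : exists z1, Cmod (z1 - 0) = r /\ forall z, Cmod (z - 0) = r -> (- Cmod (f z1) <= - Cmod (f z))%R.
  { apply: (circle_argmin (fun z => (- Cmod (f z))%R)); first lra.
    move=> w; rewrite Csub0 => Hw; apply: (@continuous_opp _ R_AbsRing R_NormedModule).
    apply: Ccont_Cmod; apply: holo_cont; apply: H; lra. }
  set M := Cmod (f z1) in Hm.
  have B m : (Cmod (Nat.iter m dq f z) <= M / r ^ m)%R.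
  { have rm : (0 < r ^ m)%R by apply: pow_lt; lra.
    apply: (maximum_principle _ 0 r); try lra.
    - move=> w; rewrite Csub0 => Hw; apply: hdisk_iter_dq => //; lra.
    - move=> w Hw; have := Hm w Hw; move: Hw; rewrite Csub0 => Hw.
      rewrite (factor_zero f m w H) //; last lra.
      rewrite Cmod_mult Cmod_pow Hw => HM; apply/Rle_div_r => //; lra.
    - rewrite Csub0 /r; lra. }
  have fp : (0 < Cmod (f z))%R by apply/Cmod_gt_0.
  have M0 : (0 <= M)%R by exact: Cmod_ge_0.
  have q : (Rabs (Cmod z / r) < 1)%R.
  { rewrite Rabs_pos_eq; first by apply/Rlt_div_l; rewrite /r; lra.
    apply: Rdiv_le_0_compat; lra. }
  have e0 : (0 < Cmod (f z) / (M + 1))%R by apply: Rdiv_lt_0_compat; lra.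
  have [m Hm'] := pow_lt_1_zero _ q _ e0.
  have := Hm' m (le_n m).
  rewrite Rabs_pos_eq; last by apply: pow_le; apply: Rdiv_le_0_compat; lra.
  move/(Rlt_div_r _ _ _ (Rlt_gt _ _ _)).
  have rm : (0 < r ^ m)%R by apply: pow_lt; lra.
  have zm : (0 <= Cmod z ^ m)%R by apply: pow_le.
  have -> : ((Cmod z / r) ^ m = Cmod z ^ m / r ^ m)%R by rewrite Rpow_mult_distr pow_inv.
  have := B m; have E := factor_zero f m z H Hz (fun k _ => all k).
  have : (Cmod (f z) <= Cmod z ^ m / r ^ m * M)%R.
  { rewrite E Cmod_mult Cmod_pow.
    replace (Cmod z ^ m / r ^ m * M)%R with (Cmod z ^ m * (M / r ^ m))%R by (field; lra).
    apply: Rmult_le_compat_l => //. }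
  have : (0 <= Cmod z ^ m / r ^ m)%R by apply: Rdiv_le_0_compat.
  move=> h1 h2 h3 h4.
  have := h4 (ltac:(lra)); nra. }
have Hc : Ccont (Nat.iter n dq f) (RtoC 0).
{ apply: holo_cont; apply: hdisk_iter_dq => //; rewrite Cmod_0; lra. }
have [d [d0 Hd]] := proj1 (locally_Cmod _ _) (Ccont_locally_neq _ _ _ _ Hc Hn).
exists (Rmin d 1); split; first by apply: Rmin_glb_lt; lra.
move=> w Hw; have := Rmin_l d 1; have := Rmin_r d 1 => h1 h2.
rewrite (factor_zero f n w H) //; last lra.
apply: Cmult_neq_0.
- apply/Cmod_gt_0; rewrite Cmod_pow; apply: pow_lt; lra.
- apply: Hd; rewrite Csub0; lra.
Qed.

(** Hurwitz's argument. Zeros of g' are isolated, so |g'| >= eta on some small circle. By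
    injectivity (g(z + h) - g z) / h has no zero, and for small h it is at least eta/2 on the
    circle, hence at 0; with g'(0) = 0 it would be at most eta/4 there. *)
Lemma injective_derive_neq0_at_0 (g : C -> C) : hdisk g -> injective_on disk g -> C_derive g 0 <> 0.
Proof.
move=> H inj E0.
have Hf := hdisk_derive g H.
have Z : (Cmod 0 < 1)%R by rewrite Cmod_0; lra.
have [rho [rho0 Hrho]] : exists rho, (0 < rho)%R /\ forall z, (0 < Cmod z < rho)%R -> C_derive g z <> 0.
{ apply: isolated_zero => //; apply: NNPP => N.
  have h : (Cmod (/ 2) < 1)%R.
  { rewrite -RtoC_inv ?Cmod_R ?Rabs_pos_eq; lra. }
  have E : g (/ 2) = g 0.
  { rewrite (dq_spec g _ H h) /dq /avg.
    rewrite (CInt_unique _ 0 1 0); first by ring.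
    have := is_CInt_const 0 0 1; rewrite Cmult_0_r.
    apply: is_CInt_ext; first lra. move=> t Ht; rewrite (_ : C_derive g (t * / 2) = 0); first by ring.
    apply: NNPP => n; apply: N; exists (t * / 2); split => //; apply: Cmod_tz_lt => //; lra. }
  have := inj _ _ h Z E.
  rewrite -RtoC_inv; last lra. move=> /RtoC_inj; lra. }
set r := (Rmin rho (/ 2) / 2)%R.
have Hr : (0 < r < rho)%R /\ (r < / 2)%R.
{ rewrite /r; have := Rmin_l rho (/ 2); have := Rmin_r rho (/ 2).
  have : (0 < Rmin rho (/ 2))%R by apply: Rmin_glb_lt; lra. lra. }
have [eta [e0 He]] : exists eta, (0 < eta)%R /\ forall z, Cmod (z - 0) = r -> (eta <= Cmod (C_derive g z))%R.
{ apply: circle_lower_bound; first lra.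
  - move=> z; rewrite Csub0 => Hz; apply: holo_cont; apply: Hf; lra.
  - move=> z; rewrite Csub0 => Hz; apply: Hrho; lra. }
have cm t : Cmod (r * cis t) = r by rewrite Cmod_mult Cmod_cis Cmod_R Rabs_pos_eq; lra.
have U t : (0 <= t <= 2 * PI)%R -> Ccont (fun p : C * R => C_derive g (r * cis (snd p) + fst p)) (RtoC 0, t).
{ move=> _; have h : holo (C_derive g) (r * cis t + 0) by apply: Hf; rewrite Cplus_0_r cm; lra.
  move/holo_cont: h => h; by circ. }
have e2 : (0 < eta / 2)%R by lra.
have e4 : (0 < eta / 4)%R by lra.
have [d [d0 Hd]] := compact_uniform (fun h t => C_derive g (r * cis t + h)) 0 0 (2 * PI) U (eta / 2) e2.
have [d' [d0' Hd']] := proj1 (Cder_iff _ _ _) (holo_Cder _ _ (H 0 Z)) (eta / 4)%R e4.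
(* Below d: g' varies by at most eta/2 along [z, z + h]. Below d': the quotient at 0 is near g'(0).
   Below 1/2: z + h stays in the disk, as r < 1/2. *)
set h := (Rmin (Rmin d d') (/ 2) / 2)%R.
have Hh : (0 < h < d)%R /\ (h < d')%R /\ (h < / 2)%R.
{ rewrite /h; have := Rmin_l (Rmin d d') (/ 2); have := Rmin_r (Rmin d d') (/ 2).
  have := Rmin_l d d'; have := Rmin_r d d'.
  have : (0 < Rmin (Rmin d d') (/ 2))%R by do 2 (apply: Rmin_glb_lt; try lra). lra. }
have hn : RtoC h <> 0 by move=> /RtoC_inj; lra.
have hm : Cmod h = h by rewrite Cmod_R Rabs_pos_eq; lra.
have inD z (s : R) : (Cmod z <= r)%R -> (0 <= s <= 1)%R -> (Cmod (z + s * h) < 1)%R.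
{ move=> Hz Hs; have := Cmod_triangle z (s * h); rewrite (Cmod_mult s) hm Cmod_R Rabs_pos_eq; last lra. nra. }
have inD1 z : (Cmod z <= r)%R -> (Cmod (z + h) < 1)%R.
{ move=> Hz; have := inD z 1%R Hz ltac:(lra); by rewrite Cmult_1_l. }
have K : (eta / 2 <= Cmod ((g (0 + h)%C - g 0) / h))%R.
{ apply: (minimum_modulus (fun z => (g (z + h) - g z) / h) 0 r) => //; first lra.
  - move=> z; rewrite Csub0 => Hz.
    have h1 : holo g (z + h) by apply: H; exact: inD1.
    have h2 : holo g z by apply: H; lra.
    by holo.
  - move=> z; rewrite Csub0 => Hz E.
    have E1 : g (z + h) = g z.
    { replace (g (z + h)) with (g z + h * ((g (z + h) - g z) / h)) by (field; exact hn). rewrite E; ring. }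
    have E2 : z + h = z by apply: inj E1; [exact: inD1 | rewrite /disk; lra].
    apply: hn; replace (RtoC h) with (z + h - z) by ring; rewrite E2; ring.
  - move=> z Hz; have He1 := He z Hz; move: Hz; rewrite Csub0 => Hz.
    have [t [Ht Ez]] := polar z; rewrite Hz in Ez.
    have P1 (s : R) : (0 <= s <= 1)%R -> pder (fun s : R => g (z + s * h) - s * (C_derive g z * h)) s
       ((C_derive g (z + s * h) - C_derive g z) * h).
    { move=> Hs; have h1 := H _ (inD z s (Req_le _ _ Hz) Hs).
      apply: pder_eq.
      - apply: pder_minus; last by pder.
        apply: (pder_comp g (fun s : R => z + s * h)); [exact: holo_Cder h1 | by pder].
      - by cring. }
    have P2 (s : R) : (0 <= s <= 1)%R -> (Cmod ((C_derive g (z + s * h) - C_derive g z) * h) <= eta / 2 * h)%R.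
    { move=> Hs; rewrite Cmod_mult hm; apply: Rmult_le_compat_r; first lra.
      have := Hd (s * h) t _ Ht; rewrite -Ez Cplus_0_r => Hd1; apply: Rlt_le; apply: Hd1.
      rewrite Csub0 Cmod_mult hm Cmod_R Rabs_pos_eq; nra. }
    have := mean_value_bound _ _ 0 1 _ Rle_0_1 P1 P2.
    rewrite Rminus_0_r Rmult_1_r.
    replace (g (z + 1 * h) - 1 * (C_derive g z * h) - (g (z + 0 * h) - 0 * (C_derive g z * h))) with
      (((g (z + h) - g z) / h - C_derive g z) * h); last first.
    { replace (z + 1 * h) with (z + h) by ring. replace (z + 0 * h) with z by ring. field; exact: hn. }
    rewrite Cmod_mult hm => /Rmult_le_reg_r => /(_ ltac:(lra)) K1.
    have := Cmod_triangle_minus (C_derive g z) ((g (z + h) - g z) / h).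
    rewrite Cmod_minus_sym; lra.
  - rewrite Csub0 Cmod_0; lra. }
have := Hd' h; rewrite Csub0 hm E0 Cmult_0_l Csub0 => /(_ ltac:(lra)) K2.
rewrite Cplus_0_l Cmod_div // hm in K.
have K' : (eta / 2 * h <= Cmod (g h - g 0))%R by apply/Rle_div_r => //; lra.
nra.
Qed.

Lemma injective_derive_neq0 (K : C -> C) (a : C) :
  hdisk K -> injective_on disk K -> (Cmod a < 1)%R -> C_derive K a <> 0.
Proof.
move=> H inj Ha.
set d := (1 - Cmod a)%R.
have d0 : (0 < d)%R by rewrite /d; lra.
have dn : RtoC d <> 0 by move=> /RtoC_inj; lra.
have dd w : (Cmod w < 1)%R -> (Cmod (a + d * w) < 1)%R.
{ move=> Hw; have := Cmod_triangle a (d * w); rewrite Cmod_mult Cmod_R Rabs_pos_eq; last lra.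
  have dE : d = (1 - Cmod a)%R by []. have : (d * Cmod w < d * 1)%R by apply: Rmult_lt_compat_l. lra. }
have n := injective_derive_neq0_at_0 (fun w => K (a + d * w)) _ _.
have h : Cder (fun w => K (a + d * w)) 0 (d * C_derive K a).
{ have h1 : holo K (a + d * 0) by apply: H; rewrite Cmult_0_r Cplus_0_r.
  apply: Cder_eq; first by Cder.
  rewrite Cmult_0_r Cplus_0_r; ring. }
rewrite (Cder_derive _ _ _ h) in n.
move=> E; apply: n; last by rewrite E; ring.
- move=> w Hw; have h1 := H _ (dd w Hw); by holo.
- move=> x y Hx Hy /(inj _ _ (dd x Hx) (dd y Hy)) E2.
  replace x with ((a + d * x - a) / d) by (field; exact: dn). rewrite E2; field; exact: dn.
Qed.

(** Total by Hilbert's epsilon: the value is unspecified off the image of the disk. *)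
Definition disk_inverse (K : C -> C) (w : C) : C :=
  epsilon (inhabits (RtoC 0)) (fun z => disk z /\ K z = w).

Lemma disk_inverse_spec (K : C -> C) (w : C) :
  (exists z, disk z /\ K z = w) -> disk (disk_inverse K w) /\ K (disk_inverse K w) = w.
Proof. exact: epsilon_spec. Qed.

Lemma disk_inverseK (K : C -> C) (z : C) : injective_on disk K -> disk z -> disk_inverse K (K z) = z.
Proof.
move=> inj Hz; have [H1 H2] := disk_inverse_spec K (K z) (ex_intro _ z (conj Hz eq_refl)).
exact: inj.
Qed.

Lemma Cder_disk_inverse (K : C -> C) (a : C) :
  hdisk K -> injective_on disk K -> disk a -> Cder (disk_inverse K) (K a) (/ C_derive K a).
Proof.
move=> H inj Ha.
set l := C_derive K a.
have ln : l <> 0 by exact: injective_derive_neq0.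
have lp : (0 < Cmod l)%R by apply/Cmod_gt_0.
apply/Cder_iff => e e0.
(* The first bound gives |K x - K a| >= |l| |x - a| / 2; the second then makes the error of K,
   divided by l, at most e |K x - K a|. *)
set e' := Rmin (Cmod l / 2) (e * Cmod l ^ 2 / 2).
have l2 : (0 < Cmod l ^ 2)%R by apply: pow_lt.
have e0' : (0 < e')%R by apply: Rmin_glb_lt; nra.
have [d [d0 Hd]] := proj1 (Cder_iff _ _ _) (holo_Cder _ _ (H a Ha)) e' e0'.
rewrite -/l in Hd.
set d1 := Rmin d ((1 - Cmod a) / 2).
rewrite /disk in Ha.
have d10 : (0 < d1)%R by apply: Rmin_glb_lt; lra.
have d1a : (Cmod a + d1 < 1)%R by have := Rmin_r d ((1 - Cmod a) / 2); rewrite -/d1; lra.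
have [eta [eta0 Heta]] := open_mapping K a d1 H inj d10 d1a.
exists eta; split => // w Hw.
have [x [Hx Kx]] := Heta w Hw.
have xd : disk x by rewrite /disk; have := Cmod_triangle_minus x a; lra.
rewrite -Kx !disk_inverseK //.
have := Hd x (Rlt_le_trans _ _ _ Hx (Rmin_l _ _)).
set err := K x - K a - l * (x - a) => Herr.
have x0 := Cmod_ge_0 (x - a).
have E : x - a - / l * (K x - K a) = - (err / l) by rewrite /err; field.
rewrite E Cmod_opp Cmod_div //.
have B1 : (Cmod l / 2 * Cmod (x - a) <= Cmod (K x - K a))%R.
{ have := Cmod_triangle_minus (l * (x - a)) (K x - K a).
  have -> : Cmod (l * (x - a) - (K x - K a)) = Cmod err by rewrite Cmod_minus_sym.
  rewrite Cmod_mult; have := Rmin_l (Cmod l / 2) (e * Cmod l ^ 2 / 2); rewrite -/e'; nra. }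
apply/Rle_div_l => //.
have B2 : (Cmod err <= e * Cmod l ^ 2 / 2 * Cmod (x - a))%R.
{ apply: Rle_trans Herr _; apply: Rmult_le_compat_r => //; exact: Rmin_r. }
have : (e * Cmod l * (Cmod l / 2 * Cmod (x - a)) <= e * Cmod l * Cmod (K x - K a))%R.
{ apply: Rmult_le_compat_l => //; nra. }
have -> : (e * Cmod l * (Cmod l / 2 * Cmod (x - a)) = e * Cmod l ^ 2 / 2 * Cmod (x - a))%R by field.
nra.
Qed.

Lemma holo_disk_inverse (K : C -> C) (a : C) :
  hdisk K -> injective_on disk K -> disk a -> holo (disk_inverse K) (K a).
Proof.
move=> H inj Ha; have Ha' : (Cmod a < 1)%R := Ha.
have [eta [e0 He]] := open_mapping K a ((1 - Cmod a) / 2) H inj ltac:(lra) ltac:(lra).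
apply/locally_Cmod; exists eta; split => // w /He [z [Hz <-]].
apply: Cder_ex (Cder_disk_inverse K z H inj _).
rewrite /disk; have := Cmod_triangle_minus z a; lra.
Qed.

(** * Convex functions on the disk *)

Definition convex_fun (K : C -> C) : Prop :=
  hdisk K /\ injective_on disk K /\
  forall x y (t : R), disk x -> disk y -> (0 <= t <= 1)%R ->
    exists m, disk m /\ K m = (1 - t) * K x + t * K y.

Lemma disk0 : disk 0.
Proof. rewrite /disk Cmod_0; lra. Qed.

Lemma disk_scal (e z : C) : (Cmod e <= 1)%R -> disk z -> disk (e * z).
Proof. rewrite /disk Cmod_mult; have := Cmod_ge_0 e; have := Cmod_ge_0 z; nra. Qed.

(* Study's theorem: z |-> K^-1((1-t) K(z) + t K(eta z)) satisfies the hypotheses of the Schwarz lemma. *)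
Lemma study (K : C -> C) (t : R) (e z m : C) : convex_fun K -> (0 <= t <= 1)%R ->
  (Cmod e <= 1)%R -> disk z -> disk m -> K m = (1 - t) * K z + t * K (e * z) -> (Cmod m <= Cmod z)%R.
Proof.
move=> [H [inj conv]] Ht He Hz Hm E.
set phi := fun x => disk_inverse K ((1 - t) * K x + t * K (e * x)).
have phiP x : disk x -> disk (phi x) /\ K (phi x) = (1 - t) * K x + t * K (e * x).
{ move=> Hx; apply: disk_inverse_spec; apply: conv => //; exact: disk_scal. }
have phi_eq x u : disk x -> disk u -> K u = (1 - t) * K x + t * K (e * x) -> phi x = u.
{ by move=> Hx Hu Eu; rewrite /phi -Eu disk_inverseK. }
rewrite -(phi_eq z m Hz Hm E).
apply: schwarz => //.
- move=> x Hx; have [D1 D2] := phiP x Hx.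
  have h1 : holo K x by exact: H.
  have h2 : holo K (e * x) by apply: H; exact: disk_scal.
  apply: (holo_comp (disk_inverse K)).
  + rewrite -D2; exact: holo_disk_inverse.
  + by holo.
- apply: (phi_eq 0 0) => //; try exact: disk0. rewrite Cmult_0_r; ring.
- move=> x Hx; have [D1 _] := phiP x Hx; exact: Rlt_le.
Qed.

Lemma study2 (K : C -> C) (t : R) (x y m : C) : convex_fun K -> (0 <= t <= 1)%R ->
  (Cmod x <= Cmod y)%R -> disk y -> disk m -> K m = (1 - t) * K y + t * K x -> (Cmod m <= Cmod y)%R.
Proof.
move=> HK Ht Hxy Hy Hm E.
case: (Ceq_dec y 0) => [y0|n].
- rewrite y0 Cmod_0 in Hxy *; have x0 : x = 0 by apply: Cmod_eq_0; have := Cmod_ge_0 x; lra.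
  have [_ [inj _]] := HK.
  have -> : m = 0 by apply: inj => //; [exact: disk0 | rewrite E y0 x0; ring].
  by rewrite Cmod_0; lra.
- have yp : (0 < Cmod y)%R by apply/Cmod_gt_0.
  apply: (study K t (x / y)) => //.
  + rewrite Cmod_div //; apply/Rle_div_l => //; lra.
  + by replace (x / y * y) with x by (field; exact: n).
Qed.

Lemma right_derivative_nonpos (h : R -> R) (t0 l : R) :
  is_derive h t0 l -> (forall t, (t0 < t <= t0 + 1)%R -> (h t <= h t0)%R) -> (l <= 0)%R.
Proof.
move=> D H; apply: Rnot_lt_le => lp.
have l2 : (0 < l / 2)%R by lra.
have [d Hd] := proj2 D t0 (fun Q HQ => HQ) (mkposreal _ l2).
have dp := cond_pos d.
set s := Rmin (d / 2) 1.
have s0 : (0 < s)%R by apply: Rmin_glb_lt; lra.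
have := Rmin_l (d / 2) 1; have := Rmin_r (d / 2) 1; rewrite -/s => s1 sd.
have := Hd (t0 + s)%R; have := H (t0 + s)%R ltac:(lra).
rewrite /norm /= /abs /minus /plus /opp /scal /= /mult /=.
have -> : (t0 + s + - t0 = s)%R by ring.
rewrite (Rabs_pos_eq s); last lra.
move=> H1 H2.
have : (Rabs (h (t0 + s) + - h t0 + - (s * l)) <= l / 2 * s)%R.
{ apply: H2; rewrite /ball /= /AbsRing_ball /abs /minus /plus /opp /=.
  have -> : (t0 + s + - t0 = s)%R by ring. rewrite Rabs_pos_eq; lra. }
move/Rabs_le_between; nra.
Qed.

Lemma Re_div_conj (u y : C) : y <> 0 -> (Re (u / y) * Cmod y ^ 2 = Re (Cconj y * u))%R.
Proof.
move=> n; have yp : (0 < Cmod y)%R by apply/Cmod_gt_0.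
have E : Cconj y * u = RtoC (Cmod y ^ 2) * (u / y) by rewrite Cmod2_conj; field.
by rewrite E /Cmult /RtoC /Re /Im /=; ring.
Qed.

(** The curve phi t = K^-1((1 - t) K y + t K x) starts at y and by Study's theorem never leaves |.|
    <= |y|. So |phi|^2 has a nonpositive right derivative at 0, and this derivative is 2 Re(conj y
    (K x - K y) / K' y). *)
Lemma convex_support_weak (K : C -> C) (x y : C) : convex_fun K -> disk y -> y <> 0 ->
  (Cmod x <= Cmod y)%R -> (0 <= Re ((K y - K x) / (y * C_derive K y)))%R.
Proof.
move=> HK Hy n Hxy.
have [H [inj conv]] := HK.
have Hx : disk x by rewrite /disk in Hy *; lra.
have ln := injective_derive_neq0 K y H inj Hy.
set l := C_derive K y in ln *.
pose phi := fun t : R => disk_inverse K ((1 - t) * K y + t * K x).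
have phi0 : phi 0%R = y.
{ rewrite /phi; replace ((1 - 0) * K y + 0 * K x) with (K y) by ring; exact: disk_inverseK. }
have D : pder phi 0 ((K x - K y) / l).
{ apply: pder_eq.
  - apply: (pder_comp (disk_inverse K) (fun t : R => (1 - t) * K y + t * K x)).
    + replace ((1 - 0%R) * K y + 0%R * K x) with (K y) by ring; exact: Cder_disk_inverse.
    + by pder.
  - cbv beta; rewrite -/l; field; exact: ln. }
have B t : (0 < t <= 0 + 1)%R -> (Re (phi t) ^ 2 + Im (phi t) ^ 2 <= Re (phi 0%R) ^ 2 + Im (phi 0%R) ^ 2)%R.
{ move=> Ht; rewrite -!Cmod2_alt phi0.
  have Ht' : (0 <= t <= 1)%R by lra.
  have [D1 D2] : disk (phi t) /\ K (phi t) = (1 - t) * K y + t * K x.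
  { apply: disk_inverse_spec; exact: conv. }
  apply: pow_incr; split; first exact: Cmod_ge_0.
  exact: (study2 K t x). }
have DR := pder_Re _ _ _ D. have DI := pder_Im _ _ _ D.
have DD : is_derive (fun t => Re (phi t) ^ 2 + Im (phi t) ^ 2)%R 0%R
   (2 * Re (Cconj y * ((K x - K y) / l)))%R.
{ have := is_derive_plus _ _ _ _ _ (is_derive_pow _ 2 _ _ DR) (is_derive_pow _ 2 _ _ DI).
  rewrite phi0; set u := (K x - K y) / l => K1.
  match type of K1 with is_derive _ _ ?X => suff <- : X = (2 * Re (Cconj y * u))%R by exact: K1 end.
  rewrite /plus /= /Cmult /Cconj /Re /Im /=; ring. }
have L := right_derivative_nonpos _ _ _ DD B.
have yp : (0 < Cmod y)%R by apply/Cmod_gt_0.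
have E : (K y - K x) / (y * l) = - (((K x - K y) / l) / y) by field.
rewrite E.
have E2 : (Re (- ((K x - K y) / l / y)) = - Re ((K x - K y) / l / y))%R by [].
rewrite E2; have := Re_div_conj ((K x - K y) / l) y n.
set q := Re (_ / y); set p := Re (Cconj y * _) in L * => Q.
have y2 : (0 < Cmod y ^ 2)%R by apply: pow_lt.
nra.
Qed.

(** With e = x / y fixed, [Rf] z = (K z - K(e z)) / (z K' z) is holomorphic on the disk, has
    nonnegative real part and takes the value 1 - e at 0. If its real part vanished at y it would
    vanish at 0, forcing e = 1 because |e| <= 1. *)
Lemma convex_support (K : C -> C) (x y : C) : convex_fun K -> disk y ->
  (Cmod x <= Cmod y)%R -> x <> y -> (0 < Re ((K y - K x) / (y * C_derive K y)))%R.
Proof.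
move=> HK Hy Hxy nxy.
have n : y <> 0.
{ move=> y0; apply: nxy; rewrite y0 Cmod_0 in Hxy *; apply: Cmod_eq_0; have := Cmod_ge_0 x; lra. }
have yp : (0 < Cmod y)%R by apply/Cmod_gt_0.
have [H [inj _]] := HK.
set e := x / y.
have He : (Cmod e <= 1)%R by rewrite /e Cmod_div //; apply/Rle_div_l => //; lra.
have ln z : disk z -> C_derive K z <> 0 by exact: injective_derive_neq0.
pose Rf := fun z => (dq K z - e * dq K (e * z)) / C_derive K z.
have RfE z : disk z -> z <> 0 -> Rf z = (K z - K (e * z)) / (z * C_derive K z).
{ move=> Hz zn; rewrite /Rf (dq_spec K z H Hz) (dq_spec K (e * z) H (disk_scal e z He Hz)).
  field; split => //; exact: ln. }
have Rf0 : Rf 0 = 1 - e.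
{ rewrite /Rf Cmult_0_r !dq_at_0 //; field; exact: ln disk0. }
have e1 : (0 <= 1 - Re e)%R by have := Re_le_Cmod e; lra.
have Re1 : Re (1 - e) = (1 - Re e)%R by [].
have pos z : disk z -> (0 <= Re (Rf z))%R.
{ move=> Hz; case: (Ceq_dec z 0) => [->|zn]; first by rewrite Rf0 Re1.
  rewrite RfE //; apply: convex_support_weak => //.
  rewrite Cmod_mult; have := Cmod_ge_0 z; nra. }
have hRf : hdisk Rf.
{ move=> z Hz; have h1 := hdisk_dq K H z Hz; have h2 := hdisk_dq K H (e * z) (disk_scal e z He Hz).
  have h3 := hdisk_derive K H z Hz; have n3 := ln z Hz; by rewrite /Rf; holo. }
have -> : (K y - K x) / (y * C_derive K y) = Rf y.
{ rewrite RfE //; by replace (e * y) with x by (rewrite /e; field; exact: n). }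
case: (Rle_lt_or_eq_dec _ _ (pos y Hy)) => // E; exfalso.
have := strong_minimum_Re Rf y 0 hRf pos Hy disk0 (eq_sym E).
rewrite Rf0 Re1 => E1.
have ee : e = 1.
{ have := Cmod2_alt e; have := Cmod_ge_0 e => c0 M.
  have R1 : (Re e = 1)%R by lra.
  have : (Im e ^ 2 <= 0)%R by rewrite R1 in M; nra.
  move: R1.
  case: (e) => p q; rewrite /Re /Im /= => -> Q; have -> // : q = 0%R by nra. }
apply: nxy; replace x with (e * y) by (rewrite /e; field; exact: n). rewrite ee; ring.
Qed.

Lemma sigma_disk_scal (a z y : C) : (Cmod a < 1)%R -> disk z -> disk y -> disk (z * Csigma a y).
Proof. move=> Ha Hz Hy; apply: disk_scal; [exact: Rlt_le | exact: sigma_lt]. Qed.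

(** The image is that of the disk of radius |z| under K, since sigma_a is an automorphism of the
    disk; Study's theorem makes it convex. *)
Lemma convex_fun_sigma (K : C -> C) (a z : C) : convex_fun K -> (Cmod a < 1)%R -> disk z -> z <> 0 ->
  convex_fun (fun y => K (z * Csigma a y)).
Proof.
move=> HK Ha Hz zn.
have [H [inj conv]] := HK.
have zp : (0 < Cmod z)%R by apply/Cmod_gt_0.
have ind := sigma_disk_scal a z _ Ha Hz.
split; [|split].
- move=> y Hy; have h1 : holo (Csigma a) y by apply: holo_sigma_disk => //; exact: Rlt_le.
  have h2 : holo K (z * Csigma a y) by apply: H; exact: ind.
  by holo.
- move=> x y Hx Hy /(inj _ _ (ind _ Hx) (ind _ Hy)) E.
  rewrite -(sigma_inv a x Ha (Rlt_le _ _ Hx)) -(sigma_inv a y Ha (Rlt_le _ _ Hy)); congr Csigma.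
  replace (Csigma a x) with (z * Csigma a x / z) by (field; exact: zn). rewrite E; field; exact: zn.
- move=> x y t Hx Hy Ht.
  have [m [Hm Em]] := conv _ _ t (ind _ Hx) (ind _ Hy) Ht.
  have Hmz : (Cmod m < Cmod z)%R.
  { have bnd v : disk v -> (Cmod (z * Csigma a v) < Cmod z)%R.
    { move=> Hv; rewrite Cmod_mult; have := sigma_lt a v Ha Hv; nra. }
    case: (Rle_dec (Cmod (z * Csigma a y)) (Cmod (z * Csigma a x))) => Hc.
    - apply: Rle_lt_trans (bnd x Hx); apply: (study2 K t (z * Csigma a y)) => //; exact: ind.
    - apply: Rle_lt_trans (bnd y Hy); apply: (study2 K (1 - t) (z * Csigma a x)) => //; try lra.
      + exact: ind.
      + rewrite Em RtoC_minus; ring. }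
  have Hmz' : disk (m / z) by rewrite /disk Cmod_div //; apply/Rlt_div_l => //; lra.
  exists (Csigma (- a) (m / z)); split.
  + apply: sigma_lt => //; exact: Cmod_opp_lt1.
  + rewrite sigma_inv' //; last exact: Rlt_le.
    by replace (z * (m / z)) with m by (field; exact: zn).
Qed.

Lemma second_derivative_nonneg (h h' : R -> R) (c : R) :
  (forall t, is_derive h t (h' t)) -> is_derive h' 0 c -> h' 0%R = 0%R ->
  (forall t, (h 0%R <= h t)%R) -> (0 <= c)%R.
Proof.
move=> D D2 h0 Hpos; apply: Rnot_lt_le => cn.
have c2 : (0 < - c / 2)%R by lra.
have [d Hd] := proj2 D2 0%R (fun Q HQ => HQ) (mkposreal _ c2).
have dp := cond_pos d.
have [s [Es Hs]] := MVT_cor2 h h' 0 (d / 2) ltac:(lra) (fun t _ => proj1 (is_derive_Reals _ _ _) (D t)).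
have := Hd s; rewrite /norm /= /abs /minus /plus /opp /scal /= /mult /= h0.
have -> : (s + - 0 = s)%R by ring.
move=> H1.
have : (Rabs (h' s + - 0 + - (s * c)) <= - c / 2 * Rabs s)%R.
{ apply: H1; rewrite /ball /= /AbsRing_ball /abs /minus /plus /opp /=.
  have -> : (s + - 0 = s)%R by ring. rewrite Rabs_pos_eq; lra. }
rewrite (Rabs_pos_eq s); last lra.
move/Rabs_le_between => [_ H2].
have := Hpos (d / 2)%R.
have : (h' s < 0)%R by nra.
nra.
Qed.

(** Second-order form of the support inequality: Re((K y - K(y cis t)) / (y K' y)) is nonnegative
    and vanishes at t = 0, where its second derivative is the quantity claimed. *)
Lemma convex_fun_curvature (K : C -> C) (y : C) : convex_fun K -> disk y ->
  (0 <= Re (1 + y * C_derive (C_derive K) y / C_derive K y))%R.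
Proof.
move=> HK Hy.
have [H [inj _]] := HK.
case: (Ceq_dec y 0) => [->|n].
{ replace (1 + 0 * C_derive (C_derive K) 0 / C_derive K 0) with (RtoC 1) by (rewrite /Cdiv; ring).
  rewrite /RtoC /Re /=; lra. }
have ln := injective_derive_neq0 K y H inj Hy.
have ind t : disk (y * cis t) by rewrite /disk Cmod_mult Cmod_cis Rmult_1_r.
have Ci2 : Ci * Ci = - 1 by rewrite /Ci /Cmult /Copp /RtoC /=; congr pair; ring.
pose g := fun t => (K y - K (y * cis t)) * / (y * C_derive K y).
pose g' := fun t => - (C_derive K (y * cis t) * (y * (Ci * cis t))) * / (y * C_derive K y).
have D1 t : pder g t (g' t).
{ have h := H _ (ind t); rewrite /g /g'.
  apply: pder_eq; first by apply: (pder_comp (fun w => (K y - K (y * w)) * / (y * C_derive K y)) cis); [Cder | exact: pder_cis].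
  cring. }
have D2 : pder g' 0 (1 + y * C_derive (C_derive K) y / C_derive K y).
{ have h := hdisk_derive K H _ (ind 0%R); rewrite /g'.
  apply: pder_eq.
  - apply: (pder_comp (fun w => - (C_derive K (y * w) * (y * (Ci * w))) * / (y * C_derive K y)) cis); [Cder | exact: pder_cis].
  - cbv beta; rewrite cis_0 !Cmult_1_r.
    transitivity (- (Ci * Ci) * (1 + y * C_derive (C_derive K) y / C_derive K y)).
    + field; split => //.
    + rewrite Ci2; ring. }
have R0 : Re (g' 0%R) = 0%R.
{ have -> : g' 0%R = - Ci by rewrite /g' cis_0 !Cmult_1_r; field.
  by rewrite /Ci /Copp /Re /=; ring. }
apply: (second_derivative_nonneg (fun t => Re (g t)) (fun t => Re (g' t))) => //.
- move=> t; exact: pder_Re.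
- exact: pder_Re.
- move=> t; have -> : Re (g 0%R) = 0%R.
  { rewrite /g cis_0 Cmult_1_r; replace ((K y - K y) * / (y * C_derive K y)) with (RtoC 0) by ring. by []. }
  apply: convex_support_weak => //; rewrite Cmod_mult Cmod_cis; lra.
Qed.

Lemma Cmod_le_of_Re_nonneg (p : C) : (0 <= Re p)%R -> (Cmod (p - 1) <= Cmod (p + 1))%R.
Proof.
move=> H; have E : (Cmod (p + 1) ^ 2 - Cmod (p - 1) ^ 2 = 4 * Re p)%R.
{ rewrite !Cmod2_alt; case: p {H} => u v; rewrite /Cminus /Cplus /Copp /RtoC /Re /Im /=; ring. }
have := Cmod_ge_0 (p + 1); have := Cmod_ge_0 (p - 1); nra.
Qed.

(** With p = 1 + w K''/K', of nonnegative real part, (p - 1) / (p + 1) is bounded by 1 and equals w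
    times the quotient in question. The Schwarz lemma removes the factor w. *)
Lemma convex_fun_koebe (K : C -> C) (w : C) : convex_fun K -> disk w ->
  2 * C_derive K w + w * C_derive (C_derive K) w <> 0 /\
  (Cmod (C_derive (C_derive K) w / (2 * C_derive K w + w * C_derive (C_derive K) w)) <= 1)%R.
Proof.
move=> HK Hw.
have [H [inj _]] := HK.
have ln z : disk z -> C_derive K z <> 0 by exact: injective_derive_neq0.
have dn z : disk z -> 2 * C_derive K z + z * C_derive (C_derive K) z <> 0.
{ move=> Hz E; have P := convex_fun_curvature K z HK Hz.
  have E1 : 1 + z * C_derive (C_derive K) z / C_derive K z = - (1).
  { replace (z * C_derive (C_derive K) z) with ((2 * C_derive K z + z * C_derive (C_derive K) z) - 2 * C_derive K z) by ring.
    rewrite E; field; exact: ln. }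
  by move: P; rewrite E1 /Copp /RtoC /Re /=; lra. }
split; first exact: dn.
pose q := fun z => C_derive (C_derive K) z / (2 * C_derive K z + z * C_derive (C_derive K) z).
have hq : hdisk q.
{ move=> z Hz; have h1 := hdisk_derive K H z Hz; have h2 := hdisk_derive _ (hdisk_derive K H) z Hz.
  have := dn z Hz; by rewrite /q => n; holo. }
pose g := fun z => z * q z.
have hg : hdisk g by move=> z Hz; have h := hq z Hz; rewrite /g; holo.
have bg z : disk z -> (Cmod (g z) <= 1)%R.
{ move=> Hz; have P := convex_fun_curvature K z HK Hz.
  have lz := ln z Hz. have nz := dn z Hz.
  set p := 1 + z * C_derive (C_derive K) z / C_derive K z in P.
  have pn : p + 1 <> 0.
  { move=> E; apply: nz.
    replace (2 * C_derive K z + z * C_derive (C_derive K) z) with (C_derive K z * (p + 1)) by (rewrite /p; field; exact: lz).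
    rewrite E; ring. }
  have -> : g z = (p - 1) / (p + 1).
  { have E1 : p - 1 = z * C_derive (C_derive K) z / C_derive K z by rewrite /p; ring.
    have E2 : p + 1 = (2 * C_derive K z + z * C_derive (C_derive K) z) / C_derive K z by rewrite /p; field.
    rewrite E1 E2 /g /q; field; split => //. }
  rewrite Cmod_div //; apply/Rle_div_l; first by apply/Cmod_gt_0.
  rewrite Rmult_1_l; exact: Cmod_le_of_Re_nonneg. }
have g0 : g 0 = 0 by rewrite /g Cmult_0_l.
rewrite -/(q w).
have -> : q w = dq g w; last exact: bound_dq.
case: (Ceq_dec w 0) => [->|n].
- rewrite dq_at_0 //; symmetry; apply: Cder_derive.
  have h := hq 0 disk0; rewrite /g; apply: Cder_eq; first by Cder.
  ring.
- have := dq_spec g w hg Hw; rewrite g0 Cplus_0_l {1}/g => E.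
  replace (q w) with (w * q w / w) by (field; exact: n). rewrite E; field; exact: n.
Qed.

(** * Two lemmas of Jack-Sakaguchi type *)

Lemma derivative_at_min (h : R -> R) (l : R) :
  is_derive h 0 l -> (forall t, (h 0%R <= h t)%R) -> l = 0%R.
Proof.
move=> D H.
have h1 : (- l <= 0)%R.
{ apply: (right_derivative_nonpos (fun t => - h t)%R 0%R); first exact: (is_derive_opp h).
  move=> t _; have := H t; lra. }
have h2 : (l <= 0)%R.
{ apply: (right_derivative_nonpos (fun t => - h (- t))%R 0%R).
  - have D' : is_derive h (- 0)%R l by rewrite Ropp_0.
    have := is_derive_opp _ _ _ (is_derive_comp h (fun t => (- t)%R) 0%R l (-1)%R D' _).
    rewrite /opp /scal /= /mult /= => K.
    have -> : l = (- (-1 * l))%R by ring.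
    apply: K; have := is_derive_opp (fun t : R => t) 0%R _ (is_derive_id 0%R).
    by rewrite /opp /one /=.
  - move=> t _; have := H (- t)%R; rewrite Ropp_0; lra. }
lra.
Qed.

(** Along the circle the derivative of Re p vanishes at the minimum, so z1 p'(z1) is real; moving
    inwards Re p cannot decrease, so it is nonpositive. *)
Lemma derivative_at_boundary_min (p : C -> C) (z1 : C) : hdisk p -> disk z1 ->
  (forall z, (Cmod z <= Cmod z1)%R -> (Re (p z1) <= Re (p z))%R) ->
  exists lam : R, (0 <= lam)%R /\ z1 * C_derive p z1 = - lam.
Proof.
move=> H Hz1 Hm.
have h1 : holo p z1 by exact: H.
set d := C_derive p z1.
have T : Re (d * (z1 * Ci)) = 0%R.
{ apply: (derivative_at_min (fun t => Re (p (z1 * cis t)))).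
  - apply: pder_Re.
    have h2 : Cder p (z1 * cis 0) d by rewrite cis_0 Cmult_1_r; exact: holo_Cder.
    apply: pder_eq; first by apply: (pder_comp p (fun t => z1 * cis t)); [exact: h2 | circ].
    rewrite cis_0; ring.
  - move=> t; rewrite cis_0 Cmult_1_r; apply: Hm; rewrite Cmod_mult Cmod_cis; lra. }
have Rd : (Re (d * z1) <= 0)%R.
{ apply: (right_derivative_nonpos (fun t : R => - Re (p ((1 - t) * z1)%C))%R 0%R).
  - have -> : Re (d * z1) = (- Re (d * - z1))%R by rewrite /Cmult /Copp /Re /Im /=; ring.
    apply: (is_derive_opp (fun t : R => Re (p ((1 - t) * z1)))).
    apply: pder_Re.
    have E : (1 - RtoC 0) * z1 = z1 by ring.
    have h2 : Cder p ((1 - RtoC 0) * z1) d by rewrite E; exact: holo_Cder.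
    apply: pder_eq; first by apply: (pder_comp p (fun t : R => (1 - t) * z1)); [exact: h2 | pder].
    cring.
  - move=> t Ht; replace ((1 - 0%R) * z1) with z1 by ring.
    have := Hm ((1 - t) * z1); rewrite -RtoC_minus Cmod_mult Cmod_R Rabs_pos_eq; last lra.
    have := Cmod_ge_0 z1 => c0 K; apply: Ropp_le_contravar; apply: K; nra. }
have I0 : Im (d * z1) = 0%R.
{ move: T; rewrite /Cmult /Ci /Re /Im /=; lra. }
exists (- Re (d * z1))%R; split; first lra.
rewrite Cmult_comm; move: I0; case: (d * z1) => u v; rewrite /Re /Im /Copp /RtoC /= => ->.
congr pair; ring.
Qed.

Lemma boundary_min (p : C -> C) (r : R) : hdisk p -> (0 < r < 1)%R ->
  exists z1 (lam : R), Cmod z1 = r /\ (forall z, (Cmod z <= r)%R -> (Re (p z1) <= Re (p z))%R) /\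
    (0 <= lam)%R /\ z1 * C_derive p z1 = - lam.
Proof.
move=> H Hr.
have [z1 [Hz1 Hm]] : exists z1, Cmod (z1 - 0) = r /\ forall z, Cmod (z - 0) = r -> (Re (p z1) <= Re (p z))%R.
{ apply: (circle_argmin (fun z => Re (p z))); first lra.
  move=> z; rewrite Csub0 => Hz; apply: Ccont_Re; apply: holo_cont; apply: H; lra. }
rewrite Csub0 in Hz1.
have Hall z : (Cmod z <= r)%R -> (Re (p z1) <= Re (p z))%R.
{ move=> Hz; apply: (Re_ge_disk p 0 r) => //; try lra.
  - move=> w; rewrite Csub0 => Hw; apply: H; lra.
  - by rewrite Csub0. }
have [|lam [l0 El]] := derivative_at_boundary_min p z1 H ltac:(rewrite /disk; lra).
- by move=> z; rewrite Hz1; exact: Hall.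
- by exists z1, lam.
Qed.

Lemma Re_minus_real (p : C) (lam : R) (s : C) : Re (p + - lam * s) = (Re p - lam * Re s)%R.
Proof. rewrite /Cplus /Copp /Cmult /RtoC /Re /Im /=; ring. Qed.

(** Here p = N/h and s = h/(z h'), so that p + z p' s = N'/h'. At a minimum z1 of Re p on a circle,
    z1 p' = -lam with lam >= 0, whence Re p(z1) >= lam Re s(z1) >= 0. If Re p vanishes at z, then z
    is itself such a minimum, which gives the second clause. *)
Lemma sakaguchi (p s : C -> C) : hdisk p -> hdisk s ->
  (forall z, disk z -> (0 < Re (s z))%R) ->
  (forall z, disk z -> z <> 0 -> (0 <= Re (p z + z * C_derive p z * s z))%R) ->
  forall z, disk z -> (0 <= Re (p z))%R /\
    (z <> 0 -> Re (p z) = 0%R -> (Re (p z + z * C_derive p z * s z) <= 0)%R).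
Proof.
move=> Hp Hs Rs Hq.
have pos z : disk z -> (0 <= Re (p z))%R.
{ rewrite /disk => Hz; have z0 := Cmod_ge_0 z.
  have [z1 [lam [E1 [Hm [l0 El]]]]] := boundary_min p ((1 + Cmod z) / 2) Hp ltac:(lra).
  have D1 : disk z1 by rewrite /disk; lra.
  have n1 : z1 <> 0 by apply/Cmod_gt_0; lra.
  have := Hq z1 D1 n1; rewrite El Re_minus_real.
  have := Rs z1 D1; have := Hm z ltac:(lra); nra. }
move=> z Hz; split; first exact: pos.
move=> n E.
have [w Hw|lam [l0 El]] := derivative_at_boundary_min p z Hp Hz.
- rewrite E; apply: pos; rewrite /disk in Hz *; lra.
- rewrite El Re_minus_real E; have := Rs z Hz; nra.
Qed.

Lemma Re_pos_of_mult (a b : C) (k : R) : a * b = RtoC k -> (0 < k)%R -> (0 < Re b)%R -> (0 < Re a)%R.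
Proof.
case: a => p q; case: b => c d; rewrite /Cmult /RtoC /Re /Im /= => H k0 c0.
have P1 : (p * c - q * d = k)%R by exact: (f_equal fst H).
have P2 : (p * d + q * c = 0)%R by exact: (f_equal snd H).
have : (p * (c * c + d * d) = c * k)%R.
{ have -> : (p * (c * c + d * d) = c * (p * c - q * d) + d * (p * d + q * c))%R by ring.
  rewrite P1 P2; ring. }
nra.
Qed.

(* s = h/(z h') with h(z) = z^3 avg 2 E(z), h' = z^2 E: a function with Re(1 + z h''/h') > 0 is starlike. *)
Lemma starlike_avg (E : C -> C) : hdisk E -> (forall z, disk z -> E z <> 0) ->
  (forall z, disk z -> (0 < Re (3 + z * C_derive E z / E z))%R) ->
  forall z, disk z -> (0 < Re (avg 2 E z / E z))%R.
Proof.
move=> HE n HJ z; rewrite /disk => Hz.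
set s := fun z => avg 2 E z / E z.
have Hs : hdisk s.
{ move=> w Hw; have h1 := hdisk_avg 2 E HE w Hw; have h2 := HE w Hw; have n1 := n w Hw; by rewrite /s; holo. }
have ode w : disk w -> w * C_derive s w + s w * (3 + w * C_derive E w / E w) = 1.
{ move=> Hw; have h1 := hdisk_avg 2 E HE w Hw; have h2 := HE w Hw; have n1 := n w Hw.
  have D : Cder s w ((C_derive (avg 2 E) w * E w - avg 2 E w * C_derive E w) / (E w * E w)).
  { rewrite /s; by Cder. }
  rewrite (Cder_derive _ _ _ D) /s.
  have O := avg_ode 2 E w HE Hw.
  replace (RtoC (INR 3)) with (RtoC 3) in O by (congr RtoC; rewrite /=; ring).
  have n2 : E w * E w <> 0 by exact: Cmult_neq_0.
  transitivity ((3 * avg 2 E w + w * C_derive (avg 2 E) w) / E w); first by field.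
  rewrite O; by field. }
have z0 := Cmod_ge_0 z.
have [z1 [lam [E1 [Hm [l0 El]]]]] := boundary_min s ((1 + Cmod z) / 2) Hs ltac:(lra).
have D1 : disk z1 by rewrite /disk; lra.
apply: (Rlt_le_trans _ (Re (s z1))); last by apply: Hm; lra.
apply: Rnot_le_lt => Rneg.
(* At the minimum the differential equation reads s(z1) J = 1 + lam with Re J > 0, so Re s(z1) >
   0. *)
have := ode z1 D1; rewrite El; set J := 3 + _ => O.
have RJ := HJ z1 D1. rewrite -/J in RJ.
have P : s z1 * J = RtoC (1 + lam) by rewrite RtoC_plus -O; ring.
have := Re_pos_of_mult _ _ _ P ltac:(lra) RJ; lra.
Qed.

(** * The curvature condition is preserved by multiplication by [z] and by Moebius maps *)

(** [curv w B T] expresses Re(B P''(w)/P'(w) + T) > 0 for all convex functions P at once: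
    by [convex_fun_koebe], P''(w)/P'(w) = 2 xi / (1 - xi w) with |xi| <= 1. *)
Definition curv (w B T : C) : Prop :=
  forall xi, (Cmod xi <= 1)%R -> (0 < Re (2 * xi * B / (1 - xi * w) + T))%R.

Lemma one_minus_neq0 (xi w : C) : (Cmod xi <= 1)%R -> disk w -> 1 - xi * w <> 0.
Proof.
move=> Hx Hw; have := Cneq_1_plus (- (xi * w)); apply.
rewrite Cmod_opp; exact: (disk_scal xi w Hx Hw).
Qed.

Lemma Re_cayley (u : C) : disk u -> (0 < Re ((1 + u) / (1 - u)))%R.
Proof.
rewrite /disk => Hu.
have n : 1 - u <> 0 by apply: (Cneq_1_plus (- u)); rewrite Cmod_opp.
have np : (0 < Cmod (1 - u))%R by apply/Cmod_gt_0.
have E := Re_div_conj (1 + u) (1 - u) n.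
have E2 : Re (Cconj (1 - u) * (1 + u)) = (1 - Cmod u ^ 2)%R.
{ rewrite Cmod2_alt; case: u {Hu n np E} => a b; rewrite /Cmult /Cconj /Cminus /Cplus /Copp /RtoC /Re /Im /=; ring. }
rewrite E2 in E; have c0 := Cmod_ge_0 u.
have : (0 < Cmod (1 - u) ^ 2)%R by apply: pow_lt.
nra.
Qed.

Lemma curv_start (y : C) : disk y -> curv y y 1.
Proof.
move=> Hy xi Hxi; have n := one_minus_neq0 xi y Hxi Hy.
have -> : 2 * xi * y / (1 - xi * y) + 1 = (1 + xi * y) / (1 - xi * y) by field.
by apply: Re_cayley; apply: disk_scal.
Qed.

(** For w depending on z, B stands for z dw/dz, so z w has z (w + B). The test parameter becomes xi
    z, and the extra 1 combines with the new term into (1 + xi z w) / (1 - xi z w), of positive real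
    part. *)
Lemma curv_mult (z w B T : C) : disk z -> disk w -> curv w B T -> curv (z * w) (z * (w + B)) (T + 1).
Proof.
move=> Hz Hw HS xi Hxi.
have Hxz : (Cmod (xi * z) < 1)%R by apply: disk_scal.
have n := one_minus_neq0 (xi * z) w (Rlt_le _ _ Hxz) Hw.
have n' : 1 - xi * (z * w) <> 0 by rewrite Cmult_assoc.
have -> : 2 * xi * (z * (w + B)) / (1 - xi * (z * w)) + (T + 1) =
  (2 * (xi * z) * B / (1 - xi * z * w) + T) + (1 + xi * z * w) / (1 - xi * z * w) by field.
have H1 := HS (xi * z) (Rlt_le _ _ Hxz).
have H2 := Re_cayley (xi * z * w) (disk_scal (xi * z) w (Rlt_le _ _ Hxz) Hw).
by rewrite /Cplus /Re /= in H1 H2 *; lra.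
Qed.

Definition dsigma (a z : C) : C := (1 - a * Cconj a) / ((1 + Cconj a * z) * (1 + Cconj a * z)).

(** The term removed from T is minus z times the logarithmic derivative of sigma_a'(w(z)). The
    change is absorbed by a Moebius transformation of the test parameter xi, which preserves the
    closed disk; this is why [curv] quantifies over all of it. *)
Lemma curv_sigma (a w B T : C) : disk a -> disk w -> curv w B T ->
  curv (Csigma a w) (dsigma a w * B) (T - 2 * Cconj a * B / (1 + Cconj a * w)).
Proof.
move=> Ha Hw HS xi Hxi.
have Ha' : (Cmod (- Cconj a) < 1)%R by rewrite Cmod_opp Cmod_conj.
have cj : Cconj (- Cconj a) = - a by case: a {Ha HS Ha'} => p q; rewrite /Cconj /Copp /=; congr pair; ring.
have n1 := sigma_den a w Ha (Rlt_le _ _ Hw).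
have n2 := sigma_den (- Cconj a) xi Ha' Hxi; rewrite cj in n2.
have n3 := one_minus_neq0 xi (Csigma a w) Hxi (sigma_lt a w Ha Hw).
have n4 := one_minus_neq0 (Csigma (- Cconj a) xi) w (sigma_le _ _ Ha' Hxi) Hw.
have := HS (Csigma (- Cconj a) xi) (sigma_le _ _ Ha' Hxi).
have E4 : 1 - Csigma (- Cconj a) xi * w = ((1 + - a * xi) - (xi + - Cconj a) * w) / (1 + - a * xi).
{ rewrite /Csigma cj; by field. }
have E3 : 1 - xi * Csigma a w = ((1 + Cconj a * w) - xi * (w + a)) / (1 + Cconj a * w).
{ rewrite /Csigma; by field. }
have n5 : (1 + - a * xi) - (xi + - Cconj a) * w <> 0.
{ move=> K; apply: n4; rewrite E4 K; by field. }
have n6 : (1 + Cconj a * w) - xi * (w + a) <> 0.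
{ move=> K; apply: n3; rewrite E3 K; by field. }
suff -> : 2 * xi * (dsigma a w * B) / (1 - xi * Csigma a w) + (T - 2 * Cconj a * B / (1 + Cconj a * w)) =
  2 * Csigma (- Cconj a) xi * B / (1 - Csigma (- Cconj a) xi * w) + T by [].
rewrite E3 E4 /dsigma /Csigma cj.
have E56 : (1 + - a * xi) - (xi + - Cconj a) * w = (1 + Cconj a * w) - xi * (w + a) by ring.
rewrite E56; field; do ?split => //.
Qed.

Lemma dsigma_neq0 (a z : C) : disk a -> (Cmod z <= 1)%R -> dsigma a z <> 0.
Proof.
move=> Ha Hz; have n := sigma_den a z Ha Hz; have n2 := one_minus_norm2_neq0 a Ha.
have n3 : (1 + Cconj a * z) * (1 + Cconj a * z) <> 0 by apply: Cmult_neq_0.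
have := Cmod_div (1 - a * Cconj a) _ n3; rewrite -/(dsigma a z) => E K.
apply: n2; rewrite /dsigma in K.
replace (1 - a * Cconj a) with ((1 - a * Cconj a) / ((1 + Cconj a * z) * (1 + Cconj a * z)) * ((1 + Cconj a * z) * (1 + Cconj a * z))) by (field; exact: n).
rewrite K; ring.
Qed.

Lemma Cder_dsigma (a z : C) : 1 + Cconj a * z <> 0 ->
  Cder (dsigma a) z (dsigma a z * (- 2 * Cconj a / (1 + Cconj a * z))).
Proof.
move=> n; have n2 : (1 + Cconj a * z) * (1 + Cconj a * z) <> 0 by apply: Cmult_neq_0.
rewrite /dsigma; apply: Cder_eq; first by Cder.
by cfield.
Qed.

Lemma holo_dsigma (a z : C) : 1 + Cconj a * z <> 0 -> holo (dsigma a) z.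
Proof.
move=> n; have n2 : (1 + Cconj a * z) * (1 + Cconj a * z) <> 0 by apply: Cmult_neq_0.
by rewrite /dsigma; holo.
Qed.

(** [blaschke2 g1 g2 psi] is the generic self-map of the disk whose first two Schwarz
    parameters are [g1] and [g2], with remaining parameter [psi]. *)
Definition blaschke2 (g1 g2 : C) (psi : C -> C) (z : C) : C :=
  z * Csigma g1 (z * Csigma g2 (psi z * z)).

(** * The integrand as a function of the parameter, and its curvature *)

Section KeyInequality.
Variables (P : C -> C) (g1 g2 : C).
Hypotheses (HP : convex_fun P) (Hg1 : disk g1) (Hg2 : disk g2).

Let om := blaschke2 g1 g2.

Lemma layers (e z : C) : disk (e * z) -> disk z ->
  disk (z * Csigma g2 (e * z)) /\ disk (z * Csigma g1 (z * Csigma g2 (e * z))) /\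
  1 + Cconj g2 * (e * z) <> 0 /\ 1 + Cconj g1 * (z * Csigma g2 (e * z)) <> 0.
Proof.
move=> He Hz.
have h1 : disk (z * Csigma g2 (e * z)) by exact: sigma_disk_scal.
have h2 : disk (z * Csigma g1 (z * Csigma g2 (e * z))) by exact: sigma_disk_scal.
split => //; split => //; split; apply: sigma_den => //; exact: Rlt_le.
Qed.

(** The derivative of P(z sigma_g1(z sigma_g2(e z))) in e is z^3 times this. *)
Definition dom (e z : C) : C :=
  C_derive P (z * Csigma g1 (z * Csigma g2 (e * z))) *
    (dsigma g1 (z * Csigma g2 (e * z)) * dsigma g2 (e * z)).

Lemma hdisk_P : hdisk P. Proof. by case: HP. Qed.

Lemma dom_neq0 (e z : C) : (Cmod e <= 1)%R -> disk z -> dom e z <> 0.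
Proof.
move=> He Hz; have Hy := disk_scal e z He Hz.
have [h1 [h2 [n2 n1]]] := layers e z Hy Hz.
have [H [inj _]] := HP.
apply: Cmult_neq_0; first exact: injective_derive_neq0.
by apply: Cmult_neq_0; apply: dsigma_neq0 => //; exact: Rlt_le.
Qed.

(** The logarithmic derivative of [dom] in z, with [Bx] and [Bw] equal to z times the derivatives of
    the layers x and w, the shape in which [curv] accumulates them. *)
Lemma Cder_dom (e z : C) : (Cmod e <= 1)%R -> disk z ->
  let y := e * z in let x := z * Csigma g2 y in let w := z * Csigma g1 x in
  let Bx := z * (Csigma g2 y + dsigma g2 y * y) in
  let Bw := z * (Csigma g1 x + dsigma g1 x * Bx) in
  exists l, Cder (dom e) z l /\
  z * l = dom e z * (Bw * C_derive (C_derive P) w / C_derive P w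
    - 2 * Cconj g1 * Bx / (1 + Cconj g1 * x) - 2 * Cconj g2 * y / (1 + Cconj g2 * y)).
Proof.
move=> He Hz y x w Bx Bw; have Hy : disk y by exact: disk_scal.
have [h1 [h2 [n2 n1]]] := layers e z Hy Hz.
have [H [inj _]] := HP.
have Dy : Cder (fun z => e * z) z e by apply: Cder_eq; [Cder | ring].
have Ds2 : Cder (fun z => Csigma g2 (e * z)) z (dsigma g2 y * e).
{ apply: (Cder_comp (Csigma g2) (fun z => e * z)) => //; exact: Cder_sigma. }
have Dx : Cder (fun z => z * Csigma g2 (e * z)) z (Csigma g2 y + z * (dsigma g2 y * e)).
{ apply: Cder_eq; first by apply: (Cder_mult (fun z => z)); [exact: Cder_id | exact: Ds2]. by cbv beta; rewrite -/y; ring. }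
have Ds1 : Cder (fun z => Csigma g1 (z * Csigma g2 (e * z))) z (dsigma g1 x * (Csigma g2 y + z * (dsigma g2 y * e))).
{ apply: (Cder_comp (Csigma g1) (fun z => z * Csigma g2 (e * z))) => //; exact: Cder_sigma. }
have Dw : Cder (fun z => z * Csigma g1 (z * Csigma g2 (e * z))) z
   (Csigma g1 x + z * (dsigma g1 x * (Csigma g2 y + z * (dsigma g2 y * e)))).
{ apply: Cder_eq; first by apply: (Cder_mult (fun z => z)); [exact: Cder_id | exact: Ds1]. by cbv beta; rewrite -/y -/x; ring. }
have DP : Cder (C_derive P) w (C_derive (C_derive P) w) by apply: holo_Cder; exact: hdisk_derive.
eexists; split.
- apply: (Cder_mult (fun z => C_derive P (z * Csigma g1 (z * Csigma g2 (e * z))))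
     (fun z => dsigma g1 (z * Csigma g2 (e * z)) * dsigma g2 (e * z))).
  + apply: (Cder_comp (C_derive P) (fun z => z * Csigma g1 (z * Csigma g2 (e * z)))); [exact: DP | exact: Dw].
  + apply: (Cder_mult (fun z => dsigma g1 (z * Csigma g2 (e * z))) (fun z => dsigma g2 (e * z))).
    * apply: (Cder_comp (dsigma g1) (fun z => z * Csigma g2 (e * z))); [exact: Cder_dsigma | exact: Dx].
    * apply: (Cder_comp (dsigma g2) (fun z => e * z)); [exact: Cder_dsigma | exact: Dy].
- have ln : C_derive P w <> 0 by exact: injective_derive_neq0.
  rewrite /dom -/y -/x -/w /Bw /Bx.
  move: ln n1 n2; rewrite -/y -/x.
  move: (C_derive P w) (C_derive (C_derive P) w) (dsigma g1 x) (dsigma g2 y) (Csigma g1 x) (Csigma g2 y) => p1 p2 d1 d2 s1 s2 ln n1 n2.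
  have -> : y = e * z by []. rewrite -/y.
  field_simplify_eq; last by split; [|split].
  rewrite /y; ring.
Qed.

Lemma hdisk_dom (e : C) : (Cmod e <= 1)%R -> hdisk (dom e).
Proof.
move=> He; apply/hdiskP => z Hz; have [l [D _]] := Cder_dom e z He Hz; exact: Cder_ex D.
Qed.

Lemma koebe_identity (l m w B : C) : l <> 0 -> 2 * l + w * m <> 0 ->
  2 * (m / (2 * l + w * m)) * B / (1 - m / (2 * l + w * m) * w) = B * m / l.
Proof.
move=> ln kn; have n2 := C2_neq_0.
have -> : 1 - m / (2 * l + w * m) * w = 2 * l / (2 * l + w * m) by field.
by field.
Qed.

(** [curv] is started at e z with T = 1 and passed through sigma_g2, multiplication by z, sigma_g1,
    multiplication by z; the two multiplications raise the constant to 3. It is then read at the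
    value of xi that [convex_fun_koebe] attaches to P at w. *)
Lemma dom_curvature (e z : C) : (Cmod e <= 1)%R -> disk z ->
  (0 < Re (3 + z * C_derive (dom e) z / dom e z))%R.
Proof.
move=> He Hz; have [l [D E]] := Cder_dom e z He Hz.
have dn := dom_neq0 e z He Hz.
rewrite (Cder_derive _ _ _ D) E.
have Hy : disk (e * z) := disk_scal e z He Hz.
have [h1 [h2 [n2 n1]]] := layers e z Hy Hz.
have C1 := curv_sigma g2 _ _ _ Hg2 Hy (curv_start _ Hy).
have C2 := curv_mult z _ _ _ Hz (sigma_lt _ _ Hg2 Hy) C1.
have C3 := curv_sigma g1 _ _ _ Hg1 h1 C2.
have C4 := curv_mult z _ _ _ Hz (sigma_lt _ _ Hg1 h1) C3.
have [kn k1] := convex_fun_koebe P _ HP h2.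
have := C4 _ k1.
move: E {D C1 C2 C3 C4 k1}.
set y := e * z in n1 n2 h1 h2 kn *. set x := z * Csigma g2 y in n1 h1 h2 kn *.
set w := z * Csigma g1 x in h2 kn *.
set Bx := z * (Csigma g2 y + dsigma g2 y * y).
set Bw := z * (Csigma g1 x + dsigma g1 x * Bx).
move=> _.
have [H [inj _]] := HP.
have ln : C_derive P w <> 0 by exact: injective_derive_neq0.
move: (dom e z) dn (C_derive P w) ln (C_derive (C_derive P) w) kn => D0 dn p1 ln p2 kn.
rewrite (koebe_identity p1 p2 w Bw ln kn).
set a := 2 * Cconj g1 * Bx / _. set b := 2 * Cconj g2 * y / _.
suff -> : 3 + D0 * (Bw * p2 / p1 - a - b) / D0 = Bw * p2 / p1 + (1 - b + 1 - a + 1) by [].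
by field.
Qed.

(** z^3 [avg_dom e z] is the starlike function h, namely the integral of x^2 [dom e x] from 0 to
    z. *)
Definition avg_dom (e : C) : C -> C := avg 2 (dom e).

Lemma starlike_dom (e z : C) : (Cmod e <= 1)%R -> disk z -> (0 < Re (avg_dom e z / dom e z))%R.
Proof.
move=> He Hz; apply: starlike_avg => //; first exact: hdisk_dom.
- move=> w Hw; exact: dom_neq0.
- move=> w Hw; exact: dom_curvature.
Qed.

Lemma avg_dom_neq0 (e z : C) : (Cmod e <= 1)%R -> disk z -> avg_dom e z <> 0.
Proof.
move=> He Hz E; have := starlike_dom e z He Hz; rewrite E /Cdiv Cmult_0_l /RtoC /Re /=; lra.
Qed.

Definition schur (psi : C -> C) : Prop := hdisk psi /\ forall z, disk z -> (Cmod (psi z) <= 1)%R.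

Lemma schur_const (e : C) : (Cmod e <= 1)%R -> schur (fun _ => e).
Proof. by move=> He; split => // z _; holo. Qed.

Lemma schur_layers (psi : C -> C) (z : C) : schur psi -> disk z ->
  disk (psi z * z) /\ disk (z * Csigma g2 (psi z * z)) /\ disk (om psi z).
Proof.
move=> [Hs Hb] Hz; have Hy := disk_scal (psi z) z (Hb z Hz) Hz.
by have [h1 [h2 _]] := layers (psi z) z Hy Hz.
Qed.

Lemma hdisk_layer (psi : C -> C) : schur psi ->
  hdisk (fun z => Csigma g1 (z * Csigma g2 (psi z * z))).
Proof.
move=> Hpsi z Hz; have [h1 [h2 h3]] := schur_layers psi z Hpsi Hz.
have k1 := proj1 Hpsi z Hz.
have k2 : holo (Csigma g2) (psi z * z) by apply: holo_sigma_disk => //; exact: Rlt_le.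
have k3 : holo (Csigma g1) (z * Csigma g2 (psi z * z)) by apply: holo_sigma_disk => //; exact: Rlt_le.
by holo.
Qed.

Lemma hdisk_blaschke2 (psi : C -> C) : schur psi -> hdisk (om psi).
Proof.
move=> Hpsi z Hz; apply: (holo_mult (fun z => z)); [exact: holo_id | exact: hdisk_layer].
Qed.

Lemma sigma_diff (a u v : C) : disk a -> disk u -> disk v ->
  Csigma a u - Csigma a v = (u - v) * ((1 - a * Cconj a) / ((1 + Cconj a * u) * (1 + Cconj a * v))).
Proof.
move=> Ha Hu Hv; have n1 := sigma_den a u Ha (Rlt_le _ _ Hu); have n2 := sigma_den a v Ha (Rlt_le _ _ Hv).
rewrite /Csigma; by field.
Qed.

(** The divided difference of P is written as the mean of P' over the segment from v z to u z, so it
    remains holomorphic where u and v meet. *)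
Lemma segment_quotient (u v : C -> C) : hdisk u -> hdisk v ->
  (forall z, disk z -> disk (u z)) -> (forall z, disk z -> disk (v z)) ->
  exists Q, hdisk Q /\ forall z, disk z -> P (u z) - P (v z) = (u z - v z) * Q z.
Proof.
move=> Hu Hv Du Dv.
have seg (t : R) z : disk z -> (0 <= t <= 1)%R -> disk (v z + t * (u z - v z)).
{ rewrite /disk => Hz Ht; have h1 := Du z Hz; have h2 := Dv z Hz; rewrite /disk in h1 h2.
  apply: (Rle_lt_trans _ (Rmax (Cmod (v z)) (Cmod (u z)))); last exact: Rmax_lub_lt.
  apply: disk_convex => //; [exact: Rmax_l | exact: Rmax_r]. }
have hP1 := hdisk_derive P hdisk_P. have hP2 := hdisk_derive _ hP1.
exists (fun z => CInt (fun t => C_derive P (v z + t * (u z - v z))) 0 1); split.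
- apply/hdiskP => z Hz.
  apply: Cder_ex.
  apply: (Cder_CInt (fun z t => C_derive P (v z + t * (u z - v z)))
    (fun z t => C_derive (C_derive P) (v z + t * (u z - v z)) * (C_derive v z + t * (C_derive u z - C_derive v z)))
    z 0 1 (1 - Cmod z)); try (rewrite /disk in Hz; lra).
  + move=> w t /(near_in_disk z Hz) Hw Ht.
    have h1 := Hu w Hw; have h2 := Hv w Hw; have h3 := hP1 _ (seg t w Hw Ht).
    apply: Cder_eq; first by apply: (Cder_comp (C_derive P) (fun z => v z + t * (u z - v z))); [exact: holo_Cder h3 | Cder].
    cring.
  + move=> w t /(near_in_disk z Hz) Hw Ht.
    have h3 := holo_cont _ _ (hP1 _ (seg t w Hw Ht)); by Ccont.
  + move=> t Ht.
    have h1 := holo_cont _ _ (Hu z Hz); have h2 := holo_cont _ _ (Hv z Hz).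
    have h4 := holo_cont _ _ (hdisk_derive u Hu z Hz); have h5 := holo_cont _ _ (hdisk_derive v Hv z Hz).
    have h3 := holo_cont _ _ (hP2 _ (seg t z Hz Ht)); by Ccont.
- move=> z Hz.
  have J : is_CInt (fun t => C_derive P (v z + t * (u z - v z)) * (u z - v z)) 0 1
    ((fun t : R => P (v z + t * (u z - v z))) 1%R - (fun t : R => P (v z + t * (u z - v z))) 0%R).
  { apply: (is_CInt_derive (fun t : R => P (v z + t * (u z - v z)))); first lra.
    - move=> t Ht; have h := hdisk_P _ (seg t z Hz Ht).
      apply: pder_eq; first by apply: (pder_comp P (fun t : R => v z + t * (u z - v z))); [exact: holo_Cder h | pder].
      cring.
    - move=> t Ht; have h3 := holo_cont _ _ (hP1 _ (seg t z Hz Ht)); by Ccont. }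
  have I : is_CInt (fun t => (u z - v z) * C_derive P (v z + t * (u z - v z))) 0 1
    ((u z - v z) * CInt (fun t => C_derive P (v z + t * (u z - v z))) 0 1).
  { apply: is_CInt_scal; apply: is_CInt_CInt; first lra.
    move=> t Ht; have h3 := holo_cont _ _ (hP1 _ (seg t z Hz Ht)); by Ccont. }
  rewrite -(CInt_unique _ _ _ _ I).
  transitivity ((fun t : R => P (v z + t * (u z - v z))) 1%R - (fun t : R => P (v z + t * (u z - v z))) 0%R).
  { cbv beta; congr (P _ - P _); ring. }
  rewrite -(CInt_unique _ _ _ _ J); apply: CInt_ext; first lra. move=> t _; ring.
Qed.

(** Each of the three multiplications by z in [blaschke2] passes one factor z to the difference. *)
Lemma blaschke2_difference (psi chi : C -> C) : schur psi -> schur chi ->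
  exists M, hdisk M /\ forall z, disk z -> P (om psi z) - P (om chi z) = z * z * z * M z.
Proof.
move=> Hpsi Hchi.
have D1 z : disk z -> disk (om psi z) by move=> Hz; have [_ []] := schur_layers psi z Hpsi Hz.
have D2 z : disk z -> disk (om chi z) by move=> Hz; have [_ []] := schur_layers chi z Hchi Hz.
have [Q [HQ EQ]] := segment_quotient (om psi) (om chi) (hdisk_blaschke2 _ Hpsi) (hdisk_blaschke2 _ Hchi) D1 D2.
pose X (f : C -> C) z := z * Csigma g2 (f z * z).
pose q2 z := (1 - g2 * Cconj g2) / ((1 + Cconj g2 * (psi z * z)) * (1 + Cconj g2 * (chi z * z))).
pose q1 z := (1 - g1 * Cconj g1) / ((1 + Cconj g1 * (X psi z)) * (1 + Cconj g1 * (X chi z))).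
exists (fun z => (psi z - chi z) * q2 z * q1 z * Q z); split.
- move=> z Hz.
  have [a1 [a2 _]] := schur_layers psi z Hpsi Hz. have [b1 [b2 _]] := schur_layers chi z Hchi Hz.
  have n1 := sigma_den g2 _ Hg2 (Rlt_le _ _ a1); have n2 := sigma_den g2 _ Hg2 (Rlt_le _ _ b1).
  have n3 := sigma_den g1 _ Hg1 (Rlt_le _ _ a2); have n4 := sigma_den g1 _ Hg1 (Rlt_le _ _ b2).
  have h1 := proj1 Hpsi z Hz; have h2 := proj1 Hchi z Hz; have h3 := HQ z Hz.
  have k1 : holo (Csigma g2) (psi z * z) by apply: holo_sigma.
  have k2 : holo (Csigma g2) (chi z * z) by apply: holo_sigma.
  by rewrite /q1 /q2 /X; holo; apply: Cmult_neq_0.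
- move=> z Hz.
  have [a1 [a2 a3]] := schur_layers psi z Hpsi Hz. have [b1 [b2 b3]] := schur_layers chi z Hchi Hz.
  rewrite EQ //.
  have -> : om psi z - om chi z = z * (Csigma g1 (X psi z) - Csigma g1 (X chi z)) by rewrite /om /blaschke2 /X; ring.
  rewrite sigma_diff // -/(q1 z).
  have -> : X psi z - X chi z = z * (Csigma g2 (psi z * z) - Csigma g2 (chi z * z)) by rewrite /X; ring.
  rewrite sigma_diff // -/(q2 z); ring.
Qed.

End KeyInequality.

(** * [Pint] as an integral of a holomorphic function *)

Lemma hdisk_Pint_integrand (P v : C -> C) : hdisk P -> hdisk v -> (forall z, disk z -> disk (z * v z)) ->
  hdisk (fun z => v z * dq P (z * v z)).
Proof.
move=> HP Hv Hd z Hz; have h1 := Hv z Hz; have h2 := hdisk_dq P HP _ (Hd z Hz); by holo.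
Qed.

(** Writing omega z = z v z and P w = 1 + w [dq P] w cancels the factor 1/z. The integrands agree
    for t in the open interval, so the value of the inverse at 0 is immaterial. *)
Lemma is_CInt_Pint (P omega v : C -> C) (z : C) : hdisk P -> P 0 = 1 -> hdisk v ->
  (forall z, disk z -> omega z = z * v z) -> (forall z, disk z -> disk (omega z)) -> disk z ->
  is_CInt (fun t => z * (/ (t * z) * (P (omega (t * z)) - 1))) 0 1 (z * avg 0 (fun z => v z * dq P (z * v z)) z).
Proof.
move=> HP P0 Hv E Hd Hz.
have Hd' x : disk x -> disk (x * v x) by move=> Hx; rewrite -E //; exact: Hd.
have I := is_CInt_scal z _ _ _ _ (is_CInt_avg 0 _ z (hdisk_Pint_integrand P v HP Hv Hd') Hz).
apply: is_CInt_ext I; first lra.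
move=> t Ht; case: (Ceq_dec z 0) => [->|n]; first by rewrite !Cmult_0_l.
have tn : RtoC t <> 0 by move=> /RtoC_inj; lra.
have Htz : disk (t * z) by apply: Cmod_tz_lt => //; lra.
rewrite E // (dq_spec P (t * z * v (t * z)) HP (Hd' _ Htz)) P0 /=.
by field.
Qed.

Lemma Pint_avg (P omega v : C -> C) (z : C) : hdisk P -> P 0 = 1 -> hdisk v ->
  (forall z, disk z -> omega z = z * v z) -> (forall z, disk z -> disk (omega z)) -> disk z ->
  Pint P omega z = z * avg 0 (fun z => v z * dq P (z * v z)) z.
Proof. move=> HP P0 Hv E Hd Hz; apply: CInt_unique; exact: is_CInt_Pint. Qed.

(** * Passing the support inequality from integrands to integrals *)

Section KeyInequality2.
Variables (P : C -> C) (g1 g2 : C).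
Hypotheses (HP : convex_fun P) (P0 : P 0 = 1) (Hg1 : disk g1) (Hg2 : disk g2).

Let om := blaschke2 g1 g2.

Lemma is_CInt_Pint_blaschke2 (psi : C -> C) (z : C) : schur psi -> disk z ->
  is_CInt (fun t => z * (/ (t * z) * (P (om psi (t * z)) - 1))) 0 1 (Pint P (om psi) z).
Proof.
move=> Hpsi Hz.
have HPd := hdisk_P P HP.
have Hv := hdisk_layer g1 g2 Hg1 Hg2 psi Hpsi.
have Hd x : disk x -> disk (om psi x) by move=> Hx; have [_ []] := schur_layers g1 g2 Hg1 Hg2 psi x Hpsi Hx.
rewrite (Pint_avg P (om psi) _ z HPd P0 Hv) //.
exact: is_CInt_Pint.
Qed.

Lemma key_inequality (e z0 : C) (psi : C -> C) :
  disk z0 -> z0 <> 0 -> e <> 0 -> (Cmod e <= 1)%R -> schur psi ->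
  (forall z, disk z -> (Cmod (psi z) <= Cmod e)%R) ->
  let p := (Pint P (om (fun _ => e)) z0 - Pint P (om psi) z0) / (e * (z0 * z0 * z0 * avg_dom P g1 g2 e z0)) in
  (0 <= Re p)%R /\ (Re p = 0%R -> forall z, disk z -> psi z = e).
Proof.
move=> Hz0 z0n en He Hpsi Hbd p.
have [M [HM EM]] := blaschke2_difference P g1 g2 HP Hg1 Hg2 (fun _ => e) psi (schur_const e He) Hpsi.
have Hdom := hdisk_dom P g1 g2 HP Hg1 Hg2 e He.
have dn z : disk z -> dom P g1 g2 e z <> 0 by exact: dom_neq0.
have an z : disk z -> avg_dom P g1 g2 e z <> 0 by exact: avg_dom_neq0.
have Hs z : disk z -> (0 < Re (avg_dom P g1 g2 e z / dom P g1 g2 e z))%R by exact: starlike_dom.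
have hA : hdisk (avg_dom P g1 g2 e) by exact: hdisk_avg.
have hN : hdisk (avg 2 M) by exact: hdisk_avg.
have odeE z (Hz : disk z) := avg_ode 2 _ z Hdom Hz.
have odeM z (Hz : disk z) := avg_ode 2 _ z HM Hz.
rewrite -/(avg_dom P g1 g2 e) in odeE.
have Ediff : Pint P (om (fun _ => e)) z0 - Pint P (om psi) z0 = z0 * z0 * z0 * avg 2 M z0.
{ have I1 := is_CInt_Pint_blaschke2 _ z0 (schur_const e He) Hz0.
  have I2 := is_CInt_Pint_blaschke2 _ z0 Hpsi Hz0.
  have I := is_CInt_minus _ _ _ _ _ _ I1 I2.
  have J := is_CInt_scal (z0 * z0 * z0) _ _ _ _ (is_CInt_avg 2 M z0 HM Hz0).
  rewrite -(CInt_unique _ _ _ _ I) -(CInt_unique _ _ _ _ J); apply: CInt_ext; first lra.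
  move=> t Ht; have tn : RtoC t <> 0 by move=> /RtoC_inj; lra.
  have Htz : disk (t * z0) by apply: Cmod_tz_lt => //; lra.
  have := EM _ Htz; rewrite -/om.
  set u := P _; set v := P _ => E.
  transitivity (/ t * (u - v)); first by field.
  rewrite E /= !RtoC_mult; field; exact: tn. }
pose pf := fun z => avg 2 M z / (e * avg_dom P g1 g2 e z).
have hpf : hdisk pf.
{ move=> z Hz; have h1 := hN z Hz; have h2 := hA z Hz; have n := an z Hz.
  by rewrite /pf; holo; apply: Cmult_neq_0. }
have hs : hdisk (fun z => avg_dom P g1 g2 e z / dom P g1 g2 e z).
{ move=> z Hz; have h1 := Hdom z Hz; have h2 := hA z Hz; have n := dn z Hz; by holo. }
have Ep : p = pf z0 by rewrite /p Ediff /pf; field; split => //; exact: an.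
(* In terms of N = z^3 [avg 2 M] and h = z^3 [avg_dom], the right side is N'/(e h'), since N' = z^2
   M and h' = z^2 [dom]. *)
have Eq z : disk z -> pf z + z * C_derive pf z * (avg_dom P g1 g2 e z / dom P g1 g2 e z) = M z / (e * dom P g1 g2 e z).
{ move=> Hz; have h1 := hN z Hz; have h2 := hA z Hz; have n := an z Hz; have n' := dn z Hz.
  have n2 : e * avg_dom P g1 g2 e z <> 0 by exact: Cmult_neq_0.
  have D : Cder pf z ((C_derive (avg 2 M) z * avg_dom P g1 g2 e z - avg 2 M z * C_derive (avg_dom P g1 g2 e) z)
     / (e * (avg_dom P g1 g2 e z * avg_dom P g1 g2 e z))).
  { rewrite /pf; apply: Cder_eq; first by Cder. by field. }
  rewrite (Cder_derive _ _ _ D) -(odeM z Hz).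
  have E3 : RtoC (INR 3) * avg_dom P g1 g2 e z + z * C_derive (avg_dom P g1 g2 e) z - dom P g1 g2 e z = 0.
  { rewrite (odeE z Hz); ring. }
  rewrite /pf.
  have -> : z * ((C_derive (avg 2 M) z * avg_dom P g1 g2 e z - avg 2 M z * C_derive (avg_dom P g1 g2 e) z) /
     (e * (avg_dom P g1 g2 e z * avg_dom P g1 g2 e z))) =
     (z * C_derive (avg 2 M) z * avg_dom P g1 g2 e z - avg 2 M z * (dom P g1 g2 e z - RtoC (INR 3) * avg_dom P g1 g2 e z)) /
     (e * (avg_dom P g1 g2 e z * avg_dom P g1 g2 e z)).
  { rewrite -(odeE z Hz); by field. }
  by field. }
have K z : disk z -> z <> 0 ->
  (0 <= Re (M z / (e * dom P g1 g2 e z)))%R /\ (psi z <> e -> (0 < Re (M z / (e * dom P g1 g2 e z)))%R).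
{ move=> Hz zn.
  have Hy : disk (e * z) by exact: disk_scal.
  have Hx : (Cmod (psi z * z) <= Cmod (e * z))%R.
  { rewrite !Cmod_mult; apply: Rmult_le_compat_r; [exact: Cmod_ge_0 | exact: Hbd]. }
  (* For this z the integrand is a convex function of y, compared at psi(z) z and e z; the bound
     |psi| <= |e| orders their moduli as the support inequality requires. *)
  have HK := convex_fun_sigma _ g2 z (convex_fun_sigma P g1 z HP Hg1 Hz zn) Hg2 Hz zn.
  have DK : C_derive (fun y => P (z * Csigma g1 (z * Csigma g2 y))) (e * z) = z * z * dom P g1 g2 e z.
  { have [h1 [h2 [n2 n1]]] := layers g1 g2 Hg1 Hg2 e z Hy Hz.
    apply: Cder_derive.
    have k1 := holo_Cder _ _ (hdisk_P P HP _ h2).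
    have k2 := Cder_sigma g1 _ n1. have k3 := Cder_sigma g2 _ n2.
    apply: Cder_eq; first by Cder.
    rewrite /dom /dsigma; by field. }
  have EMz : M z / (e * dom P g1 g2 e z) = (P (z * Csigma g1 (z * Csigma g2 (e * z))) - P (z * Csigma g1 (z * Csigma g2 (psi z * z)))) /
     (e * z * C_derive (fun y => P (z * Csigma g1 (z * Csigma g2 y))) (e * z)).
  { have := EM z Hz; rewrite /blaschke2 => ->; rewrite DK; field; do !split => //; exact: dn. }
  have pos : psi z <> e -> (0 < Re (M z / (e * dom P g1 g2 e z)))%R.
  { move=> n; rewrite EMz; apply: (convex_support _ (psi z * z) (e * z) HK) => // E; apply: n.
    replace (psi z) with (psi z * z / z) by (field; exact: zn). rewrite E; field; exact: zn. }
  split => //.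
  case: (Ceq_dec (psi z) e) => [E|n]; last by apply: Rlt_le; exact: pos.
  rewrite EMz E.
  match goal with |- (0 <= Re (?a / ?b))%R => have -> : a / b = 0 by rewrite /Cdiv; ring end.
  rewrite /RtoC /Re /=; lra. }
have [S1 S2] := sakaguchi pf _ hpf hs Hs (fun z Hz zn => eq_ind_r (fun q => 0 <= Re q)%R (proj1 (K z Hz zn)) (Eq z Hz)) z0 Hz0.
rewrite Ep; split => // E z Hz.
have := S2 z0n E; rewrite (Eq z0 Hz0) => Q.
(* Vanishing at z0 makes N'/(e h') of nonpositive real part there, which strict support allows only
   if psi z0 = e. Then psi attains its bound |e| inside the disk and is constant. *)
have E0 : psi z0 = e by apply: NNPP => n; have := proj2 (K z0 Hz0 z0n) n; lra.
rewrite -E0; apply: (strong_maximum psi (Cmod e)) => //; first exact: (proj1 Hpsi).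
by rewrite E0.
Qed.

(** * The function [Qint] of the parameter [eps] *)

(** Assuming only |e z0| < 1 gives a neighbourhood of the closed disk of parameters on which [Qint]
    is analytic. *)
Lemma Cder_Qint (e z0 : C) : disk z0 -> disk (e * z0) ->
  Cder (Qint P g1 g2 z0) e (z0 * z0 * z0 * avg_dom P g1 g2 e z0).
Proof.
move=> Hz0 He0.
have z0p := Cmod_ge_0 z0.
case: (Ceq_dec z0 0) => [->|z0n].
{ apply: (Cder_ext_loc (fun _ => 0)); last by rewrite !Cmult_0_l; exact: Cder_const.
  apply: filter_forall => w; symmetry; apply: CInt_unique.
  have H0 := is_CInt_const 0 0 1; rewrite Cmult_0_r in H0.
  apply: is_CInt_ext H0; first lra. move=> t _; by rewrite Cmult_0_l. }
have m0 : (0 < Cmod z0)%R by apply/Cmod_gt_0.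
have HPd := hdisk_P P HP. have HQ := hdisk_dq P HPd.
have tz t : (0 <= t <= 1)%R -> disk (t * z0) by exact: Cmod_tz_lt.
have near w : (Cmod (w - e) < (1 - Cmod (e * z0)))%R -> disk (w * z0).
{ rewrite /disk => Hw; replace (w * z0) with ((w - e) * z0 + e * z0) by ring.
  apply: Rle_lt_trans (Cmod_triangle _ _) _; rewrite (Cmod_mult (w - e)).
  rewrite /disk in Hz0; have := Cmod_ge_0 (w - e); nra. }
have wtz w t : disk (w * z0) -> (0 <= t <= 1)%R -> disk (w * (t * z0)).
{ move=> Hw Ht; replace (w * (t * z0)) with (t * (w * z0)) by ring. exact: Cmod_tz_lt. }
pose v w t := Csigma g1 (t * z0 * Csigma g2 (w * (t * z0))).
(* The integrand with 1/t cancelled, differentiable in w also at t = 0. *)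
pose G (w : C) (t : R) := z0 * (v w (RtoC t) * dq P (t * z0 * v w (RtoC t))).
have EG w : disk (w * z0) -> Qint P g1 g2 z0 w = CInt (G w) 0 1.
{ move=> Hw; apply: CInt_ext; first lra.
  move=> t Ht; have tn : RtoC t <> 0 by move=> /RtoC_inj; lra.
  have Ht' : (0 <= t <= 1)%R by lra.
  have [h1 [h2 _]] := layers g1 g2 Hg1 Hg2 w (t * z0) (wtz w t Hw Ht') (tz t Ht').
  rewrite (dq_spec P _ HPd h2) P0 /G /v; by field. }
have HeD : (0 < 1 - Cmod (e * z0))%R by rewrite /disk in He0; lra.
apply: (Cder_ext_loc (fun w => CInt (G w) 0 1)).
{ apply/locally_Cmod; exists (1 - Cmod (e * z0))%R; split => // w /near Hw; by rewrite EG. }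
have derG w t : disk (w * z0) -> (0 <= t <= 1)%R ->
  Cder (fun w => G w t) w (z0 * z0 * z0 * (RtoC (t ^ 2) * dom P g1 g2 w (t * z0))).
{ move=> Hw Ht.
  have [h1 [h2 [n2 n1]]] := layers g1 g2 Hg1 Hg2 w (t * z0) (wtz w t Hw Ht) (tz t Ht).
  have k2 := Cder_sigma g1 _ n1. have k3 := Cder_sigma g2 _ n2. have k4 := holo_Cder _ _ (HQ _ h2).
  rewrite /G /v; apply: Cder_eq.
  - by Cder.
  (* P' w is expanded as [dq P] w + w ([dq P])' w, since the integrand contains [dq P]. *)
  - cbv beta; rewrite /dom -[C_derive P _](avg_ode 0 _ _ (hdisk_derive P HPd) h2) -/(dq P) /dsigma /= Rmult_1_r RtoC_mult.
    field; by split. }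
have ->: z0 * z0 * z0 * avg_dom P g1 g2 e z0 = CInt (fun t => z0 * z0 * z0 * (RtoC (t ^ 2) * dom P g1 g2 e (t * z0))) 0 1.
{ symmetry; apply: CInt_unique; apply: is_CInt_scal; apply: is_CInt_CInt; first lra.
  move=> t Ht; have [h1 [h2 [n2 n1]]] := layers g1 g2 Hg1 Hg2 e (t * z0) (wtz e t He0 Ht) (tz t Ht).
  have k1 := holo_cont _ _ (hdisk_derive P HPd _ h2).
  have k2 := holo_cont _ _ (holo_sigma g1 _ n1). have k3 := holo_cont _ _ (holo_sigma g2 _ n2).
  have k4 := holo_cont _ _ (holo_dsigma g1 _ n1). have k5 := holo_cont _ _ (holo_dsigma g2 _ n2).
  apply: Ccont_mult; first by apply: (Ccont_pow _ (fun t : R => t)); exact: continuous_id.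
  by rewrite /dom; Ccont. }
apply: (Cder_CInt G (fun w t => z0 * z0 * z0 * (RtoC (t ^ 2) * dom P g1 g2 w (t * z0))) e 0 1 (1 - Cmod (e * z0))) => //; first lra.
- move=> w t /near Hw Ht; exact: derG.
- move=> w t /near Hw Ht.
  have [h1 [h2 [n2 n1]]] := layers g1 g2 Hg1 Hg2 w (t * z0) (wtz w t Hw Ht) (tz t Ht).
  have k1 := holo_cont _ _ (HQ _ h2).
  have k2 := holo_cont _ _ (holo_sigma g1 _ n1). have k3 := holo_cont _ _ (holo_sigma g2 _ n2).
  by rewrite /G /v; Ccont.
- move=> t Ht; have [h1 [h2 [n2 n1]]] := layers g1 g2 Hg1 Hg2 e (t * z0) (wtz e t He0 Ht) (tz t Ht).
  have k1 := holo_cont _ _ (hdisk_derive P HPd _ h2).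
  have k2 := holo_cont _ _ (holo_sigma g1 _ n1). have k3 := holo_cont _ _ (holo_sigma g2 _ n2).
  have k4 := holo_cont _ _ (holo_dsigma g1 _ n1). have k5 := holo_cont _ _ (holo_dsigma g2 _ n2).
  apply: Ccont_mult; first exact: Ccont_const.
  apply: Ccont_mult; first by apply: (Ccont_pow _ (fun p : C * R => snd p)); exact: continuous_snd.
  by rewrite /dom; Ccont.
Qed.

End KeyInequality2.

Lemma Re_convex_comb (a b : C) (t : R) : Re ((1 - t) * a + t * b) = ((1 - t) * Re a + t * Re b)%R.
Proof. rewrite /Cplus /Cminus /Cmult /Copp /RtoC /Re /Im /=; ring. Qed.

Lemma Re_inv_pos (u : C) : u <> 0 -> (0 < Re u)%R -> (0 < Re (/ u))%R.
Proof. move=> n H; apply: (Re_pos_of_mult (/ u) u 1) => //; [exact: Cinv_l | lra]. Qed.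

(** * Injectivity, covering and convexity for a fixed end point *)

Section QintProperties.
Variables (P : C -> C) (g1 g2 z0 : C).
Hypotheses (HP : convex_fun P) (P0 : P 0 = 1) (Hg1 : disk g1) (Hg2 : disk g2) (Hz0 : disk z0) (z0n : z0 <> 0).

Let F := Qint P g1 g2 z0.
Let om := blaschke2 g1 g2.

Lemma Qint_cder (e : C) : disk (e * z0) -> Cder F e (C_derive F e).
Proof. move=> He; apply: ex_derive_Cder; exact: Cder_ex (Cder_Qint P g1 g2 HP P0 Hg1 Hg2 e z0 Hz0 He). Qed.

Lemma cdisk_scal_z0 (e : C) : (Cmod e <= 1)%R -> disk (e * z0).
Proof. by move=> He; exact: disk_scal. Qed.

Lemma open_Qint_domain : @open C_UniformSpace (fun e => disk (e * z0)).
Proof.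
have m0 : (0 < Cmod z0)%R by apply/Cmod_gt_0.
have Hz1 : (Cmod z0 < 1)%R := Hz0.
move=> e He; apply/locally_Cmod; exists (1 - Cmod (e * z0))%R; rewrite /disk in He *; split; first lra.
move=> w Hw; replace (w * z0) with ((w - e) * z0 + e * z0) by ring.
apply: Rle_lt_trans (Cmod_triangle _ _) _; rewrite (Cmod_mult (w - e)).
have := Cmod_ge_0 (w - e); nra.
Qed.

Lemma holo_Qint (e : C) : (Cmod e <= 1)%R -> holo F e.
Proof.
move=> He; apply: (holo_open (fun e => disk (e * z0)) F e open_Qint_domain); last exact: cdisk_scal_z0.
move=> w Hw; exact: Cder_ex (Qint_cder w Hw).
Qed.

Lemma derive_Qint (e : C) : (Cmod e <= 1)%R -> C_derive F e = z0 * z0 * z0 * avg_dom P g1 g2 e z0.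
Proof. move=> He; apply: Cder_derive; apply: Cder_Qint => //; exact: cdisk_scal_z0. Qed.

Lemma derive_Qint_neq0 (e : C) : (Cmod e <= 1)%R -> C_derive F e <> 0.
Proof.
move=> He; rewrite derive_Qint //; apply: Cmult_neq_0; last exact: avg_dom_neq0.
by do 2 apply: Cmult_neq_0 => //.
Qed.

Lemma Qint_support (e : C) (psi : C -> C) :
  e <> 0 -> (Cmod e <= 1)%R -> schur psi -> (forall z, disk z -> (Cmod (psi z) <= Cmod e)%R) ->
  (0 <= Re ((F e - Pint P (om psi) z0) / (e * C_derive F e)))%R /\
  (Re ((F e - Pint P (om psi) z0) / (e * C_derive F e)) = 0%R -> forall z, disk z -> psi z = e).
Proof. move=> en He Hpsi Hbd; rewrite derive_Qint //; exact: key_inequality. Qed.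

Lemma Qint_injective : injective_on cdisk F.
Proof.
suff W x y : cdisk x -> cdisk y -> (Cmod x <= Cmod y)%R -> F x = F y -> x = y.
{ move=> x y Hx Hy E; case: (Rle_dec (Cmod x) (Cmod y)) => Hc; first exact: W.
  symmetry; apply: W => //; lra. }
move=> Hx Hy Hxy E.
case: (Ceq_dec y 0) => [y0|yn].
{ rewrite y0 Cmod_0 in Hxy *; apply: Cmod_eq_0; have := Cmod_ge_0 x; lra. }
(* The point of smaller modulus enters as a constant psi; F x = F y is then the equality case. *)
have [_ K] := Qint_support y (fun _ => x) yn Hy (schur_const x Hx) (fun _ _ => Hxy).
apply: (K _ 0 disk0).
have -> : Pint P (om (fun _ => x)) z0 = F y by exact: E.
by have -> : (F y - F y) / (y * C_derive F y) = 0 by rewrite /Cdiv; ring.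
Qed.

(* If w were not a value of F on |e| <= r, the function e F'(e)/(F(e) - w), which vanishes at 0,
   would have positive real part on |e| = r, contradicting the mean value property. *)
Lemma Qint_covers (r : R) (w : C) : (0 < r <= 1)%R ->
  (forall e, Cmod e = r -> F e <> w -> (0 < Re ((F e - w) / (e * C_derive F e)))%R) ->
  exists e, (Cmod e <= r)%R /\ F e = w.
Proof.
move=> Hr H; apply: NNPP => N.
have n e : (Cmod e <= r)%R -> F e - w <> 0.
{ move=> He E; apply: N; exists e; split => //; replace (F e) with (F e - w + w) by ring; rewrite E; ring. }
pose R0 := fun e => e * C_derive F e / (F e - w).
have pos e : Cmod e = r -> (0 < Re (R0 e))%R.
{ move=> He; have He1 : (Cmod e <= 1)%R by lra.
  have n1 := n e (Req_le _ _ He). have n2 := derive_Qint_neq0 e He1.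
  have en : e <> 0 by apply/Cmod_gt_0; lra.
  have -> : R0 e = / ((F e - w) / (e * C_derive F e)) by rewrite /R0; field; do !split.
  apply: Re_inv_pos.
  - apply: Cmult_neq_0 => // K; have n3 : e * C_derive F e <> 0 by apply: Cmult_neq_0.
    have := Cinv_r _ n3; rewrite K Cmult_0_r => /RtoC_inj; lra.
  - apply: H => // E; apply: n1; rewrite E; ring. }
have [] := mean_value_Re_pos R0 0 r (proj1 Hr).
- move=> e; rewrite Csub0 => He; have He1 : (Cmod e <= 1)%R by lra.
  have h1 := holo_Qint e He1; have h2 := holo_derive _ _ h1; have n1 := n e He.
  by rewrite /R0; holo.
- move=> e; rewrite Csub0 => He; apply: Rlt_le; exact: pos.
- have -> : R0 0 = 0 by rewrite /R0 /Cdiv; ring.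
  move=> _ /(_ eq_refl) K.
  have Er : Cmod r = r by rewrite Cmod_R Rabs_pos_eq; lra.
  have := pos r Er; rewrite K; first lra. by rewrite Csub0.
Qed.

Lemma Qint_variability (psi : C -> C) : schur psi -> exists e, cdisk e /\ F e = Pint P (om psi) z0.
Proof.
move=> Hpsi; have [|e [He E]] := Qint_covers 1 (Pint P (om psi) z0) (ltac:(lra)); last by exists e.
move=> e He nE.
have en : e <> 0 by apply/Cmod_gt_0; lra.
have Hbd z : disk z -> (Cmod (psi z) <= Cmod e)%R by move=> Hz; rewrite He; exact: (proj2 Hpsi).
have [K1 K2] := Qint_support e psi en (Req_le _ _ He) Hpsi Hbd.
case: (Rle_lt_or_eq_dec _ _ K1) => // E; exfalso; apply: nE.
(* In the equality case psi is the constant e and the integral equals F e, which [nE] excludes. *)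
have Epsi := K2 (eq_sym E).
apply: CInt_ext; first lra. move=> t Ht.
by rewrite /om /blaschke2 Epsi //; apply: Cmod_tz_lt => //; lra.
Qed.

Lemma Qint_convex_image : convex_domain (image F disk).
Proof.
have HF : hdisk F by move=> e He; apply: holo_Qint; exact: Rlt_le.
have inj : injective_on disk F by move=> x y Hx Hy; apply: Qint_injective; exact: Rlt_le.
split; [|split].
- move=> w [e [He <-]]; apply/locally_Cmod.
  have He' : (Cmod e < 1)%R := He.
  have [eta [e0 Heta]] := open_mapping F e ((1 - Cmod e) / 2) HF inj ltac:(lra) ltac:(lra).
  exists eta; split => // v /Heta [z [Hz Ez]]; exists z; split => //.
  rewrite /disk; have := Cmod_triangle_minus z e; lra.
- exists (F 0), 0; split => //; exact: disk0.
- move=> x y t [e1 [He1 <-]] [e2 [He2 <-]] Ht.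
  set w := (1 - t) * F e1 + t * F e2.
  (* Covering is applied on |e| <= r < 1: both constants e1 and e2 are admissible against |e| = r,
     and the preimage found stays in the open disk. *)
  set r := Rmax (Cmod e1) (Cmod e2).
  have r1 : (r < 1)%R by exact: Rmax_lub_lt.
  have Hr1 : (Cmod e1 <= r)%R by exact: Rmax_l.
  have Hr2 : (Cmod e2 <= r)%R by exact: Rmax_r.
  case: (Rle_dec r 0) => r0.
  { have E1 : e1 = 0 by apply: Cmod_eq_0; have := Cmod_ge_0 e1; lra.
    have E2 : e2 = 0 by apply: Cmod_eq_0; have := Cmod_ge_0 e2; lra.
    exists 0; split; first exact: disk0. rewrite /w E1 E2; ring. }
  have [|e [He Ee]] := Qint_covers r w ltac:(lra); last first.
  { exists e; split => //; rewrite /disk; lra. }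
  move=> e He nE.
  have en : e <> 0 by apply/Cmod_gt_0; lra.
  have He1' : (Cmod e <= 1)%R by lra.
  have dn := derive_Qint_neq0 e He1'.
  have S u (Hu : (Cmod u <= r)%R) : (0 <= Re ((F e - F u) / (e * C_derive F e)))%R /\
     (Re ((F e - F u) / (e * C_derive F e)) = 0%R -> u = e).
  { have [K1 K2] := Qint_support e (fun _ => u) en He1' (schur_const u ltac:(lra)) (fun _ _ => ltac:(lra)).
    split => // E; exact: (K2 E 0 disk0). }
  have [A1 A2] := S e1 Hr1. have [B1 B2] := S e2 Hr2.
  have E : (F e - w) / (e * C_derive F e) =
    (1 - t) * ((F e - F e1) / (e * C_derive F e)) + t * ((F e - F e2) / (e * C_derive F e)) by rewrite /w; field.
  rewrite E Re_convex_comb.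
  move: A1 A2 B1 B2; set p1 := Re _; set p2 := Re _ => A1 A2 B1 B2.
  apply: Rnot_le_lt => Hle.
  (* Two nonnegative terms with nonpositive sum vanish; each then has zero weight or its point is e,
     so w = F e, against [nE]. *)
  have Q1 : (0 <= (1 - t) * p1)%R by apply: Rmult_le_pos; lra.
  have Q2 : (0 <= t * p2)%R by apply: Rmult_le_pos; lra.
  have Z1 : ((1 - t) * p1 = 0)%R by lra.
  have Z2 : (t * p2 = 0)%R by lra.
  apply: nE; rewrite /w.
  case: (Rmult_integral _ _ Z1) => [t1|/A2 ->].
  + have -> : t = 1%R by lra.
    case: (Rmult_integral _ _ Z2) => [t0|/B2 ->]; first lra. ring.
  + case: (Rmult_integral _ _ Z2) => [->|/B2 ->]; ring.
Qed.

Lemma Qint_convex_univalent : convex_univalent_analytic_on_cdisk F.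
Proof.
split; [|split; [exact: Qint_injective | exact: Qint_convex_image]].
exists (fun e => disk (e * z0)); split; [exact: open_Qint_domain | split; first exact: cdisk_scal_z0].
move=> e He; exact: Cder_ex (Qint_cder e He).
Qed.

End QintProperties.

(** * The complex exponential *)

Lemma Ccont_Cexp (z : C) : @Ccont C_UniformSpace Cexp z.
Proof.
apply: (continuous_ext (fun z : C => RtoC (exp (Re z)) * cis (Im z))).
{ move=> w; rewrite /Cexp /cis /Cmult /RtoC /=; congr pair; ring. }
case: z => x y.
apply: (Ccont_mult C_UniformSpace (fun z : C => RtoC (exp (Re z))) (fun z : C => cis (Im z))).
- apply: (Ccont_RtoC_comp C_UniformSpace (fun z : C => exp (Re z))).
  apply: (continuous_comp (fun z : C => Re z) exp); first exact: continuous_fst.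
  by apply: (@ex_derive_continuous R_AbsRing R_NormedModule); auto_derive.
- apply: (continuous_comp (fun z : C => Im z) cis); [exact: continuous_snd | exact: Ccont_cis].
Qed.

(** Along the segment from z to w, real calculus gives the derivative (w - z) Cexp of the curve; the
    mean value inequality and continuity of [Cexp] turn this into a complex derivative. *)
Lemma Cder_Cexp (z : C) : Cder Cexp z (Cexp z).
Proof.
apply/Cder_iff => e e0.
have [d [d0 Hd]] := proj1 (locally_Cmod _ _) (proj1 (Ccont_iff _ _ _) (Ccont_Cexp z) e e0).
exists d; split => // w Hw.
have w0 := Cmod_ge_0 (w - z).
pose g := fun s : R => Cexp (z + s * (w - z)) - s * ((w - z) * Cexp z).
have D (s : R) : pder g s ((w - z) * (Cexp (z + s * (w - z)) - Cexp z)).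
{ have D1 : pder (fun s : R => Cexp (z + s * (w - z))) s ((w - z) * Cexp (z + s * (w - z))).
  { case: z w {Hd Hw w0 g} => a b [c k]; apply: pder_pair; rewrite /Cexp /Cminus /Cplus /Copp /Cmult /RtoC /Re /Im /=;
      auto_derive => //; rewrite !Rmult_0_l Ropp_0 !Rplus_0_r Rminus_0_r; ring. }
  apply: pder_eq; first by apply: pder_minus; [exact: D1 | pder].
  by cring. }
have := mean_value_bound g _ 0 1 (e * Cmod (w - z)) Rle_0_1 (fun t _ => D t).
rewrite /g Rminus_0_r Rmult_1_r.
replace (z + 1 * (w - z)) with w by ring. replace (z + 0 * (w - z)) with z by ring.
replace (Cexp w - 1 * ((w - z) * Cexp z) - (Cexp z - 0 * ((w - z) * Cexp z))) with (Cexp w - Cexp z - Cexp z * (w - z)) by ring.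
apply => t Ht; rewrite Cmod_mult Rmult_comm; apply: Rmult_le_compat_r => //; apply: Rlt_le; apply: Hd.
replace (z + t * (w - z) - z) with (t * (w - z)) by ring.
rewrite Cmod_mult Cmod_R Rabs_pos_eq; nra.
Qed.

Lemma holo_Cexp (z : C) : holo Cexp z.
Proof. by apply: filter_forall => w; apply: Cder_ex (Cder_Cexp w). Qed.

Lemma Cexp_neq0 (z : C) : Cexp z <> 0.
Proof.
have E : Cexp z = RtoC (exp (Re z)) * cis (Im z) by rewrite /Cexp /cis /Cmult /RtoC /=; congr pair; ring.
rewrite E; apply: Cmult_neq_0.
- move=> /RtoC_inj; have := exp_pos (Re z); lra.
- move=> K; have := Cmod_cis (Im z); rewrite K Cmod_0; lra.
Qed.

Lemma Cexp_0 : Cexp 0 = 1.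
Proof. by rewrite /Cexp /= exp_0 cos_0 sin_0 Rmult_1_l Rmult_0_r. Qed.

Lemma locally_disk (z : C) : disk z -> @locally C_UniformSpace z disk.
Proof. exact: open_ball0. Qed.

Lemma derive_ext_disk (f g : C -> C) (z : C) :
  hdisk f -> (forall z, disk z -> f z = g z) -> disk z -> C_derive f z = C_derive g z.
Proof.
move=> Hf E Hz; apply: C_derive_ext_loc; last exact: Hf.
by apply: filter_imp (locally_disk z Hz) => w; exact: E.
Qed.

Lemma hdisk_ext (f g : C -> C) : hdisk f -> (forall z, disk z -> f z = g z) -> hdisk g.
Proof.
move=> Hf E z Hz; apply: (holo_ext_loc f); last exact: Hf.
by apply: filter_imp (locally_disk z Hz) => w; exact: E.
Qed.

Lemma hdisk_constant (f : C -> C) (z : C) : hdisk f -> (forall z, disk z -> C_derive f z = 0) -> disk z -> f z = f 0.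
Proof.
move=> Hf E Hz; rewrite (dq_spec f z Hf Hz) /dq /avg (CInt_unique _ 0 1 0); first by ring.
have H0 := is_CInt_const 0 0 1; rewrite Cmult_0_r in H0.
apply: is_CInt_ext H0; first lra. move=> t Ht; rewrite E; first by ring.
apply: Cmod_tz_lt => //; lra.
Qed.

Lemma hdisk_primitive_unique (f g : C -> C) (z : C) : hdisk f -> hdisk g -> f 0 = g 0 ->
  (forall z, disk z -> C_derive f z = C_derive g z) -> disk z -> f z = g z.
Proof.
move=> Hf Hg E0 E Hz.
have H : hdisk (fun z => f z - g z) by move=> w Hw; have h1 := Hf w Hw; have h2 := Hg w Hw; holo.
have := hdisk_constant _ z H _ Hz; rewrite E0 => K.
replace (f z) with (f z - g z + g z) by ring; rewrite K; first by ring.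
move=> w Hw; apply: Cder_derive; have h1 := Hf w Hw; have h2 := Hg w Hw.
apply: Cder_eq; first by Cder. rewrite (E w Hw); ring.
Qed.

(** At 0, where division fails, a 0 is recovered as the derivative of z a(z). *)
Lemma mult_z_inj (a b : C -> C) (z : C) : hdisk a -> hdisk b ->
  (forall z, disk z -> z * a z = z * b z) -> disk z -> a z = b z.
Proof.
move=> Ha Hb E Hz.
case: (Ceq_dec z 0) => [->|n].
- have h1 := Ha 0 disk0; have h2 := Hb 0 disk0.
  have D1 : Cder (fun z => z * a z) 0 (a 0) by apply: Cder_eq; [Cder | ring].
  have D2 : Cder (fun z => z * b z) 0 (b 0) by apply: Cder_eq; [Cder | ring].
  rewrite -(Cder_derive _ _ _ D1) -(Cder_derive _ _ _ D2); apply: (derive_ext_disk _ _ 0 _ E disk0).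
  by move=> w Hw; have h := Ha w Hw; holo.
- replace (a z) with (z * a z / z) by (field; exact: n). rewrite (E z Hz); field; exact: n.
Qed.

Lemma hdisk_Cint (g : C -> C) : hdisk g ->
  hdisk (Cint g) /\ forall z, disk z -> C_derive (Cint g) z = g z.
Proof.
move=> Hg.
have D z : disk z -> Cder (fun z => z * avg 0 g z) z (g z).
{ move=> Hz; have h := hdisk_avg 0 g Hg z Hz.
  apply: Cder_eq; first by Cder. rewrite -(avg_ode 0 g z Hg Hz) /=; ring. }
have E z : disk z -> z * avg 0 g z = Cint g z.
{ move=> Hz; symmetry; apply: CInt_unique.
  have := is_CInt_scal z _ _ _ _ (is_CInt_avg 0 g z Hg Hz).
  apply: is_CInt_ext; first lra. move=> t _; rewrite /=; ring. }
have H : hdisk (fun z => z * avg 0 g z) by apply/hdiskP => z Hz; exact: Cder_ex (D z Hz).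
split; first exact: hdisk_ext E.
move=> z Hz; rewrite -(derive_ext_disk _ _ z H E Hz); apply: Cder_derive; exact: D.
Qed.

Lemma Cint_0 (g : C -> C) : Cint g 0 = 0.
Proof.
apply: CInt_unique; have H0 := is_CInt_const 0 0 1; rewrite Cmult_0_r in H0.
apply: is_CInt_ext H0; first lra. move=> t _; by rewrite Cmult_0_l.
Qed.

(** * Functions of the class [CV] and their Schwarz functions *)

Section Representation.
Variables (P : C -> C) (Omega : C -> Prop).
Hypotheses (HP : convex_fun P) (P0 : P 0 = 1) (HOmega : forall w, image P disk w <-> Omega w).

(** The Schwarz function of [f] is [z * v z]; the right-hand side is [(P (z * v z) - 1) / z]. *)
Definition represents (v f : C -> C) : Prop :=
  forall z, disk z -> C_derive (C_derive f) z / C_derive f z = v z * dq P (z * v z).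

Lemma schur_disk (v : C -> C) (z : C) : schur v -> disk z -> disk (z * v z).
Proof. move=> [_ Hb] Hz; rewrite Cmult_comm; apply: disk_scal => //; exact: Hb. Qed.

Lemma dq_P_spec (v : C -> C) (z : C) : schur v -> disk z -> 1 + z * (v z * dq P (z * v z)) = P (z * v z).
Proof. move=> Hv Hz; rewrite (dq_spec P _ (hdisk_P P HP) (schur_disk v z Hv Hz)) P0; ring. Qed.

Lemma hdisk_integrand (v : C -> C) : schur v -> hdisk (fun z => v z * dq P (z * v z)).
Proof.
move=> Hv; apply: hdisk_Pint_integrand; [exact: hdisk_P | exact: (proj1 Hv) | move=> z; exact: schur_disk].
Qed.

Lemma CV_represents (f : C -> C) : CV Omega f -> exists v, schur v /\ represents v f.
Proof.
move=> [[Hf [f0 f1]] HCV].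
have {}Hf : hdisk f by apply/hdiskP.
have [H [inj _]] := HP.
have H1 := hdisk_derive f Hf. have H2 := hdisk_derive _ H1.
pose g := fun z => 1 + z * (C_derive (C_derive f) z / C_derive f z).
have n z : disk z -> C_derive f z <> 0 by move=> /HCV [].
have hl : hdisk (fun z => C_derive (C_derive f) z / C_derive f z).
{ move=> z Hz; have h1 := H1 z Hz; have h2 := H2 z Hz; have nz := n z Hz; by holo. }
have hg : hdisk g by move=> z Hz; have h := hl z Hz; rewrite /g; holo.
(* The Schwarz function of f; it vanishes at 0 because g 0 = 1 = P 0, and its quotient by z is the
   wanted v. *)
pose om := fun z => disk_inverse P (g z).
have omP z : disk z -> disk (om z) /\ P (om z) = g z.
{ move=> Hz; apply: disk_inverse_spec.
  have [_ /HOmega [x [Hx Ex]]] := HCV z Hz; by exists x. }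
have hom : hdisk om.
{ move=> z Hz; have [D1 D2] := omP z Hz; apply: (holo_comp (disk_inverse P) g); last exact: hg.
  rewrite -D2; exact: holo_disk_inverse. }
have om0 : om 0 = 0.
{ have [D1 D2] := omP 0 disk0; apply: inj => //; first exact: disk0. rewrite D2 P0 /g; ring. }
have Hv : schur (dq om).
{ split; first exact: hdisk_dq.
  move=> z Hz; apply: bound_dq => // w Hw; apply: Rlt_le; by have [] := omP w Hw. }
exists (dq om); split => // z Hz.
apply: (mult_z_inj _ _ z hl (hdisk_integrand _ Hv)) => // w Hw.
have := dq_P_spec _ w Hv Hw; have := dq_spec om w hom Hw; rewrite om0 Cplus_0_l => <-.
have [_ ->] := omP w Hw; rewrite /g => E.
replace (w * (dq om w * dq P (om w))) with (1 + w * (dq om w * dq P (om w)) - 1) by ring.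
rewrite E; ring.
Qed.

Lemma Pint_primitive (v omega : C -> C) : schur v -> (forall z, disk z -> omega z = z * v z) ->
  hdisk (Pint P omega) /\ forall z, disk z -> C_derive (Pint P omega) z = v z * dq P (z * v z).
Proof.
move=> Hv E.
have hl := hdisk_integrand v Hv.
have [H1 H2] := hdisk_Cint _ hl.
have EE z : disk z -> Cint (fun z => v z * dq P (z * v z)) z = Pint P omega z.
{ move=> Hz.
  rewrite (Pint_avg P omega v z (hdisk_P P HP) P0 (proj1 Hv) E) //; last first.
  { move=> w Hw; rewrite E //; exact: schur_disk. }
  apply: CInt_unique; have := is_CInt_scal z _ _ _ _ (is_CInt_avg 0 _ z hl Hz).
  apply: is_CInt_ext; first lra. move=> t _; rewrite /=; ring. }
split; first exact: hdisk_ext EE.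
by move=> z Hz; rewrite -(derive_ext_disk _ _ z H1 EE Hz) H2.
Qed.

Lemma Pint_0 (omega : C -> C) : Pint P omega 0 = 0.
Proof. exact: Cint_0. Qed.

Lemma hdisk_Cexp (L : C -> C) : hdisk L -> hdisk (fun z => Cexp (L z)).
Proof. move=> H z Hz; have h := H z Hz; have h2 := holo_Cexp (L z); by holo. Qed.

Lemma derive_Cexp (L : C -> C) (z : C) : hdisk L -> disk z ->
  C_derive (fun z => Cexp (L z)) z = Cexp (L z) * C_derive L z.
Proof. move=> H Hz; apply: Cder_derive; apply: Cder_comp; [exact: Cder_Cexp | exact: holo_Cder (H z Hz)]. Qed.

Lemma derive_of_log (f L : C -> C) (z : C) : hdisk f -> hdisk L ->
  (forall z, disk z -> Cexp (L z) = C_derive f z) -> disk z ->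
  C_derive (C_derive f) z / C_derive f z = C_derive L z.
Proof.
move=> Hf HL E Hz.
rewrite -(derive_ext_disk _ _ z (hdisk_Cexp L HL) E Hz) derive_Cexp // -(E z Hz).
field; exact: Cexp_neq0.
Qed.

Lemma CV_of_schur (v omega : C -> C) : schur v -> (forall z, disk z -> omega z = z * v z) ->
  let f := Cint (fun x => Cexp (Pint P omega x)) in
  CV Omega f /\ represents v f.
Proof.
move=> Hv E f.
have [HL DL] := Pint_primitive v omega Hv E.
have [Hf Df] := hdisk_Cint _ (hdisk_Cexp _ HL).
have R z : disk z -> C_derive (C_derive f) z / C_derive f z = v z * dq P (z * v z).
{ move=> Hz; rewrite (derive_of_log f _ z Hf HL) ?DL // => w Hw; by rewrite Df. }
split => //; split.
- split; [by apply/hdiskP | split; first exact: Cint_0].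
  by rewrite Df ?Pint_0 ?Cexp_0 //; exact: disk0.
- move=> z Hz; split; first by rewrite Df //; exact: Cexp_neq0.
  rewrite R // (dq_P_spec v z Hv Hz); apply/HOmega; exists (z * v z); split => //; exact: schur_disk.
Qed.

(** A branch of log f' is determined by its value 0 at 0 and its derivative f''/f', which
    [Pint P omega] shares. *)
Lemma log_deriv_represents (f v omega : C -> C) (z w : C) : CV Omega f -> schur v ->
  (forall z, disk z -> omega z = z * v z) -> represents v f -> disk z ->
  (log_deriv f z w <-> w = Pint P omega z).
Proof.
move=> [[Hf [f0 f1]] HCV] Hv E R Hz.
have {}Hf : hdisk f by apply/hdiskP.
have [HL DL] := Pint_primitive v omega Hv E.
split.
- move=> [L [HL' [L0 [EL <-]]]].
  have {}HL' : hdisk L by apply/hdiskP.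
  apply: hdisk_primitive_unique => //; first by rewrite Pint_0.
  by move=> x Hx; rewrite DL // -R // (derive_of_log f L).
- move=> ->; exists (Pint P omega); split; first by apply/hdiskP.
  split; first exact: Pint_0. split => // x Hx.
  (* the quotient f'/exp(L) has zero derivative and equals 1 at 0 *)
  have H1 := hdisk_derive f Hf. have H2 := hdisk_Cexp _ HL.
  have n y : disk y -> C_derive f y <> 0 by move=> /HCV [].
  have hq : hdisk (fun y => C_derive f y / Cexp (Pint P omega y)).
  { move=> y Hy; have h1 := H1 y Hy; have h2 := H2 y Hy; have nz := Cexp_neq0 (Pint P omega y).
    by apply: (holo_div (C_derive f) (fun y => Cexp (Pint P omega y))). }
  have K : C_derive f x / Cexp (Pint P omega x) = C_derive f 0 / Cexp (Pint P omega 0).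
  { apply: (hdisk_constant _ x hq) => // y Hy; apply: Cder_derive.
    have nz := Cexp_neq0 (Pint P omega y). have n1 := n y Hy.
    apply: Cder_eq.
    - apply: (Cder_div (C_derive f) (fun y => Cexp (Pint P omega y))) => //; [exact: holo_Cder (H1 y Hy) | exact: holo_Cder (H2 y Hy)].
    - rewrite derive_Cexp // DL // -R //; by field. }
  have nz := Cexp_neq0 (Pint P omega x).
  rewrite Pint_0 Cexp_0 f1 in K.
  replace (C_derive f x) with (C_derive f x / Cexp (Pint P omega x) * Cexp (Pint P omega x)) by (field; exact: nz).
  rewrite K; field.
Qed.

Lemma represents_formula (f v omega : C -> C) (z : C) : CV Omega f -> schur v ->
  (forall z, disk z -> omega z = z * v z) -> represents v f -> disk z ->
  f z = Cint (fun x => Cexp (Pint P omega x)) z.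
Proof.
move=> HCV Hv E R Hz.
have [HL DL] := Pint_primitive v omega Hv E.
have [Hi Di] := hdisk_Cint _ (hdisk_Cexp _ HL).
have [[Hf [f0 f1]] _] := HCV.
have {}Hf : hdisk f by apply/hdiskP.
apply: hdisk_primitive_unique => //; first by rewrite f0 Cint_0.
move=> x Hx; rewrite Di //.
have [L [HL' [L0 [EL Lx]]]] := proj2 (log_deriv_represents f v omega x _ HCV Hv E R Hx) eq_refl.
by rewrite -EL // Lx.
Qed.

(** The equation f'' = v [dq P](z v) f' and its derivative are evaluated at 0, where f' = 1; the
    denominators are 2! and 3!. *)
Lemma coef_represents (f v : C -> C) : CV Omega f -> schur v -> represents v f ->
  coef f 2 = coef P 1 * v 0 / 2 /\
  coef f 3 = (coef P 1 * C_derive v 0 + coef P 2 * v 0 ^ 2 + coef P 1 ^ 2 * v 0 ^ 2) / 6.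
Proof.
move=> [[Hf [f0 f1]] HCV] Hv R.
have {}Hf : hdisk f by apply/hdiskP.
have H1 := hdisk_derive f Hf. have H2 := hdisk_derive _ H1.
have HPd := hdisk_P P HP.
have hl := hdisk_integrand v Hv.
have E z : disk z -> v z * dq P (z * v z) * C_derive f z = C_derive (C_derive f) z.
{ move=> Hz; have [n _] := HCV z Hz; rewrite -(R z Hz); field; exact: n. }
have h1 : holo v 0 by exact: (proj1 Hv) 0 disk0.
have h2 : holo (dq P) (0 * v 0) by rewrite Cmult_0_l; exact: hdisk_dq P HPd 0 disk0.
have h3 := H1 0 disk0.
have D : Cder (fun z => v z * dq P (z * v z) * C_derive f z) 0
   ((C_derive v 0 * dq P 0 + v 0 * (C_derive (dq P) 0 * v 0)) * C_derive f 0 + v 0 * dq P 0 * C_derive (C_derive f) 0).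
{ apply: Cder_eq; first by Cder. rewrite !Cmult_0_l; ring. }
have Hm : hdisk (fun z => v z * dq P (z * v z) * C_derive f z).
{ move=> z Hz; have k1 := hl z Hz; have k2 := H1 z Hz.
  by apply: (holo_mult (fun z => v z * dq P (z * v z)) (C_derive f)). }
have D3 : C_derive (C_derive (C_derive f)) 0 =
  (C_derive v 0 * dq P 0 + v 0 * (C_derive (dq P) 0 * v 0)) * C_derive f 0 + v 0 * dq P 0 * C_derive (C_derive f) 0.
{ rewrite -(derive_ext_disk _ _ 0 Hm E disk0); exact: Cder_derive D. }
have D2 := E 0 disk0; rewrite Cmult_0_l f1 Cmult_1_r in D2.
have Q0 := dq_at_0 P HPd. have Q1 := dq_derive_0 P HPd.
have c1 : coef P 1 = dq P 0 by rewrite /coef /= Q0; field.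
have c2 : coef P 2 = C_derive (dq P) 0.
{ rewrite /coef /= -Q1. have -> : (1 + 1 = 2)%R by ring. field. }
have n2 := C2_neq_0.
split.
- rewrite c1 /coef /= -D2. have -> : (1 + 1 = 2)%R by ring. by field.
- rewrite c1 c2 /coef.
  have -> : INR (fact 3) = 6%R by rewrite /=; ring.
  rewrite /= D3 -D2 f1; field.
Qed.

End Representation.

(** * Schur parameters *)

Lemma schur_unimodular (v : C -> C) (z : C) : schur v -> Cmod (v 0) = 1%R -> disk z -> v z = v 0.
Proof. move=> [Hv Hb] H0 Hz; apply: (strong_maximum v 1) => //; exact: disk0. Qed.

(** One step of Schur's algorithm: sigma_(-v 0) composed with v vanishes at 0 and is divided by z.
    By the maximum principle v stays in the open disk, so the composition is bounded by 1. *)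
Lemma schur_step (v : C -> C) : schur v -> disk (v 0) ->
  exists u, schur u /\ forall z, disk z -> v z = Csigma (v 0) (z * u z).
Proof.
move=> [Hv Hb] H0.
have Hd z : disk z -> disk (v z).
{ move=> Hz; case: (Rle_lt_or_eq_dec _ _ (Hb z Hz)) => // E.
  have K : v 0 = v z by apply: (strong_maximum v 1) => //; exact: disk0.
  by rewrite -K. }
have H0' : (Cmod (- v 0) < 1)%R by exact: Cmod_opp_lt1.
pose w := fun z => Csigma (- v 0) (v z).
have hw : hdisk w.
{ move=> z Hz; have h := Hv z Hz; have h2 := holo_sigma_disk (- v 0) (v z) H0' (Hb z Hz).
  by apply: (holo_comp (Csigma (- v 0)) v). }
have w0 : w 0 = 0.
{ rewrite /w /Csigma; replace (v 0 + - v 0) with (RtoC 0) by ring. by rewrite /Cdiv Cmult_0_l. }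
exists (dq w); split.
- split; first exact: hdisk_dq.
  move=> z Hz; apply: bound_dq => // x Hx; apply: Rlt_le; apply: sigma_lt => //; exact: Hd.
- move=> z Hz; have := dq_spec w z hw Hz; rewrite w0 Cplus_0_l => <-.
  by rewrite /w sigma_inv' //; exact: Hb.
Qed.

Lemma schur_sigma (a : C) (u : C -> C) : disk a -> schur u ->
  schur (fun z => Csigma a (z * u z)).
Proof.
move=> Ha Hu; have Hd z : disk z -> disk (z * u z) by exact: schur_disk.
split.
- move=> z Hz; have h := proj1 Hu z Hz; have h2 := holo_sigma_disk a (z * u z) Ha (Rlt_le _ _ (Hd z Hz)).
  by holo.
- move=> z Hz; apply: sigma_le => //; apply: Rlt_le; exact: Hd.
Qed.

Lemma derive_schur_sigma (a : C) (u v : C -> C) : disk a -> schur u ->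
  (forall z, disk z -> v z = Csigma a (z * u z)) ->
  v 0 = a /\ C_derive v 0 = (1 - a * Cconj a) * u 0.
Proof.
move=> Ha Hu E; split; first by rewrite E ?Cmult_0_l ?sigma_0 //; exact: disk0.
rewrite -(derive_ext_disk (fun z => Csigma a (z * u z)) v 0 (proj1 (schur_sigma a u Ha Hu)) (fun z Hz => eq_sym (E z Hz)) disk0).
apply: Cder_derive.
have h := proj1 Hu 0 disk0.
have n : 1 + Cconj a * (0 * u 0) <> 0 by rewrite Cmult_0_l Cmult_0_r Cplus_0_r => /RtoC_inj; lra.
apply: Cder_eq; first by apply: (Cder_comp (Csigma a) (fun z => z * u z)); [exact: Cder_sigma | Cder].
rewrite !Cmult_0_l Cmult_0_r Cplus_0_r; field.
Qed.

(** * The coefficient body *)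

Lemma convex_fun_of_domain (P : C -> C) (Omega : C -> Prop) :
  convex_domain Omega -> conformal_map P Omega -> convex_fun P.
Proof.
move=> [_ [_ conv]] [HP [inj im]]; split; [by apply/hdiskP | split => //].
move=> x y t Hx Hy Ht.
have /im [m [Hm Em]] : Omega ((1 - t) * P x + t * P y).
{ by apply: conv => //; apply/im; [exists x | exists y]. }
by exists m.
Qed.

Lemma coef_1_neq0 (P : C -> C) : convex_fun P -> coef P 1 <> 0.
Proof.
move=> [H [inj _]] E; apply: (injective_derive_neq0 P 0 H inj disk0).
have -> : C_derive P 0 = coef P 1 by rewrite /coef /=; field. exact: E.
Qed.

Lemma norm2_conj_neg (a : C) : 1 - a * Cconj a = RtoC (1 - Cmod a ^ 2).
Proof. by rewrite RtoC_minus Cmod2_conj. Qed.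

Section CoefficientBody.
Variables (P : C -> C) (Omega : C -> Prop).
Hypotheses (HP : convex_fun P) (P0 : P 0 = 1) (HOmega : forall w, image P disk w <-> Omega w).

(** [schur1 lambda] and [schur2 lambda mu] are the values forced on [v 0] and [v' 0]
    by [(a_2(f), a_3(f)) = (lambda, mu)] when [f] is represented by [v]. *)
Definition schur1 (lambda : C) : C := 2 * lambda / coef P 1.
Definition schur2 (lambda mu : C) : C :=
  (6 * mu - (coef P 2 + coef P 1 ^ 2) * schur1 lambda ^ 2) / coef P 1.

Lemma coef_iff (f v : C -> C) (lambda mu : C) : CV Omega f -> schur v -> represents P v f ->
  ((coef f 2, coef f 3) = (lambda, mu) <-> v 0 = schur1 lambda /\ C_derive v 0 = schur2 lambda mu).
Proof.
move=> HCV Hv R; have [E2 E3] := coef_represents P Omega HP f v HCV Hv R.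
have an := coef_1_neq0 P HP. have n2 := C2_neq_0.
have n6 : RtoC 6 <> 0 by move=> /RtoC_inj; lra.
rewrite E2 E3 /schur2 /schur1; split.
- move=> [<- <-]; have E1 : 2 * (coef P 1 * v 0 / 2) / coef P 1 = v 0 by field.
  by rewrite E1; split => //; field.
- move=> [E1 ->]; rewrite -E1; congr pair; last by field.
  by rewrite E1; field.
Qed.

Lemma coef_body_iff (lambda mu : C) : coef_body Omega (lambda, mu) <->
  exists v, schur v /\ v 0 = schur1 lambda /\ C_derive v 0 = schur2 lambda mu.
Proof.
split.
- move=> [f [HCV E]]; have [v [Hv R]] := CV_represents P Omega HP P0 HOmega f HCV.
  by exists v; split => //; apply/(coef_iff f v).
- move=> [v [Hv E]].
  have [HCV R] := CV_of_schur P Omega HP P0 HOmega v (fun z => z * v z) Hv (fun _ _ => eq_refl).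
  by eexists; split; first exact: HCV; apply/(coef_iff _ v).
Qed.

(** The Schwarz-Pick inequality |v'(0)| <= 1 - |v(0)|^2: when |v(0)| < 1, v'(0) is (1 - |v(0)|^2)
    u(0) with u the next Schur function; otherwise v is constant. *)
Lemma coef_body_necessary (lambda mu : C) : coef_body Omega (lambda, mu) ->
  (Cmod (schur1 lambda) <= 1)%R /\ (Cmod (schur2 lambda mu) <= 1 - Cmod (schur1 lambda) ^ 2)%R.
Proof.
move=> /coef_body_iff [v [Hv [<- <-]]].
have H0 := proj2 Hv 0 disk0; split => //.
case: (Rle_lt_or_eq_dec _ _ H0) => [Hlt|E].
- have [u [Hu Eu]] := schur_step v Hv Hlt.
  have [_ ->] := derive_schur_sigma (v 0) u v Hlt Hu Eu.
  have u0 := proj2 Hu 0 disk0; have c0 := Cmod_ge_0 (v 0).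
  have q0 : (0 <= 1 - Cmod (v 0) ^ 2)%R by rewrite /disk in Hlt; nra.
  rewrite norm2_conj_neg Cmod_mult Cmod_R Rabs_pos_eq //; nra.
- have -> : C_derive v 0 = 0.
  { rewrite -(derive_ext_disk (fun _ => v 0) v 0 _ (fun z Hz => eq_sym (schur_unimodular v z Hv E Hz)) disk0).
    - exact: Cder_derive (Cder_const _ _).
    - by move=> z _; holo. }
  rewrite Cmod_0 E; lra.
Qed.

(** The slack in the Schwarz-Pick inequality. Positivity of this one continuous function encodes
    both |gamma1| < 1 and |gamma2| < 1. *)
Definition body_margin (p : C * C) : R :=
  (1 - Cmod (schur1 (fst p)) * Cmod (schur1 (fst p)) - Cmod (schur2 (fst p) (snd p)))%R.

Lemma coef_body_sufficient (p : C * C) : (0 < body_margin p)%R -> coef_body Omega p.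
Proof.
case: p => lambda mu; rewrite /body_margin /= => H.
have c0 := Cmod_ge_0 (schur1 lambda); have c1 := Cmod_ge_0 (schur2 lambda mu).
have H1 : disk (schur1 lambda) by rewrite /disk; nra.
have n := one_minus_norm2_neq0 _ H1.
set u := schur2 lambda mu / (1 - schur1 lambda * Cconj (schur1 lambda)).
have Hu : schur (fun _ => u).
{ apply: schur_const; rewrite /u Cmod_div // norm2_conj_neg Cmod_R Rabs_pos_eq; last nra.
  apply/Rle_div_l; nra. }
apply/coef_body_iff; exists (fun z => Csigma (schur1 lambda) (z * u)); split; first exact: (schur_sigma _ (fun _ => u)).
have [-> ->] := derive_schur_sigma _ _ _ H1 Hu (fun z _ => eq_refl).
split => //; rewrite /u; field; exact: n.
Qed.

Lemma body_margin_continuous (p : C * C) : continuous body_margin p.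
Proof.
have an := coef_1_neq0 P HP.
have F1 : Ccont (fun q : C * C => fst q) p by destruct p; exact: continuous_fst.
have F2 : Ccont (fun q : C * C => snd q) p by destruct p; exact: continuous_snd.
have C1 : Ccont (fun q : C * C => schur1 (fst q)) p.
{ rewrite /schur1; apply: (Ccont_div _ (fun q : C * C => 2 * fst q)) => //; last exact: Ccont_const.
  by apply: Ccont_mult => //; exact: Ccont_const. }
have C2 : Ccont (fun q : C * C => schur2 (fst q) (snd q)) p.
{ rewrite /schur2; apply: (Ccont_div _ (fun q : C * C => 6 * snd q - (coef P 2 + coef P 1 ^ 2) * schur1 (fst q) ^ 2)) => //; last exact: Ccont_const.
  apply: Ccont_minus.
  - by apply: Ccont_mult => //; exact: Ccont_const.
  - apply: Ccont_mult; first exact: Ccont_const.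
    apply: (continuous_ext (fun q : C * C => schur1 (fst q) * schur1 (fst q))); first by move=> q /=; ring.
    exact: (Ccont_mult _ (fun q : C * C => schur1 (fst q)) (fun q : C * C => schur1 (fst q))). }
have M1 := Ccont_Cmod _ _ _ C1. have M2 := Ccont_Cmod _ _ _ C2.
apply: (continuous_minus (fun q => 1 - Cmod (schur1 (fst q)) * Cmod (schur1 (fst q)))%R) => //.
apply: (continuous_minus (fun q => 1%R)); first exact: continuous_const.
exact: (continuous_mult (fun q => Cmod (schur1 (fst q)))).
Qed.

(** A point without slack leaves the body under small moves: scaling lambda by 1 + s scales [schur1]
    by 1 + s, and a suitable shift of mu scales [schur2] by 1 + s. *)
Lemma coef_body_interior (lambda mu : C) :
  @locally (prod_UniformSpace C_UniformSpace C_UniformSpace) (lambda, mu) (coef_body Omega) <->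
  (0 < body_margin (lambda, mu))%R.
Proof.
have an := coef_1_neq0 P HP.
split.
- move=> [d Hd].
  have Hd' l m : (Cmod (l - lambda) < d)%R -> (Cmod (m - mu) < d)%R -> coef_body Omega (l, m).
  { move=> Hl Hm; apply: Hd; split; exact: C_NormedModule_mixin_compat1. }
  have dp := cond_pos d.
  have near x c : (Cmod (x + (d / (2 * (Cmod c + 1)))%R * c - x) < d)%R.
  { replace (x + (d / (2 * (Cmod c + 1)))%R * c - x) with ((d / (2 * (Cmod c + 1)))%R * c) by ring.
    have c0 := Cmod_ge_0 c.
    have q0 : (0 < d / (2 * (Cmod c + 1)))%R by apply: Rdiv_lt_0_compat; lra.
    rewrite Cmod_mult Cmod_R Rabs_pos_eq; last lra.
    have : (d / (2 * (Cmod c + 1)) * (Cmod c + 1) = d / 2)%R by field; lra.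
    lra. }
  have zero x : (Cmod (x - x) < d)%R by replace (x - x) with (RtoC 0) by ring; rewrite Cmod_0.
  have pos c : (0 < d / (2 * (Cmod c + 1)))%R by apply: Rdiv_lt_0_compat => //; have := Cmod_ge_0 c; lra.
  have [h1 h2] := coef_body_necessary _ _ (Hd' lambda mu (zero _) (zero _)).
  have c0 := Cmod_ge_0 (schur1 lambda).
  have lt1 : (Cmod (schur1 lambda) < 1)%R.
  { apply: Rnot_le_lt => Hge.
    have [k _] := coef_body_necessary _ _ (Hd' _ mu (near lambda lambda) (zero _)).
    set s := (d / _)%R in k. have s0 : (0 < s)%R := pos lambda.
    have E : schur1 (lambda + s * lambda) = RtoC (1 + s) * schur1 lambda by rewrite /schur1 RtoC_plus; field.
    rewrite E Cmod_mult Cmod_R Rabs_pos_eq in k; nra. }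
  apply: Rnot_le_lt; rewrite /body_margin /= => Hle.
  (* [schur2] is affine in mu with slope 6 / [coef P 1], so adding s c to mu adds s [schur2] to
     it. *)
  set c := schur2 lambda mu * coef P 1 / 6.
  have [_ k] := coef_body_necessary _ _ (Hd' lambda _ (zero _) (near mu c)).
  set s := (d / _)%R in k. have s0 : (0 < s)%R := pos c.
  have E : schur2 lambda (mu + s * c) = RtoC (1 + s) * schur2 lambda mu.
  { rewrite RtoC_plus /c; have n6 : RtoC 6 <> 0 by move=> /RtoC_inj; lra.
    have -> : schur2 lambda (mu + s * (schur2 lambda mu * coef P 1 / 6)) = schur2 lambda mu + s * schur2 lambda mu.
    { move Eq : (schur2 lambda mu) => q.
      transitivity (schur2 lambda mu + s * q); last by rewrite Eq.
      by rewrite /schur2; field. }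
    ring. }
  rewrite E Cmod_mult Cmod_R Rabs_pos_eq in k; last lra.
  have m0 : (0 < 1 - Cmod (schur1 lambda) * Cmod (schur1 lambda))%R by nra.
  have : (0 < s * Cmod (schur2 lambda mu))%R by apply: Rmult_lt_0_compat; lra.
  lra.
- move=> H; have K := body_margin_continuous (lambda, mu) (fun y => (0 < y)%R) (open_gt 0 _ H).
  by apply: (near2 _ _ _ _ _ K K) => p Hp _; exact: coef_body_sufficient.
Qed.

End CoefficientBody.

(** The prescribed formula for gamma2 is v'(0) / (1 - |v(0)|^2), the second Schur parameter:
    |alpha1|^2 - 4 |lambda|^2 equals |alpha1|^2 (1 - |gamma1|^2). *)
Lemma gamma2_eq (P : C -> C) (lambda mu : C) : coef P 1 <> 0 -> (Cmod (schur1 P lambda) < 1)%R ->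
  schur2 P lambda mu = (1 - schur1 P lambda * Cconj (schur1 P lambda)) *
   (2 * Cconj (coef P 1) * (3 * coef P 1 ^ 2 * mu - 2 * (coef P 1 ^ 2 + coef P 2) * lambda ^ 2) /
        (coef P 1 ^ 2 * (Cmod (coef P 1) ^ 2 - 4 * Cmod lambda ^ 2)%R)).
Proof.
rewrite /schur2 /schur1; move: (coef P 1) (coef P 2) => a b an H1.
have cn : Cconj a <> 0.
{ move=> E; apply: an; apply: Cmod_eq_0; by rewrite -Cmod_conj E Cmod_0. }
have n := one_minus_norm2_neq0 _ H1.
have E : RtoC (Cmod a ^ 2 - 4 * Cmod lambda ^ 2) = a * Cconj a * (1 - 2 * lambda / a * Cconj (2 * lambda / a)).
{ have C2 : Cconj 2 = 2 by rewrite /Cconj /RtoC /= Ropp_0.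
  rewrite /Cdiv !Cmult_conj Cinv_conj // C2 RtoC_minus RtoC_mult !Cmod2_conj; field; by split. }
rewrite E; set q := 1 - 2 * lambda / a * _ in n *.
field; by do !split.
Qed.

Theorem theorem2p4
  (Omega : C -> Prop) (P : C -> C)
  (alpha1 alpha2 lambda mu gamma1 z0 : C) (gamma2 : option C)
  (HOmega : convex_domain Omega)
  (HOmega_proper : exists w, ~ Omega w)
  (HOmega1 : Omega 1)
  (HP : conformal_map P Omega)
  (HP0 : P 0 = 1)
  (Halpha1 : alpha1 = coef P 1)
  (Halpha2 : alpha2 = coef P 2)
  (Hgamma1 : gamma1 = 2 * lambda / alpha1)
  (Hgamma2 : is_gamma2 alpha1 alpha2 lambda mu gamma1 gamma2)
  (Hz0 : disk z0)
  (Hz0_neq0 : z0 <> 0) :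
  (Cmod gamma1 = 1%R -> gamma2 = Some (RtoC 0) ->
     forall w, variability_region Omega z0 lambda mu w <->
       w = Pint P (fun x => gamma1 * x) z0)
  /\
  (forall g2, (Cmod gamma1 < 1)%R -> gamma2 = Some g2 -> Cmod g2 = 1%R ->
     forall w, variability_region Omega z0 lambda mu w <->
       w = Pint P (fun x => x * Csigma gamma1 (g2 * x)) z0)
  /\
  ((Cmod gamma1 < 1)%R /\ (exists g2, gamma2 = Some g2 /\ (Cmod g2 < 1)%R) <->
     locally (lambda, mu) (coef_body Omega))
  /\
  (forall g2, (Cmod gamma1 < 1)%R -> gamma2 = Some g2 -> (Cmod g2 < 1)%R ->
     convex_univalent_analytic_on_cdisk (Qint P gamma1 g2 z0) /\
     (forall w, variability_region Omega z0 lambda mu w <->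
        image (Qint P gamma1 g2 z0) cdisk w) /\
     (forall eps f, Cmod eps = 1%R -> CV Omega f ->
        (coef f 2, coef f 3) = (lambda, mu) ->
        (log_deriv f z0 (Qint P gamma1 g2 z0 eps) <->
         forall z, disk z ->
           f z = Cint (fun x1 => Cexp (Qint P gamma1 g2 x1 eps)) z))).

Proof.
have HPc := convex_fun_of_domain P Omega HOmega HP.
have HO := proj2 (proj2 HP).
have an := coef_1_neq0 P HPc.
have E1 : gamma1 = schur1 P lambda by rewrite Hgamma1 Halpha1.
have Eg2 g2 : (Cmod gamma1 < 1)%R -> gamma2 = Some g2 -> schur2 P lambda mu = (1 - gamma1 * Cconj gamma1) * g2.
{ move=> H1 Hg; have [G _] := Hgamma2; have := G H1; rewrite Hg => -[->].
  rewrite E1 in H1 *; rewrite Halpha1 Halpha2; exact: gamma2_eq. }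
(* Dividing v'(0) = (1 - |gamma1|^2) u(0) by its nonzero factor identifies u(0) with gamma2. *)
have step (f v : C -> C) : schur v -> (Cmod gamma1 < 1)%R -> v 0 = schur1 P lambda ->
  C_derive v 0 = schur2 P lambda mu -> forall g2, gamma2 = Some g2 ->
  exists u, schur u /\ u 0 = g2 /\ forall z, disk z -> v z = Csigma gamma1 (z * u z).
{ move=> Hv H1 v0 v1 g2 Hg; have H1' : disk (v 0) by rewrite v0 -E1.
  have [u [Hu Eu]] := schur_step v Hv H1'.
  exists u; split => //; split; last by rewrite E1 -v0.
  have [_ D] := derive_schur_sigma (v 0) u v H1' Hu Eu.
  have n := one_minus_norm2_neq0 _ H1.
  have K : (1 - gamma1 * Cconj gamma1) * u 0 = (1 - gamma1 * Cconj gamma1) * g2.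
  { by rewrite -(Eg2 g2 H1 Hg) -v1 D v0 E1. }
  replace (u 0) with ((1 - gamma1 * Cconj gamma1) * u 0 / (1 - gamma1 * Cconj gamma1)) by (field; exact: n).
  rewrite K; field; exact: n. }
have fwd w : variability_region Omega z0 lambda mu w -> exists f v, CV Omega f /\ schur v /\ represents P v f /\
   log_deriv f z0 w /\ v 0 = schur1 P lambda /\ C_derive v 0 = schur2 P lambda mu.
{ move=> [f [HCV [Ec Hlog]]]; have [v [Hv R]] := CV_represents P Omega HPc HP0 HO f HCV.
  exists f, v; do 4 (split; first done); exact/(coef_iff P Omega HPc f v). }
have bwd (v omega : C -> C) : schur v -> (forall z, disk z -> omega z = z * v z) ->
  v 0 = schur1 P lambda -> C_derive v 0 = schur2 P lambda mu ->
  variability_region Omega z0 lambda mu (Pint P omega z0).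
{ move=> Hv E v0 v1; have [HCV R] := CV_of_schur P Omega HPc HP0 HO v omega Hv E.
  exists (Cint (fun x => Cexp (Pint P omega x))); split => //; split; first exact/(coef_iff P Omega HPc _ v).
  exact/(log_deriv_represents P Omega HPc HP0 _ v omega). }
split; [|split; [|split]].
- move=> H1 Hg w.
  have c2 : schur2 P lambda mu = 0.
  { have [_ [_ G]] := Hgamma2.
    (* Otherwise gamma2 would be infinity, that is [None]. *)
    have K : 3 * alpha1 ^ 2 * mu = 2 * (alpha1 ^ 2 + alpha2) * lambda ^ 2.
    { apply: NNPP => N; have := G H1 N; by rewrite Hg. }
    rewrite /schur2 /schur1.
    have -> : (6 * mu - (coef P 2 + coef P 1 ^ 2) * (2 * lambda / coef P 1) ^ 2) / coef P 1 =
      2 * (3 * coef P 1 ^ 2 * mu - 2 * (coef P 1 ^ 2 + coef P 2) * lambda ^ 2) / (coef P 1 * coef P 1 * coef P 1) by field.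
    rewrite -Halpha1 -Halpha2 K; field; by rewrite Halpha1. }
  split.
  + move=> /fwd [f [v [HCV [Hv [R [Hlog [v0 v1]]]]]]].
    apply/(log_deriv_represents P Omega HPc HP0 f v _ _ _ HCV Hv _ R Hz0 : log_deriv f z0 w <-> _) => //.
    (* |v 0| = 1, so v is constant and Schur's algorithm stops before its first step. *)
    move=> z Hz; rewrite (schur_unimodular v z Hv) ?v0 -?E1 //; ring.
  + move=> ->; apply: (bwd (fun _ => gamma1)) => //.
    * apply: schur_const; lra.
    * move=> z _; ring.
    * rewrite c2; exact: Cder_derive (Cder_const _ _).
- move=> g2 H1 Hg Hg1 w; split.
  + move=> /fwd [f [v [HCV [Hv [R [Hlog [v0 v1]]]]]]].
    have [u [Hu [u0 Eu]]] := step f v Hv H1 v0 v1 g2 Hg.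
    apply/(log_deriv_represents P Omega HPc HP0 f v _ _ _ HCV Hv _ R Hz0 : log_deriv f z0 w <-> _) => //.
    (* |u 0| = 1: the algorithm stops one step later. *)
    move=> z Hz; rewrite Eu // (schur_unimodular u z Hu) ?u0 //; by rewrite (Cmult_comm g2).
  + move=> ->.
    have Hu : schur (fun _ => g2) by apply: schur_const; lra.
    have [D0 D1] := derive_schur_sigma gamma1 _ _ H1 Hu (fun z _ => eq_refl).
    apply: (bwd (fun z => Csigma gamma1 (z * g2))).
    * exact: (schur_sigma gamma1 (fun _ => g2)).
    * by move=> z _; rewrite (Cmult_comm g2).
    * by rewrite D0.
    * by rewrite D1 (Eg2 g2).
- have M : body_margin P (lambda, mu) = (1 - Cmod gamma1 * Cmod gamma1 - Cmod (schur2 P lambda mu))%R.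
  { by rewrite /body_margin /= -E1. }
  have c0 := Cmod_ge_0 gamma1.
  have abs g2 : (Cmod gamma1 < 1)%R -> gamma2 = Some g2 ->
    Cmod (schur2 P lambda mu) = ((1 - Cmod gamma1 * Cmod gamma1) * Cmod g2)%R.
  { move=> H1 Hg; rewrite (Eg2 g2 H1 Hg) norm2_conj_neg Cmod_mult Cmod_R Rabs_pos_eq; [ring | nra]. }
  rewrite (coef_body_interior P Omega HPc HP0 HO) M; split.
  + move=> [H1 [g2 [Hg Hg1]]]; rewrite (abs g2 H1 Hg).
    have q0 : (0 < 1 - Cmod gamma1 * Cmod gamma1)%R by nra.
    have := Rmult_lt_compat_l _ _ _ q0 Hg1; lra.
  + move=> K; have s0 := Cmod_ge_0 (schur2 P lambda mu).
    have H1 : (Cmod gamma1 < 1)%R by nra.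
    split => //; have [G _] := Hgamma2; have Hg := G H1.
    eexists; split; first exact: Hg.
    have := abs _ H1 Hg; set q := Cmod (_ / _) => Q.
    have q0 : (0 < 1 - Cmod gamma1 * Cmod gamma1)%R by nra.
    apply: (Rmult_lt_reg_l _ _ _ q0); lra.
- move=> g2 H1 Hg Hg1.
  have Hg2 : disk g2 by [].
  (* With [param], this identifies the admissible v with the free parameter psi after two Schur
     steps. *)
  have layer psi : schur psi -> let v := fun z => Csigma gamma1 (z * Csigma g2 (z * psi z)) in
    schur v /\ v 0 = schur1 P lambda /\ C_derive v 0 = schur2 P lambda mu /\
      forall z, disk z -> blaschke2 gamma1 g2 psi z = z * v z.
  { move=> Hpsi v; have Hu := schur_sigma g2 psi Hg2 Hpsi.
    have [D0 D1] := derive_schur_sigma gamma1 _ v H1 Hu (fun z _ => eq_refl).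
    split; [|split; [|split]].
    - exact: (schur_sigma gamma1 (fun z => Csigma g2 (z * psi z))).
    - by rewrite D0.
    - by rewrite D1 (Eg2 g2) // Cmult_0_l sigma_0.
    - by move=> z _; rewrite /blaschke2 /v (Cmult_comm (psi z)). }
  have param (v : C -> C) : schur v -> v 0 = schur1 P lambda -> C_derive v 0 = schur2 P lambda mu ->
    exists psi, schur psi /\ forall z, disk z -> blaschke2 gamma1 g2 psi z = z * v z.
  { move=> Hv v0 v1; have [u [Hu [u0 Eu]]] := step v v Hv H1 v0 v1 g2 Hg.
    have Hu0 : disk (u 0) by rewrite u0.
    have [psi [Hpsi Epsi]] := schur_step u Hu Hu0.
    exists psi; split => // z Hz; by rewrite Eu // Epsi // u0 /blaschke2 (Cmult_comm (psi z)). }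
  split; [|split].
  + exact: Qint_convex_univalent.
  + move=> w; split.
    * move=> /fwd [f [v [HCV [Hv [R [Hlog [v0 v1]]]]]]].
      have [psi [Hpsi E]] := param v Hv v0 v1.
      have -> := proj1 (log_deriv_represents P Omega HPc HP0 f v _ z0 w HCV Hv E R Hz0) Hlog.
      exact: Qint_variability.
    * move=> [e [He <-]]; have [Hv [v0 [v1 E]]] := layer _ (schur_const e He).
      exact: (bwd _ _ Hv E v0 v1).
  + move=> eps f Heps HCV Ec.
    have en : eps <> 0 by apply/Cmod_gt_0; lra.
    have He : (Cmod eps <= 1)%R by lra.
    split.
    * move=> Hlog z Hz.
      have [v [Hv R]] := CV_represents P Omega HPc HP0 HO f HCV.
      have [v0 v1] := proj1 (coef_iff P Omega HPc f v lambda mu HCV Hv R) Ec.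
      have [psi [Hpsi E]] := param v Hv v0 v1.
      have W := proj1 (log_deriv_represents P Omega HPc HP0 f v _ z0 _ HCV Hv E R Hz0) Hlog.
      have Hbd x : disk x -> (Cmod (psi x) <= Cmod eps)%R by move=> Hx; rewrite Heps; exact: (proj2 Hpsi).
      have [_ K] := Qint_support P gamma1 g2 z0 HPc HP0 H1 Hg2 Hz0 Hz0_neq0 eps psi en He Hpsi Hbd.
      rewrite -W in K.
      have Epsi : forall x, disk x -> psi x = eps.
      (* Equal values make the numerator vanish: this is the equality case, with |psi| <= 1 =
         |eps|. *)
      { apply: K; match goal with |- Re ?q = _ => have -> : q = 0 by rewrite /Cdiv; ring end. by []. }
      have E' x : disk x -> blaschke2 gamma1 g2 (fun _ => eps) x = x * v x.
      { by move=> Hx; rewrite -E // /blaschke2 Epsi. }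
      exact: (represents_formula P Omega HPc HP0 f v _ z HCV Hv E' R Hz).
    * move=> Ef; have [Hv [v0 [v1 E]]] := layer _ (schur_const eps He).
      have [HCV0 R0] := CV_of_schur P Omega HPc HP0 HO _ _ Hv E.
      apply/(log_deriv_represents P Omega HPc HP0 f _ _ z0 _ HCV Hv E _ Hz0 : _ <-> _ = Pint _ _ _) => //.
      have Hf : hdisk f by apply/hdiskP; exact: (proj1 (proj1 HCV)).
      (* f agrees on the disk with the explicit function, hence so do f' and f'', and the same v
         represents both. *)
      have D x : disk x -> C_derive f x = C_derive (Cint (fun x => Cexp (Pint P (blaschke2 gamma1 g2 (fun _ => eps)) x))) x.
      { exact: (derive_ext_disk f). }
      move=> x Hx; rewrite -(R0 x Hx) -(D x Hx).
      by rewrite (derive_ext_disk (C_derive f) _ x (hdisk_derive f Hf) D Hx).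
Qed.
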